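(* There is a function $f$ such that every instance of $P||C_{\max}$ with $n$ jobs, $m$ machines and integer processing times bounded by $p_{\max}$ can be solved optimally in time $f(p_{\max})\cdot(n+\log m)^{O(1)}$.
   Context: $P||C_{\max}$: given $m$ identical machines and a set $J$ of $n$ jobs, each job $j$ with positive integer processing time $p_j$ and released at time $0$, assign each job non-preemptively to a machine so as to minimize the makespan (maximum total processing time on a machine). $p_{\max}:=\max_j p_j$. *)

(* Defs.v *)
From mathcomp Require Import all_boot.
Set Implicit Arguments. Unset Strict Implicit. Unset Printing Implicit Defensive.

(* Jobs are 0..n-1 with processing times p = [:: p_0; ...; p_{n-1}],   *)
(* machines are 0..m-1; a schedule is an assignment a : nat -> nat      *)
(* (job j runs on machine a j).                                        *)

Definition valid_assignment (m n : nat) (a : nat -> nat) : bool :=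
  [forall j : 'I_n, a j < m].

Definition load (p : seq nat) (a : nat -> nat) (i : nat) : nat :=
  \sum_(j < size p | a j == i) nth 0 p j.

Definition makespan (m : nat) (p : seq nat) (a : nat -> nat) : nat :=
  \max_(i < m) load p a i.

Definition optimal_schedule (m : nat) (p : seq nat) (a : nat -> nat) : Prop :=
  valid_assignment m (size p) a /\
  forall b, valid_assignment m (size p) b -> makespan m p a <= makespan m p b.

Definition pmax (p : seq nat) : nat := \max_(x <- p) x.

(* Model of computation: a logarithmic-cost RAM (Cook-Reckhow style)   *)
(* with unboundedly many natural-number registers, constants, addition,*)
(* truncated subtraction, indirect addressing and conditional jumps.   *)
(* Each executed instruction costs 1 + the bit lengths of all values   *)
(* (and indirect addresses) it touches.                                *)

Definition bits (x : nat) : nat := (trunc_log 2 x).+1.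

Inductive instr : Type :=
| IConst of nat & nat          (* IConst r c   : R[r] := c            *)
| IAdd of nat & nat & nat      (* IAdd r a b   : R[r] := R[a] + R[b]  *)
| ISub of nat & nat & nat      (* ISub r a b   : R[r] := R[a] - R[b]  *)
| ILoad of nat & nat           (* ILoad r a    : R[r] := R[R[a]]      *)
| IStore of nat & nat          (* IStore a r   : R[R[a]] := R[r]      *)
| IJz of nat & nat.            (* IJz r l      : if R[r] = 0 goto l   *)

Definition program := seq instr.

Record state := State { pc : nat; regs : nat -> nat }.

Definition upd (R : nat -> nat) (k v : nat) : nat -> nat :=
  fun i => if i == k then v else R i.

Definition halted (P : program) (s : state) : bool := size P <= pc s.

Definition step (P : program) (s : state) : state * nat :=
  let R := regs s in
  let nx := (pc s).+1 in
  match nth (IJz 0 0) P (pc s) with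
  | IConst r c => (State nx (upd R r c), 1 + bits c)
  | IAdd r a b => (State nx (upd R r (R a + R b)),
                   1 + bits (R a) + bits (R b) + bits (R a + R b))
  | ISub r a b => (State nx (upd R r (R a - R b)),
                   1 + bits (R a) + bits (R b) + bits (R a - R b))
  | ILoad r a => (State nx (upd R r (R (R a))), 1 + bits (R a) + bits (R (R a)))
  | IStore a r => (State nx (upd R (R a) (R r)), 1 + bits (R a) + bits (R r))
  | IJz r l => (State (if R r == 0 then l else nx) R, 1 + bits (R r))
  end.

Fixpoint run (P : program) (fuel : nat) (s : state) : state * nat :=
  match fuel with
  | 0 => (s, 0)
  | k.+1 =>
      if halted P s then (s, 0)
      else let (s1, c1) := step P s in
           let (s2, c2) := run P k s1 in (s2, c1 + c2)
  end.

Definition init_state (m : nat) (p : seq nat) : state :=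
  State 0 (fun i => if i == 0 then m else if i == 1 then size p
                    else nth 0 p (i - 2)).

Definition output_assignment (s : state) : nat -> nat :=
  fun j => regs s (j + 2).

Definition solves_within (P : program) (m : nat) (p : seq nat) (T : nat) : Prop :=
  exists fuel, let (s, c) := run P fuel (init_state m p) in
    [/\ halted P s, c <= T & optimal_schedule m p (output_assignment s)].

(* Main.v *)
(** A schedule only matters through the number [x i d] of jobs of size [d] on
    machine [i].  Moving single jobs between machines of very different load,
    and exchanging [e] jobs of size [d] against [d] jobs of size [e], shows that
    some optimal schedule satisfies [x i d <= x k d + P ^ 2 + P] for all machines
    [i], [k], where [P] is the largest processing time.  Hence every machine may
    receive a fixed quota of about [n_d / m] jobs of each size [d] in advance, and
    what it receives in addition is one of boundedly many configurations.

    It remains to choose a multiset of [m] configurations with a prescribed sum.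
    If configuration [k] is used [N k] times, then the multisets with
    multiplicities [i * N k %/ m], [i <= m], lead from the empty multiset to the
    whole one, and their sums stay within a bounded distance of the points
    [i / m] times the prescribed sum.  Searching only in these windows takes
    [m] rounds of bounded size; the largest load [T] allowed for a configuration
    is increased until the target is reached.  When [m > n], [n] machines suffice.

    Vectors are encoded as numbers in a radix [2 ^ L], and these numbers serve
    directly as addresses of the table of reached vectors.  A register at most
    doubles in one step, so the logarithmic cost is at most quadratic in the
    number of steps, up to the length of the input. *)

Require Import Defs.
From mathcomp Require Import all_boot zify.
Set Implicit Arguments. Unset Strict Implicit. Unset Printing Implicit Defensive.

(** * Executions and their logarithmic cost *)

(** There may be about [n ^ P] partial sums of configurations, too many to search them all; hence
    the windows. Rounding moves the path to either side of the straight line, and the shift by [W]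
    keeps every offset from the moving base point a natural number.

    Component 0 of a vector belongs to no job. It is 1 in every admissible configuration and [m] in
    the target (before the shift by [W]), so it counts machines: it forces exactly [m]
    configurations to be used, and since it drops by one along each link, following the marks
    backwards terminates.

    The quotas add the same load to every machine, so minimizing the makespan amounts to minimizing
    the largest load of a configuration. Once the target is marked, no mark changes any more; the
    loop over [T] therefore needs no exit and still keeps a solution for the first limit that
    suffices.

    From the counting phase on, all loops are bounded by one number [L], which is [n] times a
    function of [P]. Shorter loops are simulated by guards, so the running time can be read off the
    syntax. *)

Inductive reach (P : program) : nat -> state -> state -> Prop :=
| ReachRefl s : reach P 0 s s
| ReachStep k s s' :
    ~~ halted P s -> reach P k (step P s).1 s' -> reach P k.+1 s s'.

Lemma reach_trans P k1 k2 s1 s2 s3 :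
  reach P k1 s1 s2 -> reach P k2 s2 s3 -> reach P (k1 + k2) s1 s3.
Proof.
by move=> r12 r23; elim: r12 r23 => // k s s' h _ IH /IH; exact: ReachStep.
Qed.

Lemma reach_run P k s s' : reach P k s s' -> (run P k s).1 = s'.
Proof.
elim=> //= {}k {}s {}s' /negbTE -> _ <-.
by case: (step P s) => s1 c1 /=; case: (run P k s1).
Qed.

Lemma bits_le e x : 0 < e -> x < 2 ^ e -> bits x <= e.
Proof.
rewrite /bits; case: x => [|x] e0 xe; first by rewrite trunc_log0.
have := trunc_logP (isT : 1 < 2) (isT : 0 < x.+1) => h.
by rewrite -(ltn_exp2l _ _ (isT : 1 < 2)); apply: leq_ltn_trans h xe.
Qed.

Definition consts_below (P : program) (e : nat) : bool :=
  all (fun i => if i is IConst _ c then c < 2 ^ e else true) P.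

Lemma consts_belowS P e : consts_below P e -> consts_below P e.+1.
Proof.
apply: sub_all => -[] // _ c h; apply: leq_trans h _.
by rewrite leq_exp2l.
Qed.

(* One instruction at most doubles the largest register, so after [k] steps
   every operand has at most [e + k] bits. *)
Lemma run_cost P k s e : 0 < e -> consts_below P e ->
  (forall i, regs s i < 2 ^ e) -> (run P k s).2 <= k * (1 + 3 * (e + k)).
Proof.
elim: k s e => [|k IH] s e e0 cP rs //=.
case: ifP => // _.
suff: (step P s).2 <= 1 + 3 * e.+1 /\
      forall i, regs (step P s).1 i < 2 ^ e.+1.
  case: (step P s) => s1 c1 /= [hc hr].
  have := IH s1 e.+1 isT (consts_belowS cP) hr.
  case: (run P k s1) => s2 c2 /= h2; nia.
have rs1 i : regs s i < 2 ^ e.+1 by rewrite expnS; have := rs i; lia.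
have hu r v i : v < 2 ^ e.+1 -> upd (regs s) r v i < 2 ^ e.+1.
  by rewrite /upd; case: ifP.
have hb v : v < 2 ^ e.+1 -> bits v <= e.+1 by apply: bits_le.
have hc r c : nth (IJz 0 0) P (pc s) = IConst r c -> c < 2 ^ e.+1.
  move=> E; have [lt|ge] := ltnP (pc s) (size P); last by rewrite nth_default in E.
  have := all_nthP (IJz 0 0) (consts_belowS cP) _ lt.
  by rewrite E.
rewrite /step; case: (nth _ _ _) hc => [r c|r a b|r a b|r a|a r|r l] /= hc.
- by have := hc _ _ erefl => h; split=> [|i]; [have := hb _ h; lia|exact: hu].
- have h : regs s a + regs s b < 2 ^ e.+1.
    by rewrite expnS; have := rs a; have := rs b; lia.
  by split=> [|i]; [have := hb _ h; have := hb _ (rs1 a); have := hb _ (rs1 b); lia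
                   |exact: hu].
- have h : regs s a - regs s b < 2 ^ e.+1.
    by have := rs1 a; lia.
  by split=> [|i]; [have := hb _ h; have := hb _ (rs1 a); have := hb _ (rs1 b); lia
                   |exact: hu].
- split=> [|i]; last exact: hu.
  by have := hb _ (rs1 a); have := hb _ (rs1 (regs s a)); lia.
- split=> [|i]; last exact: hu.
  by have := hb _ (rs1 a); have := hb _ (rs1 r); lia.
- by split=> [|i //]; have := hb _ (rs1 r); lia.
Qed.

(** * Structured code *)

Definition effect (R : nat -> nat) (i : instr) : nat -> nat :=
  match i with
  | IConst r c => upd R r c
  | IAdd r a b => upd R r (R a + R b)
  | ISub r a b => upd R r (R a - R b)
  | ILoad r a => upd R r (R (R a))
  | IStore a r => upd R (R a) (R r)
  | IJz _ _ => R
  end.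

Definition effects (R : nat -> nat) (l : seq instr) : nat -> nat :=
  foldl effect R l.

Definition jump_free (l : seq instr) : bool :=
  all (fun i => if i is IJz _ _ then false else true) l.

Inductive code : Type :=
| Block of seq instr
| CSeq of code & code
| CIf of nat & code
| CWhile of nat & code.

Fixpoint csize (c : code) : nat :=
  match c with
  | Block l => size l
  | CSeq c1 c2 => csize c1 + csize c2
  | CIf _ c => (csize c).+1
  | CWhile _ c => (csize c).+3
  end.

(* Register 0 is zeroed before the unconditional backward jump of a loop. *)
Fixpoint assemble (l : nat) (c : code) : program :=
  match c with
  | Block b => b
  | CSeq c1 c2 => assemble l c1 ++ assemble (l + csize c1) c2
  | CIf r c => IJz r (l + (csize c).+1) :: assemble l.+1 c
  | CWhile r c =>
      IJz r (l + (csize c).+3) :: assemble l.+1 c ++ [:: IConst 0 0; IJz 0 l]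
  end.

Fixpoint jumps_ok (c : code) : bool :=
  match c with
  | Block b => jump_free b
  | CSeq c1 c2 => jumps_ok c1 && jumps_ok c2
  | CIf _ c | CWhile _ c => jumps_ok c
  end.

Lemma size_assemble l c : size (assemble l c) = csize c.
Proof.
elim: c l => //= [c1 IH1 c2 IH2|r c IH|r c IH] l; rewrite ?size_cat ?IH1 ?IH2 ?IH //=.
by rewrite addn2.
Qed.

(** Evaluation with the exact number of machine steps. In [ExecWhile1] the 3 counts the test and the
    two instructions of the backward jump, which also clears register 0 for the next turn. *)
Inductive cexec : code -> (nat -> nat) -> (nat -> nat) -> nat -> Prop :=
| ExecBlock l R : cexec (Block l) R (effects R l) (size l)
| ExecSeq c1 c2 R1 R2 R3 k1 k2 :
    cexec c1 R1 R2 k1 -> cexec c2 R2 R3 k2 -> cexec (CSeq c1 c2) R1 R3 (k1 + k2)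
| ExecIf0 r c R : R r = 0 -> cexec (CIf r c) R R 1
| ExecIf1 r c R R' k : 0 < R r -> cexec c R R' k -> cexec (CIf r c) R R' k.+1
| ExecWhile0 r c R : R r = 0 -> cexec (CWhile r c) R R 1
| ExecWhile1 r c R R1 R2 k1 k2 :
    0 < R r -> cexec c R R1 k1 -> cexec (CWhile r c) (upd R1 0 0) R2 k2 ->
    cexec (CWhile r c) R R2 (k1 + k2 + 3).

Lemma step_at P pre i post l R : P = pre ++ i :: post -> size pre = l ->
  ~~ halted P (State l R) /\ nth (IJz 0 0) P l = i.
Proof.
move=> -> <-; split; last by rewrite nth_cat ltnn subnn.
by rewrite /halted /= size_cat /= -ltnNge addnS ltnS leq_addr.
Qed.

Lemma reach_block P pre b post l R : P = pre ++ b ++ post -> size pre = l ->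
  jump_free b -> reach P (size b) (State l R) (State (l + size b) (effects R b)).
Proof.
elim: b pre l R => [|i b IH] pre l R EP El /=; first by rewrite addn0; constructor.
move=> /andP[ij bj].
have [nh ni] := step_at R (EP : P = pre ++ i :: (b ++ post)) El.
apply: ReachStep nh _.
have -> : (step P (State l R)).1 = State l.+1 (effect R i).
  by rewrite /step /= ni; case: i ij {EP ni}.
rewrite -addSnnS; apply: (IH (rcons pre i)) => //.
  by rewrite EP cat_rcons.
by rewrite size_rcons El.
Qed.

(** Jump targets are absolute, so the code sits at its address [l] inside an arbitrary program; this
    lets the induction treat all subcommands within the same program. *)
Lemma assemble_correct c R R' k : cexec c R R' k -> forall P pre post l,
  P = pre ++ assemble l c ++ post -> size pre = l -> jumps_ok c ->
  reach P k (State l R) (State (l + csize c) R').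
Proof.
elim=> {c R R' k} /=.
- by move=> b R P pre post l EP El jb; apply: reach_block EP El jb.
- move=> c1 c2 R1 R2 R3 k1 k2 _ IH1 _ IH2 P pre post l EP El /andP[j1 j2].
  apply: (@reach_trans _ _ _ _ (State (l + csize c1) R2)).
    by apply: IH1 El j1; rewrite EP -catA.
  rewrite addnA; apply: (IH2 _ (pre ++ assemble l c1)) j2.
    by rewrite EP -!catA.
  by rewrite size_cat size_assemble El.
- move=> r c R R0 P pre post l EP El jc.
  have [nh ni] := step_at R EP El.
  apply: ReachStep nh _; rewrite /step /= ni /= R0 /=; exact: ReachRefl.
- move=> r c R R' k R0 _ IH P pre post l EP El jc.
  have [nh ni] := step_at R EP El.
  apply: ReachStep nh _; rewrite /step /= ni /= (gtn_eqF R0) -addSnnS.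
  apply: (IH _ (rcons pre _)) jc; first by rewrite EP cat_rcons.
  by rewrite size_rcons El.
- move=> r c R R0 P pre post l EP El jc.
  have [nh ni] := step_at R EP El.
  apply: ReachStep nh _; rewrite /step /= ni /= R0 /=; exact: ReachRefl.
- move=> r c R R1 R2 k1 k2 R0 _ IH1 _ IH2 P pre post l EP El jc.
  have -> : k1 + k2 + 3 = (k1 + (2 + k2)).+1 by lia.
  have [nh ni] := step_at R EP El.
  apply: ReachStep nh _; rewrite /step /= ni /= (gtn_eqF R0).
  apply: (@reach_trans _ _ _ _ (State (l.+1 + csize c) R1)).
    apply: (IH1 _ (rcons pre (IJz r (l + (csize c).+3)))
                  ([:: IConst 0 0; IJz 0 l] ++ post)) jc.
      by rewrite EP cat_rcons /= -catA.
    by rewrite size_rcons El.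
  apply: reach_trans (IH2 _ pre post l EP El jc).
  pose pre1 := rcons pre (IJz r (l + (csize c).+3)) ++ assemble l.+1 c.
  have EP1 : P = pre1 ++ IConst 0 0 :: IJz 0 l :: post.
    by rewrite EP /pre1 -catA cat_rcons /= -catA.
  have Epre1 : size pre1 = l.+1 + csize c.
    by rewrite size_cat size_rcons size_assemble El.
  have [nh1 ni1] := step_at R1 EP1 Epre1.
  apply: ReachStep nh1 _; rewrite {1}/step /= ni1 /=.
  have EP2 : P = rcons pre1 (IConst 0 0) ++ IJz 0 l :: post by rewrite cat_rcons.
  have Epre2 : size (rcons pre1 (IConst 0 0)) = (l.+1 + csize c).+1.
    by rewrite size_rcons Epre1.
  have [nh2 ni2] := step_at (upd R1 0 0) EP2 Epre2.
  apply: ReachStep nh2 _; rewrite /step /= ni2 /=; exact: ReachRefl.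
Qed.

(** * A language with named unbounded arrays and counted loops *)

Definition store := nat -> nat -> nat.

Definition set_cell (s : store) (a i v : nat) : store :=
  fun a' i' => if (a' == a) && (i' == i) then v else s a' i'.

Inductive expr : Type :=
| Num of nat
| Cell of nat & expr
| Add of expr & expr
| Sub of expr & expr.

Inductive cmd : Type :=
| Put of nat & expr & expr
| Then of cmd & cmd
| When of expr & cmd
| Loop of nat & nat & cmd.

Fixpoint eval (s : store) (e : expr) : nat :=
  match e with
  | Num n => n
  | Cell a e => s a (eval s e)
  | Add e1 e2 => eval s e1 + eval s e2
  | Sub e1 e2 => eval s e1 - eval s e2
  end.

(** A loop fixes its number of turns on entry, which makes [exec] a total function. A compiled loop
    reads its bound again in every turn; the two agree because [cmd_ok] forbids writing to the
    bound. *)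
Fixpoint exec (c : cmd) (s : store) : store :=
  match c with
  | Put a e1 e2 => set_cell s a (eval s e1) (eval s e2)
  | Then c1 c2 => exec c2 (exec c1 s)
  | When e c => if eval s e == 0 then s else exec c s
  | Loop i x c =>
      iter (s x 0) (fun s' => set_cell (exec c s') i 0 (s' i 0).+1)
           (set_cell s i 0 0)
  end.

Fixpoint reads (e : expr) : seq nat :=
  match e with
  | Num _ => [::]
  | Cell a e => a :: reads e
  | Add e1 e2 | Sub e1 e2 => reads e1 ++ reads e2
  end.

Fixpoint writes (c : cmd) : seq nat :=
  match c with
  | Put a _ _ => [:: a]
  | Then c1 c2 => writes c1 ++ writes c2
  | When _ c => writes c
  | Loop i _ c => i :: writes c
  end.

Fixpoint bounds (c : cmd) : seq nat :=
  match c with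
  | Put _ _ _ => [::]
  | Then c1 c2 => bounds c1 ++ bounds c2
  | When _ c => bounds c
  | Loop _ x c => x :: bounds c
  end.

Definition agree (X : seq nat) (s s' : store) : Prop :=
  forall a, a \notin X -> forall i, s' a i = s a i.

Lemma agree_sub X Y s s' : {subset X <= Y} -> agree X s s' -> agree Y s s'.
Proof. by move=> XY h a aY; apply: h; apply: contra aY; apply: XY. Qed.

Lemma agree_trans X s1 s2 s3 : agree X s1 s2 -> agree X s2 s3 -> agree X s1 s3.
Proof. by move=> h1 h2 a aX i; rewrite h2 // h1. Qed.

Lemma agree_set X s a i v : a \in X -> agree X s (set_cell s a i v).
Proof.
by move=> aX b bX j; rewrite /set_cell; case: eqP bX => [->|]; rewrite ?aX.
Qed.

Lemma exec_agree c s : agree (writes c) s (exec c s).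
Proof.
elim: c s => [a e1 e2|c1 IH1 c2 IH2|e c IH|i x c IH] s /=.
- by apply: agree_set; rewrite inE.
- apply: (@agree_trans _ _ (exec c1 s)).
    by apply: agree_sub (IH1 s) => y; rewrite mem_cat => ->.
  by apply: agree_sub (IH2 _) => y; rewrite mem_cat orbC => ->.
- by case: eqP => // _; apply: IH.
- have h0 : agree (i :: writes c) s (set_cell s i 0 0).
    by apply: agree_set; rewrite inE eqxx.
  elim: (s x 0) => //= k IHk.
  apply: agree_trans IHk _; set s1 := iter _ _ _.
  apply: (@agree_trans _ _ (exec c s1)); last first.
    by apply: agree_set; rewrite inE eqxx.
  by apply: agree_sub (IH s1) => y; rewrite inE orbC => ->.
Qed.

Lemma exec_frame c s a j : a \notin writes c -> exec c s a j = s a j.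
Proof. by move=> h; rewrite exec_agree. Qed.

Lemma eval_agree X s s' e : agree X s s' -> all (fun a => a \notin X) (reads e) ->
  eval s' e = eval s e.
Proof.
move=> h; elim: e => //= [a e IH|e1 IH1 e2 IH2|e1 IH1 e2 IH2].
- by case/andP=> aX /IH ->; rewrite h.
- by rewrite all_cat => /andP[/IH1 -> /IH2 ->].
- by rewrite all_cat => /andP[/IH1 -> /IH2 ->].
Qed.

Lemma loop_rule (I : nat -> store -> Prop) i x c s0 :
  x \notin i :: writes c -> i \notin writes c ->
  I 0 (set_cell s0 i 0 0) ->
  (forall k s, k < s0 x 0 -> s i 0 = k -> agree (i :: writes c) s0 s ->
     I k s -> I k.+1 (set_cell (exec c s) i 0 k.+1)) ->
  I (s0 x 0) (exec (Loop i x c) s0).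
Proof.
move=> hx hi I0 IS /=; set body := fun _ => _.
have h0 : agree (i :: writes c) s0 (set_cell s0 i 0 0).
  by apply: agree_set; rewrite inE eqxx.
suff: forall k, k <= s0 x 0 -> let s := iter k body (set_cell s0 i 0 0) in
    [/\ s i 0 = k, agree (i :: writes c) s0 s & I k s].
  by move=> h; have [] := h (s0 x 0) (leqnn _).
elim=> [|k IH] hk /=; first by split=> //; rewrite /set_cell !eqxx.
have [] := IH (ltnW hk); set s := iter _ _ _ => e1 e2 e3.
rewrite {1 2 3}/body e1; split; first by rewrite /set_cell !eqxx.
  apply: agree_trans e2 _; apply: (@agree_trans _ _ (exec c s)).
    by apply: (agree_sub _ (@exec_agree c s)) => y yc; rewrite inE yc orbT.
  by apply: agree_set; rewrite inE eqxx.
exact: IS.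
Qed.

(* [For i x e c] runs [c] for [i = 0 .. e - 1], as long as [e] does not
   exceed the value of [x]: the loop itself always makes [x] turns. *)
Definition For (i x : nat) (e : expr) (c : cmd) : cmd :=
  Loop i x (When (Sub e (Cell i (Num 0))) c).

Lemma for_rule (I : nat -> store -> Prop) i x e c s0 N :
  x \notin i :: writes c -> i \notin writes c ->
  all (fun a => a \notin i :: writes c) (reads e) ->
  eval s0 e = N -> N <= s0 x 0 ->
  (forall k s v, I k s -> I k (set_cell s i 0 v)) ->
  I 0 s0 ->
  (forall k s, k < N -> s i 0 = k -> agree (i :: writes c) s0 s ->
     I k s -> I k.+1 (exec c s)) ->
  I N (exec (For i x e c) s0).
Proof.
move=> hx hi he eN leN st I0 IS.
have -> : N = minn (s0 x 0) N by apply/esym/minn_idPr.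
(* The turns after the first [N] are idle, so the invariant stays at [I N]. *)
pose J k := I (minn k N).
apply: (@loop_rule J) => //; first by rewrite /J min0n; apply: st.
move=> k s hk sk hs; rewrite /J => Ik; apply: st.
rewrite /= sk (eval_agree hs he) eN.
case: eqP => [e0|e0].
  by have -> : minn k.+1 N = minn k N by lia.
have kN : k < N by lia.
have -> : minn k.+1 N = k.+1 by lia.
by apply: IS => //; move: Ik; have -> : minn k N = k by lia.
Qed.

(** * Compiling the array language *)

(* Cell [i] of array [a < 64] lives at address [base + a + 64 * i]; register 2
   holds [base], registers 3 to 15 are temporaries. *)
Definition represents (base : nat) (R : nat -> nat) (s : store) : Prop :=
  [/\ 16 <= base, R 2 = base &
      forall a i, a < 64 -> R (base + a + 64 * i) = s a i].

(** Six doublings replace the multiplication by 64. *)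
Definition address (r a : nat) : seq instr :=
  nseq 6 (IAdd r r r) ++ [:: IConst r.+1 a; IAdd r r r.+1; IAdd r r 2].

Fixpoint ecode (r : nat) (e : expr) : seq instr :=
  match e with
  | Num n => [:: IConst r n]
  | Cell a e => ecode r e ++ address r a ++ [:: ILoad r r]
  | Add e1 e2 => ecode r e1 ++ ecode r.+1 e2 ++ [:: IAdd r r r.+1]
  | Sub e1 e2 => ecode r e1 ++ ecode r.+1 e2 ++ [:: ISub r r r.+1]
  end.

(** Bounds the registers, counted from [r], that [ecode r e] overwrites; a cell needs two because
    [address] uses [r.+1] as scratch. *)
Fixpoint edepth (e : expr) : nat :=
  match e with
  | Num _ => 1
  | Cell _ e => maxn 2 (edepth e)
  | Add e1 e2 | Sub e1 e2 => maxn (edepth e1) (edepth e2).+1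
  end.

Definition expr_ok (e : expr) : bool :=
  all (fun a => a < 64) (reads e) && (edepth e <= 10).

Definition put_code (a : nat) (e1 e2 : expr) : seq instr :=
  ecode 3 e1 ++ address 3 a ++ ecode 4 e2 ++ [:: IStore 3 4].

Definition loop_test (i x : nat) : expr := Sub (Cell x (Num 0)) (Cell i (Num 0)).

Definition loop_next (i : nat) : seq instr :=
  put_code i (Num 0) (Add (Cell i (Num 0)) (Num 1)).

Definition loop_init (i x : nat) : seq instr :=
  put_code i (Num 0) (Num 0) ++ ecode 3 (loop_test i x).

Definition loop_step (i x : nat) : seq instr :=
  loop_next i ++ ecode 3 (loop_test i x).

Arguments loop_init : simpl never.
Arguments loop_step : simpl never.

Fixpoint compile (c : cmd) : code :=
  match c with
  | Put a e1 e2 => Block (put_code a e1 e2)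
  | Then c1 c2 => CSeq (compile c1) (compile c2)
  | When e c => CSeq (Block (ecode 3 e)) (CIf 3 (compile c))
  | Loop i x c =>
      CSeq (Block (loop_init i x))
        (CWhile 3 (CSeq (compile c) (Block (loop_step i x))))
  end.

(* Besides name and register ranges, this requires loop bounds never to be
   overwritten, which makes the running time a function of their values. *)
Fixpoint cmd_ok (c : cmd) : bool :=
  match c with
  | Put a e1 e2 => [&& a < 64, expr_ok e1 & expr_ok e2]
  | Then c1 c2 =>
      [&& cmd_ok c1, cmd_ok c2 & all (fun x => x \notin writes c1) (bounds c2)]
  | When e c => expr_ok e && cmd_ok c
  | Loop i x c =>
      [&& i < 64, x < 64, i \notin writes c, cmd_ok c &
          all (fun y => y \notin i :: writes c) (x :: bounds c)]
  end.

Fixpoint time (L : nat) (c : cmd) : nat :=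
  match c with
  | Put a e1 e2 => size (put_code a e1 e2)
  | Then c1 c2 => time L c1 + time L c2
  | When e c => size (ecode 3 e) + (time L c).+1
  | Loop i x c =>
      size (loop_init i x) + (L * (time L c + size (loop_step i x) + 3)).+1
  end.

Definition outside (r : nat) (R R' : nat -> nat) : Prop :=
  forall j, (j < r) || (16 <= j) -> R' j = R j.

Lemma represents_outside base R R' s :
  outside 3 R R' -> represents base R s -> represents base R' s.
Proof.
move=> h [b16 R2 Rs]; split=> //; first by rewrite h.
by move=> a i a64; rewrite h ?Rs //; apply/orP; right; lia.
Qed.

Lemma effects_cat R l1 l2 : effects R (l1 ++ l2) = effects (effects R l1) l2.
Proof. exact: foldl_cat. Qed.

Lemma outside_weak r r' R R' : r <= r' -> outside r' R R' -> outside r R R'.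
Proof. by move=> rr h j hj; apply: h; lia. Qed.

Lemma outside_trans r R1 R2 R3 : outside r R1 R2 -> outside r R2 R3 -> outside r R1 R3.
Proof. by move=> h1 h2 j hj; rewrite h2 // h1. Qed.

Lemma outside_upd r r' R v : r <= r' -> r' < 16 -> outside r R (upd R r' v).
Proof. by move=> h1 h2 j hj; rewrite /upd; case: eqP => // e; lia. Qed.

Lemma effects_double r R : forall k, let R' := effects R (nseq k (IAdd r r r)) in
  R' r = R r * 2 ^ k /\ forall j, j != r -> R' j = R j.
Proof.
move=> k; elim: k R => [|k IH] R /=; first by rewrite muln1.
have [h1 h2] := IH (upd R r (R r + R r)); split.
  by rewrite h1 /upd eqxx expnS; lia.
by move=> j jr; rewrite h2 // /upd (negbTE jr).
Qed.

Lemma address_ok r a R : 3 <= r -> r.+1 < 16 ->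
  let R' := effects R (address r a) in
  R' r = R 2 + a + 64 * R r /\ outside r R R'.
Proof.
move=> r3 r16; rewrite /address effects_cat.
have [] := effects_double r R 6; set R1 := effects R _ => h1 h2.
rewrite /= /upd !eqxx /=.
have -> : (2 == r.+1) = false by lia.
have -> : (r == r.+1) = false by lia.
have -> : (2 == r) = false by lia.
split.
  by rewrite h1 h2; [lia|apply/eqP; lia].
move=> j hj; have -> : (j == r) = false by lia.
have -> : (j == r.+1) = false by lia.
by apply: h2; lia.
Qed.

Lemma ecode_ok base r e R s : represents base R s -> 3 <= r -> r + edepth e <= 16 ->
  all (fun a => a < 64) (reads e) ->
  let R' := effects R (ecode r e) in R' r = eval s e /\ outside r R R'.
Proof.
elim: e r R => [n|a e IH|e1 IH1 e2 IH2|e1 IH1 e2 IH2] r R hR r3.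
- move=> /= h _; split; first by rewrite /upd eqxx.
  by apply: outside_upd => //; lia.
- rewrite [edepth _]/= [reads _]/= [all _ _]/= => h /andP[a64 he].
  change (ecode r (Cell a e)) with (ecode r e ++ address r a ++ [:: ILoad r r]).
  rewrite 2!effects_cat.
  have [] := IH r R hR r3 _ he; first lia.
  set R1 := effects R _ => v1 o1.
  have [] := @address_ok r a R1 r3; first lia.
  set R2 := effects R1 _ => v2 o2 /=.
  have o12 := outside_trans o1 o2.
  have [_ _ hs] := represents_outside (outside_weak r3 o12) hR.
  have [_ Rb _] := represents_outside (outside_weak r3 o1) hR.
  split; first by rewrite /upd eqxx v2 v1 Rb hs.
  by apply: outside_trans o12 _; apply: outside_upd => //; lia.
- move=> /= h; rewrite all_cat => /andP[n1 n2]; rewrite !effects_cat.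
  have [] := IH1 r R hR r3 _ n1; first lia.
  set R1 := effects R _ => v1 o1.
  have hR1 := represents_outside (outside_weak r3 o1) hR.
  have [] := IH2 r.+1 R1 hR1 (ltnW r3 : 3 <= r.+1) _ n2; first lia.
  set R2 := effects R1 _ => v2 o2 /=.
  split; first by rewrite /upd eqxx v2 o2 ?v1 // ltnSn.
  apply: outside_trans o1 _; apply: outside_trans (outside_weak (leqnSn r) o2) _.
  by apply: outside_upd => //; lia.
- move=> /= h; rewrite all_cat => /andP[n1 n2]; rewrite !effects_cat.
  have [] := IH1 r R hR r3 _ n1; first lia.
  set R1 := effects R _ => v1 o1.
  have hR1 := represents_outside (outside_weak r3 o1) hR.
  have [] := IH2 r.+1 R1 hR1 (ltnW r3 : 3 <= r.+1) _ n2; first lia.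
  set R2 := effects R1 _ => v2 o2 /=.
  split; first by rewrite /upd eqxx v2 o2 ?v1 // ltnSn.
  apply: outside_trans o1 _; apply: outside_trans (outside_weak (leqnSn r) o2) _.
  by apply: outside_upd => //; lia.
Qed.

Lemma put_code_ok base a e1 e2 R s : represents base R s -> a < 64 ->
  expr_ok e1 -> expr_ok e2 ->
  represents base (effects R (put_code a e1 e2)) (set_cell s a (eval s e1) (eval s e2)).
Proof.
move=> hR a64 /andP[n1 d1] /andP[n2 d2]; rewrite /put_code 3!effects_cat.
have [] := @ecode_ok base 3 e1 R s hR isT _ n1; first lia.
set R1 := effects R _ => v1 o1.
have [] := @address_ok 3 a R1 isT isT; set R2 := effects R1 _ => v2 o2.
have hR1 := represents_outside o1 hR.
have hR2 := represents_outside o2 hR1.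
have [] := @ecode_ok base 4 e2 R2 s hR2 isT _ n2; first lia.
set R3 := effects R2 _ => v3 o3 /=.
have [b16 R32 R3s] := represents_outside (outside_weak (isT : 3 <= 4) o3) hR2.
have [_ R12 _] := hR1.
rewrite v3 (o3 3 isT) v2 v1 R12; split=> //.
  by rewrite /upd; case: eqP => // e; lia.
move=> b i b64; rewrite /upd /set_cell.
case: (b =P a) => [->|ba] /=.
  case: (i =P eval s e1) => [->|ii]; first by rewrite eqxx.
  by case: eqP => [e|_]; [lia|rewrite R3s].
by case: eqP => [e|_]; [lia|rewrite R3s].
Qed.

Theorem compile_correct base L c R s : represents base R s -> cmd_ok c ->
  (forall x, x \in bounds c -> s x 0 <= L) ->
  exists R' k, [/\ cexec (compile c) R R' k, represents base R' (exec c s)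
                 & k <= time L c].
Proof.
elim: c R s => [a e1 e2|c1 IH1 c2 IH2|e c IH|i x c IH] R s hR /=.
- case/and3P=> a64 h1 h2 _.
  exists (effects R (put_code a e1 e2)), (size (put_code a e1 e2)).
  by split; [exact: ExecBlock|exact: put_code_ok|].
- case/and3P=> w1 w2 /allP w12 hL.
  have [|R1 [k1 [x1 r1 t1]]] := IH1 R s hR w1.
    by move=> x xb; apply: hL; rewrite mem_cat xb.
  have [|R2 [k2 [x2 r2 t2]]] := IH2 R1 _ r1 w2.
    by move=> x xb; rewrite exec_frame ?w12 //; apply: hL; rewrite mem_cat xb orbT.
  by exists R2, (k1 + k2); split; [exact: ExecSeq x1 x2|exact: r2|lia].
- case/andP=> /andP[ne de] w hL.
  have [] := @ecode_ok base 3 e R s hR isT _ ne; first lia.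
  set R1 := effects R _ => v1 o1.
  have hR1 := represents_outside o1 hR.
  have xb : cexec (Block (ecode 3 e)) R R1 (size (ecode 3 e)) := ExecBlock _ _.
  case: eqP => [e0|/eqP e0].
    exists R1, (size (ecode 3 e) + 1); split=> //; last by lia.
    by apply: ExecSeq xb _; apply: ExecIf0; rewrite v1.
  have [R2 [k [x2 r2 t2]]] := IH R1 s hR1 w hL.
  exists R2, (size (ecode 3 e) + k.+1); split=> //; last by lia.
  by apply: ExecSeq xb _; apply: ExecIf1 x2; rewrite v1 lt0n.
- case/and5P=> i64 x64 iw w /andP[xw /allP bw] hL.
  have tn : all (fun a => a < 64) (reads (loop_test i x)) by rewrite /= x64 i64.
  pose body (s' : store) := set_cell (exec c s') i 0 (s' i 0).+1.
  set N := s x 0.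
  have NL : N <= L by apply: hL; rewrite inE eqxx.
  pose s1 := set_cell s i 0 0.
  have hR1 : represents base (effects R (put_code i (Num 0) (Num 0))) s1.
    exact: put_code_ok.
  have [] := @ecode_ok base 3 (loop_test i x) _ s1 hR1 isT isT tn.
  rewrite -effects_cat -/(loop_init i x); set R2 := effects R _ => v2 o2.
  have hR2 := represents_outside o2 hR1.
  have xi : x != i by move: xw; rewrite inE negb_or => /andP[].
  have ag1 : agree (i :: writes c) s s1 by apply: agree_set; rewrite inE eqxx.
  set T := time L c + size (loop_step i x) + 3.
  (* Induction on the turns left, the number that register 3 holds at each loop test. *)
  suff main : forall k R s', k <= N -> represents base R s' ->
      agree (i :: writes c) s s' -> s' i 0 = N - k -> R 3 = k ->
      exists R' t, [/\ cexec (CWhile 3 (CSeq (compile c) (Block (loop_step i x))))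
                          R R' t,
                       represents base R' (iter k body s') & t <= (k * T).+1].
    have [||R' [t [x3 r3 t3]]] := main N R2 s1 (leqnn _) hR2 ag1.
    - by rewrite subnn /s1 /set_cell !eqxx.
    - by rewrite v2 /= /s1 /set_cell !eqxx (negbTE xi) subn0.
    exists R', (size (loop_init i x) + t); split=> //.
    - by apply: ExecSeq x3; exact: ExecBlock.
    - by rewrite leq_add2l; apply: leq_trans t3 _; rewrite ltnS leq_mul2r NL orbT.
  elim=> [|k IHk] {hR hR1 hR2 R2 v2 o2 ag1} R0 s' hk hR0 ag si R03.
    by exists R0, 1; split=> //; exact: ExecWhile0.
  have [|Ra [ka [xa ra ta]]] := IH R0 s' hR0 w.
    by move=> y yb; rewrite ag ?bw //; apply: hL; rewrite inE yb orbT.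
  have sa : exec c s' i 0 = s' i 0 by rewrite exec_frame.
  have aga : agree (i :: writes c) s (body s').
    apply: agree_trans ag _; apply: (@agree_trans _ _ (exec c s')).
      by apply: (agree_sub _ (@exec_agree c s')) => y yc; rewrite inE yc orbT.
    by apply: agree_set; rewrite inE eqxx.
  have rb : represents base (effects Ra (loop_next i)) (body s').
    have -> : body s' = set_cell (exec c s') i (eval (exec c s') (Num 0))
                (eval (exec c s') (Add (Cell i (Num 0)) (Num 1))).
      by rewrite /body /= sa addn1.
    by apply: put_code_ok => //; rewrite /expr_ok /= i64.
  have [] := @ecode_ok base 3 (loop_test i x) _ _ rb isT isT tn.
  rewrite -effects_cat -/(loop_step i x); move ERb: (effects Ra _) => Rb vb ob.
  have rb' := represents_outside ob rb.
  have vb' : Rb 3 = k.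
    rewrite vb /= aga // -/N /body /set_cell !eqxx /= si; lia.
  (* Register 0, cleared by the backward jump, lies outside the represented store. *)
  have rc : represents base (upd Rb 0 0) (body s').
    case: rb' => b16 Rb2 Rbs; split=> // a j a64.
    by rewrite /upd; case: eqP => [e|_]; [lia|exact: Rbs].
  have [||R' [t [x3 r3 t3]]] := IHk _ _ (ltnW hk) rc aga.
  - by rewrite /body /set_cell !eqxx /= si; lia.
  - by rewrite /upd /= vb'.
  exists R', (ka + size (loop_step i x) + t + 3); split.
  - apply: ExecWhile1 x3; first by rewrite R03.
    by apply: ExecSeq xa _; rewrite -ERb; exact: ExecBlock.
  - by rewrite iterSr.
  - by rewrite mulSn /T; lia.
Qed.

Fixpoint depth (c : cmd) : nat :=
  match c with
  | Put _ _ _ => 0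
  | Then c1 c2 => maxn (depth c1) (depth c2)
  | When _ c => depth c
  | Loop _ _ c => (depth c).+1
  end.

(** Each loop level costs at most a factor [L.+1] over the time with all bounds equal to 1;
    [time 1 c] thus serves as a coefficient that never has to be computed. *)
Lemma time_bound L c : time L c <= time 1 c * L.+1 ^ depth c.
Proof.
have pos k : 0 < L.+1 ^ k by rewrite expn_gt0.
elim: c => [a e1 e2|c1 IH1 c2 IH2|e c IH|i x c IH] /=.
- by rewrite muln1.
- rewrite mulnDl; apply: leq_add.
    by apply: leq_trans IH1 _; rewrite leq_mul2l leq_pexp2l ?leq_maxl ?orbT.
  by apply: leq_trans IH2 _; rewrite leq_mul2l leq_pexp2l ?leq_maxr ?orbT.
- have := pos (depth c); move: (L.+1 ^ _) IH => X; nia.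
- have := pos (depth c); rewrite expnS; move: (L.+1 ^ _) IH => X.
  move: (size (loop_init i x)) (size (loop_step i x)) (time L c) (time 1 c) => A B C D; nia.
Qed.

Lemma jump_free_ecode r e : jump_free (ecode r e).
Proof.
elim: e r => //= [a e IH|e1 IH1 e2 IH2|e1 IH1 e2 IH2] r;
  by rewrite /jump_free !all_cat /= ?[all _ _]IH ?[all _ (ecode r e1)]IH1
             ?[all _ (ecode _ e2)]IH2.
Qed.

Lemma jumps_ok_compile c : jumps_ok (compile c).
Proof.
have E r e : all (fun i => if i is IJz _ _ then false else true) (ecode r e).
  exact: jump_free_ecode.
elim: c => //= [a e1 e2|c1 -> c2 ->|e c ->|i x c ->] //.
- by rewrite /jump_free /put_code !all_cat !E.
- by rewrite /jump_free E.
Qed.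

(** * Loading the input and unloading the output *)

Definition writes_temps (lo : nat) (l : seq instr) : bool :=
  all (fun i => match i with
    | IConst r _ | IAdd r _ _ | ISub r _ _ | ILoad r _ => (lo <= r) && (r < 16)
    | IStore _ _ | IJz _ _ => false end) l.

Lemma effects_outside lo l R : writes_temps lo l -> outside lo R (effects R l).
Proof.
elim: l R => [|i l IH] R //= /andP[hi /IH {}IH].
apply: outside_trans (IH _) => j hj; rewrite /effect.
by case: i hi => // [r c|r a b|r a b|r a] h; rewrite /upd; case: eqP => // e; lia.
Qed.

Definition save_temps (k l : nat) : seq instr :=
  flatten [seq [:: IAdd 1 1 2; IStore 1 j] | j <- iota k l].

Lemma save_tempsP k l R : 2 < k -> k + l <= 16 -> R 2 = 64 -> 16 <= R 1 ->
  let R' := effects R (save_temps k l) in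
  [/\ R' 1 = R 1 + 64 * l,
      forall t, t < l -> R' (R 1 + 64 * t.+1) = R (k + t)
    & forall x, x != 1 -> (forall t, t < l -> x != R 1 + 64 * t.+1) -> R' x = R x].
Proof.
elim: l k R => [|l IH] k R k2 kl R2 R1; first by split=> //=; rewrite muln0 addn0.
rewrite /save_temps [iota k _]/= [map _ _]/= [flatten _]/=.
rewrite -/(save_temps _ _).
change (effects R (IAdd 1 1 2 :: IStore 1 k :: save_temps k.+1 l)) with
  (effects (effects R [:: IAdd 1 1 2; IStore 1 k]) (save_temps k.+1 l)).
set Ra := effects R _.
have a1 : Ra 1 = R 1 + 64.
  by rewrite /Ra /= /upd /= R2; case: eqP => // e; lia.
have ax x : x != 1 -> x != R 1 + 64 -> Ra x = R x.
  by move=> h1 h2; rewrite /Ra /= /upd /= R2 (negbTE h1) (negbTE h2).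
have ak : Ra (R 1 + 64) = R k.
  by rewrite /Ra /= /upd /= R2 eqxx; case: eqP => // e; lia.
have a2 : Ra 2 = 64 by rewrite ax //; apply/eqP; lia.
case: (IH k.+1 Ra) => //; try lia.
move=> h1 h2 h3; split; first by rewrite h1 a1; lia.
- case=> [|t] ht.
    rewrite addn0 muln1 h3 ?ak //; first by apply/eqP; lia.
    by move=> t _; rewrite a1; apply/eqP; lia.
  have -> : R 1 + 64 * t.+2 = Ra 1 + 64 * t.+1 by rewrite a1; lia.
  rewrite h2 // ax; first by congr R; lia.
    by apply/eqP; lia.
  by apply/eqP; lia.
- move=> x x1 hx; rewrite h3 //.
    by apply: ax => //; have := hx 0 isT; rewrite muln1.
  move=> t tl; rewrite a1; have := hx t.+1 tl; lia.
Qed.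

Lemma count_loop k R : R 6 = 64 * k -> R 7 = 64 -> R 8 = 1 ->
  exists R', [/\ cexec (CWhile 6 (Block [:: ISub 6 6 7; IAdd 5 5 8])) R R' (5 * k + 1),
    R' 5 = R 5 + k & forall j, j \notin [:: 0; 5; 6] -> R' j = R j].
Proof.
elim: k R => [|k IH] R R6 R7 R8.
  by exists R; split=> //; [exact: ExecWhile0|rewrite addn0].
pose Ra := upd (effects R [:: ISub 6 6 7; IAdd 5 5 8]) 0 0.
have a6 : Ra 6 = 64 * k by rewrite /Ra /= /upd /= R6 R7; lia.
have a7 : Ra 7 = 64 by rewrite /Ra /= /upd /= R7.
have a8 : Ra 8 = 1 by rewrite /Ra /= /upd /= R8.
have [R' [h1 h2 h3]] := IH Ra a6 a7 a8.
exists R'; split.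
- have -> : 5 * k.+1 + 1 = 2 + (5 * k + 1) + 3 by lia.
  apply: ExecWhile1 h1; first by rewrite R6; lia.
  exact: ExecBlock.
- by rewrite h2 /Ra /= /upd /= R8; lia.
- move=> j hj; rewrite h3 // /Ra /= /upd /=.
  by move: hj; rewrite !inE !negb_or => /and3P[/negbTE -> /negbTE -> /negbTE ->].
Qed.

(* Registers 9 and 10 point to a sequence of stride 1 and to one of stride 64;
   [b] tells which of them is the source. *)
Definition copy_loop (b : bool) : code :=
  CWhile 12 (Block [:: ILoad 13 (if b then 9 else 10);
                       IStore (if b then 10 else 9) 13;
                       IAdd 9 9 8; IAdd 10 10 7; ISub 12 12 8]).

(** The condition [R 9 + k < R 10] puts the sequence of stride 1 entirely below the one of stride
    64, so in either direction no source is overwritten before it is read. *)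
Lemma copy_loopP (b : bool) k R : R 7 = 64 -> R 8 = 1 -> R 12 = k ->
  16 <= R 9 -> R 9 + k < R 10 ->
  let src t := if b then R 9 + t else R 10 + 64 * t in
  let dst t := if b then R 10 + 64 * t else R 9 + t in
  exists R', [/\ cexec (copy_loop b) R R' (8 * k + 1),
    forall t, t < k -> R' (dst t) = R (src t),
    forall x, 16 <= x -> (forall t, t < k -> x != dst t) -> R' x = R x
  & forall x, x < 16 -> x \notin [:: 0; 9; 10; 12; 13] -> R' x = R x].
Proof.
elim: k R => [|k IH] R R7 R8 R12 R9 R10 src dst.
  by exists R; split=> //; exact: ExecWhile0.
set blk := [:: ILoad 13 (if b then 9 else 10); IStore (if b then 10 else 9) 13;
               IAdd 9 9 8; IAdd 10 10 7; ISub 12 12 8].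
pose Ra := upd (effects R blk) 0 0.
pose D := dst 0.
have D16 : 16 <= D by rewrite /D /dst; case: (b); lia.
have hD : D = R (if b then 10 else 9) by rewrite /D /dst; case: (b); rewrite ?muln0 addn0.
have hs0 : src 0 = R (if b then 9 else 10).
  by rewrite /src; case: (b); rewrite ?muln0 addn0.
have RaE x : Ra x = if x == 0 then 0 else if x == 12 then k else if x == 10 then R 10 + 64
   else if x == 9 then R 9 + 1 else if x == D then R (src 0) else
   if x == 13 then R (src 0) else R x.
  rewrite /Ra /blk /effects /= hD hs0 /upd.
  move: D16; rewrite hD => D16.
  have [E7 E8 E12] : [/\ (7 == R (if b then 10 else 9)) = false,
    (8 == R (if b then 10 else 9)) = false & (12 == R (if b then 10 else 9)) = false].
    by split; apply/negbTE/eqP; lia.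
  have [E9 E10] : (9 == R (if b then 10 else 9)) = false /\
     (10 == R (if b then 10 else 9)) = false by split; apply/negbTE/eqP; lia.
  have Eb : ((if b then 10 else 9) == 13) = false by case: (b).
  rewrite Eb /= E9 E10 E7 E8 E12 /= R7 R8 R12 subn1.
  by [].
have hx x : 16 <= x -> x != D -> Ra x = R x.
  move=> x16 xD; rewrite RaE (negbTE xD).
  by do ?(case: eqP => [e|_]; first lia).
have Ra7 : Ra 7 = 64 by rewrite RaE /= R7; case: eqP => // e; lia.
have Ra8 : Ra 8 = 1 by rewrite RaE /= R8; case: eqP => // e; lia.
have Ra12 : Ra 12 = k by rewrite RaE.
have Ra9 : 16 <= Ra 9 by rewrite RaE /=; lia.
have Ra10 : Ra 9 + k < Ra 10 by rewrite !RaE /=; lia.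
have [R' [h1 h2 h3 h4]] := IH Ra Ra7 Ra8 Ra12 Ra9 Ra10.
have dstE t : (if b then Ra 10 + 64 * t else Ra 9 + t) = dst t.+1.
  by rewrite !RaE /= /dst; case: (b); lia.
have srcE t : (if b then Ra 9 + t else Ra 10 + 64 * t) = src t.+1.
  by rewrite !RaE /= /src; case: (b); lia.
exists R'; split.
- have -> : 8 * k.+1 + 1 = 5 + (8 * k + 1) + 3 by lia.
  apply: ExecWhile1 h1; first by rewrite R12.
  exact: ExecBlock.
- case=> [|t] ht.
    rewrite h3 //; first by rewrite RaE -/D eqxx; do ?(case: eqP => [e|_]; first lia).
    by move=> t _; rewrite dstE /D /dst; case: (b); lia.
  rewrite -dstE h2 // srcE hx //; first by rewrite /src; case: (b); lia.
  by rewrite /D /src /dst; case: (b); lia.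
- move=> x x16 xd; rewrite h3 //; first by apply: hx => //; apply: xd.
  by move=> t tk; rewrite dstE; apply: xd.
- move=> x x16 hx5; rewrite h4 // RaE.
  move: hx5; rewrite !inE !negb_or.
  case/and5P=> /negbTE -> /negbTE -> /negbTE -> /negbTE -> /negbTE ->.
  by case: eqP => // e; lia.
Qed.

Definition boot_save : seq instr :=
  nseq 6 (IAdd 1 1 1) ++ [:: IStore 1 2; IConst 2 64] ++ save_temps 3 13.

(** Saving 13 temporaries has advanced register 1 by [64 * 13], which is undone to get the base.
    Register 0 is about to be cleared by a loop, so [m] moves to register 4. *)
Definition boot_count : seq instr :=
  [:: IConst 3 (64 * 13); ISub 2 1 3; IConst 3 0; IAdd 4 0 3;
      IConst 5 0; IAdd 6 2 3; IConst 7 64; IConst 8 1].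

(** The 14 jobs that started in registers 2 to 15 are already in place; the others start at address
    16. The truncated [n - 14] makes the copying loop empty for short inputs. *)
Definition boot_copy : seq instr :=
  [:: IConst 9 16; IConst 11 (64 * 14); IAdd 10 2 11; IConst 11 14; ISub 12 5 11].

Definition boot_vars : seq instr :=
  [:: IAdd 11 2 8; IStore 11 4; IAdd 11 11 8; IStore 11 5].

(* The only registers free at the start are 0 and 1, and the input may overlap
   the temporaries.  The base [64 * n] is therefore formed in register 1 and the
   temporaries are saved above it; afterwards [n] is recovered by counting. *)
Definition boot : code :=
  CSeq (Block boot_save)
 (CSeq (Block boot_count)
 (CSeq (CWhile 6 (Block [:: ISub 6 6 7; IAdd 5 5 8]))
 (CSeq (Block boot_copy)
 (CSeq (copy_loop true) (Block boot_vars))))).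

Definition input_store (m : nat) (p : seq nat) : store := fun a i =>
  if a == 0 then nth 0 p i
  else if (a == 1) && (i == 0) then m
  else if (a == 2) && (i == 0) then size p else 0.

Lemma bootP m p : 0 < size p -> exists R' k,
  [/\ cexec boot (regs (init_state m p)) R' k,
      represents (64 * size p) R' (input_store m p) & k <= 100 + 13 * size p].
Proof.
set n := size p => n0; set R := regs _.
have RE x : R x = if x == 0 then m else if x == 1 then n else nth 0 p (x - 2) by [].
(* Since [0 < n], this lies beyond the last input address [n + 1]. *)
pose b := 64 * n.
pose Ra := effects R (nseq 6 (IAdd 1 1 1)).
have [a1 a2] : Ra 1 = b /\ forall x, x != 1 -> Ra x = R x.
  have [h1 h2] := effects_double 1 R 6; split=> //.
  by rewrite /Ra h1 RE /= /b; lia.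
pose Rb := effects Ra [:: IStore 1 2; IConst 2 64].
have RbE x : Rb x = if x == 2 then 64 else if x == b then nth 0 p 0 else Ra x.
  by rewrite /Rb /= /upd a1 a2.
have b16 : 16 <= b by rewrite /b; lia.
have b1 : Rb 1 = b by rewrite RbE /= a1; case: eqP => // e; lia.
have b2 : Rb 2 = 64 by rewrite RbE.
have [] := @save_tempsP 3 13 Rb isT isT b2; first by rewrite b1.
rewrite b1; move ERc: (effects Rb _) => Rc c1 c2 c3.
have El1 : effects R boot_save = Rc by rewrite /boot_save 2!effects_cat -ERc.
have cP j : j < 14 -> Rc (b + 64 * j) = nth 0 p j.
  case: j => [|j] hj.
    rewrite muln0 addn0 c3; first by rewrite RbE eqxx; case: eqP => // e; lia.
      by apply/eqP; lia.
    by move=> t _; apply/eqP; lia.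
  rewrite c2 // RbE; do ?(case: eqP => [e|_]; first lia).
  rewrite a2; last by [].
  by rewrite RE /=; congr nth; lia.
have cO x : 16 <= x -> (forall t, t < 14 -> x != b + 64 * t) -> Rc x = nth 0 p (x - 2).
  move=> x16 hx; rewrite c3.
  - rewrite RbE; have := hx 0 isT; rewrite muln0 addn0 => /negbTE ->.
    by case: eqP => [e|_]; [lia|]; rewrite a2 ?RE; do ?[case: eqP => [e|_]; first lia]; try lia.
  - by apply/eqP; lia.
  - by move=> t ht; apply: hx.
have c0 : Rc 0 = m.
  rewrite c3 //; first by rewrite RbE /= a2 ?RE //; case: eqP => // e; lia.
  by move=> t _; apply/eqP; lia.
pose Rd := effects Rc boot_count.
have dO : outside 2 Rc Rd by apply: effects_outside.
have [d2 d4 d5 d6] : [/\ Rd 2 = b, Rd 4 = m, Rd 5 = 0 & Rd 6 = 64 * n].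
  by rewrite /Rd /boot_count /= /upd /= c1 c0 /b; split; lia.
have [d7 d8] : Rd 7 = 64 /\ Rd 8 = 1 by [].
have [Re [xe e5 eO]] := count_loop d6 d7 d8.
pose Rf := effects Re boot_copy.
have fO : outside 9 Re Rf by apply: effects_outside.
have [f7 f8 f9] : [/\ Rf 7 = 64, Rf 8 = 1 & Rf 9 = 16].
  by split=> //; rewrite fO // eO.
have f10 : Rf 10 = b + 64 * 14 by rewrite /Rf /boot_copy /= /upd /= eO // d2.
have f12 : Rf 12 = n - 14 by rewrite /Rf /boot_copy /= /upd /= e5 d5 add0n.
have [||Rg [xg g1 g2 g3]] := @copy_loopP true (n - 14) Rf f7 f8 f12.
- by rewrite f9.
- by rewrite f9 f10 /b; lia.
rewrite /= f9 f10 in g1 g2.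
have hi x : 16 <= x -> Rf x = Rc x.
  move=> x16; rewrite fO ?x16 ?orbT // eO ?dO ?x16 ?orbT //.
  by rewrite !inE !negb_or; apply/and3P; split; apply/eqP; lia.
have gP j : Rg (b + 64 * j) = nth 0 p j.
  have [hj|hj] := ltnP j 14.
    by rewrite g2 ?hi ?cP //; lia.
  have [hn|hn] := ltnP j n.
    have -> : b + 64 * j = b + 64 * 14 + 64 * (j - 14) by lia.
    by rewrite g1 ?hi ?cO //; [congr nth|..]; lia.
  by rewrite g2 ?hi ?cO //; [rewrite !nth_default // -/n|..]; lia.
have gZ a j : 0 < a < 64 -> Rg (b + a + 64 * j) = 0.
  by move=> ha; rewrite g2 ?hi ?cO //; [rewrite nth_default // -/n|..]; lia.
have [gm gn] : Rg 4 = m /\ Rg 5 = n.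
  by rewrite !g3 // !fO // eO // e5 d5 add0n.
have [g2b g8] : Rg 2 = b /\ Rg 8 = 1.
  by rewrite !g3 // !fO // !eO.
pose Rh := effects Rg boot_vars.
have RhE x : Rh x = if x == b + 2 then n else if x == 11 then b + 2 else
                    if x == b + 1 then m else if x == 11 then b + 1 else Rg x.
  have F k : k < 16 -> (k == b + 1) = false by move=> h; apply/negbTE/eqP; lia.
  rewrite /Rh /boot_vars /= /upd /= g2b g8 !(F 4, F 5, F 8, F 11) //= gm gn.
  by rewrite -addnA addn1.
exists Rh; eexists; split.
- apply: ExecSeq (ExecBlock _ _) _; rewrite El1.
  apply: ExecSeq (ExecBlock _ _) _; rewrite -/Rd.
  apply: ExecSeq xe _.
  apply: ExecSeq (ExecBlock _ _) _; rewrite -/Rf.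
  apply: ExecSeq xg _; exact: ExecBlock.
- split=> //.
    by rewrite RhE; do ?(case: eqP => [e|_]; first lia).
  move=> a i a64; rewrite RhE /input_store -/b.
  case: (a =P 0) => [->|a0].
    by rewrite addn0 gP; do ?(case: eqP => [e|_]; first lia).
  case: (a =P 1) => [->|a1'] /=.
    case: (i =P 0) => [->|i0].
      by rewrite muln0 addn0 eqxx; do ?(case: eqP => [e|_]; first lia).
    by rewrite gZ //; do ?(case: eqP => [e|_]; first lia).
  case: (a =P 2) => [->|a2'] /=.
    case: (i =P 0) => [->|i0]; first by rewrite muln0 addn0 eqxx.
    by rewrite gZ //; do ?(case: eqP => [e|_]; first lia).
  by rewrite gZ ?a64 ?andbT; do ?(case: eqP => [e|_]; first lia); lia.
- rewrite /=; lia.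
Qed.

Definition unload_temps (k l : nat) : seq instr :=
  flatten [seq [:: ILoad j 1; IAdd 1 1 0] | j <- iota k l].

Lemma unload_tempsP k l R : 1 < k -> k + l <= 16 -> R 0 = 64 -> 16 <= R 1 ->
  let R' := effects R (unload_temps k l) in
  [/\ R' 0 = 64, forall t, t < l -> R' (k + t) = R (R 1 + 64 * t)
    & forall x, 1 < x -> (x < k) || (k + l <= x) -> R' x = R x].
Proof.
elim: l k R => [|l IH] k R k2 kl R0 R1; first by split.
rewrite /unload_temps [iota k _]/= [map _ _]/= [flatten _]/= -/(unload_temps _ _).
change (effects R (ILoad k 1 :: IAdd 1 1 0 :: unload_temps k.+1 l)) with
  (effects (effects R [:: ILoad k 1; IAdd 1 1 0]) (unload_temps k.+1 l)).
have RaE x : effects R [:: ILoad k 1; IAdd 1 1 0] x =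
    if x == 1 then R 1 + 64 else if x == k then R (R 1) else R x.
  rewrite /= /upd /= R0.
  have -> : (1 == k) = false by apply/negbTE/eqP; lia.
  by have -> : (0 == k) = false by apply/negbTE/eqP; lia.
move: RaE; set Ra := effects R _ => RaE.
have E0 : Ra 0 = 64 by rewrite RaE; case: eqP => [|_] //; case: eqP => [e|] //; lia.
have E1 : Ra 1 = R 1 + 64 by rewrite RaE.
have [|||h1 h2 h3] := IH k.+1 Ra _ _ E0; try lia.
split=> //.
- case=> [|t] ht.
    rewrite addn0 muln0 addn0 h3 ?ltnSn // RaE eqxx.
    by case: eqP => // e; lia.
  rewrite -addSnnS h2 // RaE E1.
  case: eqP => [e|_]; first lia.
  case: eqP => [e|_]; first lia.
  by congr R; lia.
- move=> x x1 hx; rewrite h3 //; last by lia.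
  by rewrite RaE; do ?(case: eqP => [e|_]; first lia).
Qed.

Definition unload_copy (out : nat) : seq instr :=
  [:: IConst 3 out; IAdd 1 2 3; IConst 3 2; IAdd 3 3 2; ILoad 5 3;
      IConst 7 64; IConst 8 1; IConst 9 16; IConst 11 (64 * 14);
      IAdd 10 1 11; IConst 11 14; ISub 12 5 11].

(** Registers 2 to 15 are outputs too, but the copying loop still works with them, so they are
    filled last, with the stride in register 0 and the source pointer in register 1. *)
Definition unload (out : nat) : code :=
  CSeq (Block (unload_copy out))
 (CSeq (copy_loop false) (Block (IConst 0 64 :: unload_temps 2 14))).

Lemma unloadP n R s out : 0 < n -> out < 64 -> represents (64 * n) R s -> s 2 0 = n ->
  exists R' k, [/\ cexec (unload out) R R' k, forall j, j < n -> R' (j + 2) = s out j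
                 & k <= 100 + 8 * n].
Proof.
move=> n0 o64 hR sn; 
have [b16 R2 Rs] := hR; pose b := 64 * n.
pose Ra := effects R (unload_copy out).
have aO : outside 1 R Ra by apply: effects_outside.
have a5 : R (2 + b) = n.
  by have := Rs 2 0 isT; rewrite muln0 addn0 addnC => ->.
have [a7 a8 a9] : [/\ Ra 7 = 64, Ra 8 = 1 & Ra 9 = 16] by [].
have [a1 a10 a12] : [/\ Ra 1 = b + out, Ra 10 = b + out + 64 * 14 & Ra 12 = n - 14].
  have F k : k < 16 -> (2 + b == k) = false by move=> h; apply/negbTE/eqP; lia.
  by rewrite /Ra /= /upd /= R2 -/b !(F 1, F 3) //= a5.
have [||Rb [xb b1 b2 b3]] := @copy_loopP false (n - 14) Ra a7 a8 a12.
- by rewrite a9.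
- by rewrite a9 a10 /b; lia.
rewrite /= a9 a10 in b1 b2.
pose Rc := upd Rb 0 64.
have bs j : Rb (b + out + 64 * j) = s out j.
  rewrite b2; first by rewrite aO ?Rs //; apply/orP; right; lia.
    by lia.
  by move=> t ht; apply/eqP; rewrite /b; lia.
have c1 : Rc 1 = b + out by rewrite /Rc /upd /= b3.
have [||||d0 d1 d2] := @unload_tempsP 2 14 Rc; rewrite ?c1 //; try lia.
rewrite c1 in d1.
exists (effects Rc (unload_temps 2 14)); eexists; split.
- apply: ExecSeq (ExecBlock _ _) _; rewrite -/Ra.
  by apply: ExecSeq xb _; exact: ExecBlock.
- move=> j jn; have [hj|hj] := ltnP j 14.
    rewrite addnC d1 //.
    by rewrite /Rc /upd; case: eqP => [e|_]; [lia|rewrite bs].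
  rewrite d2; try lia.
  rewrite /Rc /upd; case: eqP => [e|_]; first lia.
  have -> : j + 2 = 16 + (j - 14) by lia.
  rewrite b1; last by lia.
  rewrite aO; last by apply/orP; right; lia.
  have -> : b + out + 64 * 14 + 64 * (j - 14) = b + out + 64 * j by lia.
  exact: Rs.
- by rewrite /=; lia.
Qed.

(** * Complete programs *)

Fixpoint compile_phases (out : nat) (cs : seq cmd) : code :=
  if cs is c :: cs' then CSeq (compile c) (compile_phases out cs') else unload out.

(** The test of register 1 skips everything when there are no jobs; the base [64 * n] would then
    collide with the registers. *)
Definition build (out : nat) (cs : seq cmd) : program :=
  assemble 0 (CIf 1 (CSeq boot (compile_phases out cs))).

(** Within one command [cmd_ok] forbids computing a number and then using it as a loop bound.
    Splitting the program into phases allows this: bounds are only inspected when a phase starts. *)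
Fixpoint phases_ok (L : nat) (s : store) (cs : seq cmd) : Prop :=
  if cs is c :: cs' then
    [/\ cmd_ok c, forall x, x \in bounds c -> s x 0 <= L
      & phases_ok L (exec c s) cs']
  else True.

Definition exec_phases (s : store) (cs : seq cmd) : store :=
  foldl (fun s c => exec c s) s cs.

Lemma compile_phasesP n L out cs R s : 0 < n -> out < 64 ->
  represents (64 * n) R s -> s 2 0 = n -> phases_ok L s cs ->
  all (fun c => 2 \notin writes c) cs ->
  exists R' k, [/\ cexec (compile_phases out cs) R R' k,
      forall j, j < n -> R' (j + 2) = exec_phases s cs out j
    & k <= \sum_(c <- cs) time L c + (100 + 8 * n)].
Proof.
move=> n0 o64; elim: cs R s => [|c cs IH] R s hR sn /=.
  move=> _ _; have [R' [k [h1 h2 h3]]] := unloadP n0 o64 hR sn.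
  by exists R', k; split=> //; rewrite big_nil.
case=> ok hb hcs /andP[w2 ws].
have [R1 [k1 [x1 r1 t1]]] := compile_correct hR ok hb.
have [|R2 [k2 [x2 r2 t2]]] := IH R1 _ r1 _ hcs ws; first by rewrite exec_frame.
exists R2, (k1 + k2); split=> //; first exact: ExecSeq x1 x2.
by rewrite big_cons; lia.
Qed.

Lemma jumps_ok_build out cs : jumps_ok (CIf 1 (CSeq boot (compile_phases out cs))).
Proof.
by rewrite [jumps_ok _]/=; elim: cs => //= c cs ->; rewrite jumps_ok_compile.
Qed.

Theorem build_correct m p L out cs : 0 < size p -> out < 64 ->
  phases_ok L (input_store m p) cs -> all (fun c => 2 \notin writes c) cs ->
  exists k s, [/\ reach (build out cs) k (init_state m p) s,
      halted (build out cs) s,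
      forall j, j < size p -> regs s (j + 2) = exec_phases (input_store m p) cs out j
    & k <= \sum_(c <- cs) time L c + (300 + 21 * size p)].
Proof.
move=> n0 o64 hcs ws.
have [R1 [k1 [x1 r1 t1]]] := bootP m n0.
have [R2 [k2 [x2 r2 t2]]] := compile_phasesP n0 o64 r1 (erefl : input_store m p 2 0 = size p) hcs ws.
have x0 : cexec (CIf 1 (CSeq boot (compile_phases out cs)))
            (regs (init_state m p)) R2 (k1 + k2).+1.
  by apply: ExecIf1 => //; exact: ExecSeq x1 x2.
have := assemble_correct x0 (P := build out cs) (pre := [::]) (post := [::]) (l := 0).
rewrite cats0 => /(_ erefl erefl (jumps_ok_build out cs)) h.
exists (k1 + k2).+1, (State (0 + csize (CIf 1 (CSeq boot (compile_phases out cs)))) R2).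
split=> //; first by rewrite /halted size_assemble.
by lia.
Qed.

(** * Vectors as numbers *)

Definition encode (Q D : nat) (v : nat -> nat) : nat := \sum_(d < D) v d * Q ^ d.

Definition digit (H x d : nat) : nat := x %/ H ^ d %% H.

Lemma encodeS Q D v : encode Q D.+1 v = v 0 + Q * encode Q D (fun d => v d.+1).
Proof.
rewrite /encode big_ord_recl expn0 muln1 big_distrr /=; congr (_ + _).
by apply: eq_bigr => d _; rewrite /bump /= add1n expnS mulnCA.
Qed.

Lemma eq_encode Q D v w : (forall d, d < D -> v d = w d) -> encode Q D v = encode Q D w.
Proof. by move=> h; apply: eq_bigr => d _; rewrite h. Qed.

Lemma encodeD Q D v w :
  encode Q D (fun d => v d + w d) = encode Q D v + encode Q D w.
Proof. by rewrite /encode -big_split; apply: eq_bigr => d _; rewrite mulnDl. Qed.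

Lemma encode_lt Q D v : (forall d, d < D -> v d < Q) -> encode Q D v < Q ^ D.
Proof.
elim: D v => [|D IH] v h; first by rewrite /encode big_ord0.
rewrite encodeS expnS.
have h0 := h 0 isT; have := IH (fun d => v d.+1) (fun d dD => h d.+1 dD).
move: (encode _ _ _) (Q ^ D) => a b; nia.
Qed.

Lemma digit_encode Q D v d : (forall d, d < D -> v d < Q) -> d < D ->
  digit Q (encode Q D v) d = v d.
Proof.
elim: D v d => [|D IH] v d h // hd.
have h0 := h 0 isT; rewrite encodeS /digit mulnC.
case: d hd => [|d] hd; first by rewrite expn0 divn1 addnC modnMDl modn_small.
rewrite expnS divnMA addnC divnMDl; last lia.
rewrite (divn_small h0) addn0.
exact: (IH (fun d => v d.+1) d (fun d dD => h d.+1 dD) hd).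
Qed.

Lemma encode_inj Q D v w : (forall d, d < D -> v d < Q) -> (forall d, d < D -> w d < Q) ->
  encode Q D v = encode Q D w -> forall d, d < D -> v d = w d.
Proof. by move=> hv hw e d dD; rewrite -(digit_encode hv dD) e digit_encode. Qed.

Lemma digit_lt H x d : 0 < H -> digit H x d < H.
Proof. by move=> h; rewrite ltn_mod. Qed.

(** One recursion for all linear functions of the digits; [table] needs it for the weights [Q ^ d],
    [d] and 1. The top digit of [x %/ H] vanishes because [x < H ^ D]. *)
Lemma sum_digits_rec (w : nat -> nat) H D x : 0 < H -> x < H ^ D -> 0 < D ->
  \sum_(d < D) digit H x d * w d =
  x %% H * w 0 + \sum_(d < D) digit H (x %/ H) d * w d.+1.
Proof.
case: D => // D H0 xD _; rewrite big_ord_recl [in RHS]big_ord_recr /=.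
rewrite {1}/digit expn0 divn1.
have -> : digit H (x %/ H) D = 0.
  by rewrite /digit -divnMA -expnS divn_small ?mod0n.
rewrite mul0n addn0; congr (_ + _); apply: eq_bigr => d _.
by rewrite /digit /bump /= add1n expnS divnMA.
Qed.

(** * Balanced job distributions *)

Definition row_load (P : nat) (x : nat -> nat -> nat) (i : nat) : nat :=
  \sum_(d < P.+1) d * x i d.

Definition transfer (x : nat -> nat -> nat) (i k d t : nat) : nat -> nat -> nat :=
  fun i' d' => if d' == d then
    (if i' == i then x i d - t else if i' == k then x k d + t else x i' d)
    else x i' d'.

Lemma sum_change2 m (F G : nat -> nat) i k : i < m -> k < m -> i != k ->
  (forall j, j != i -> j != k -> F j = G j) ->
  \sum_(j < m) F j + (G i + G k) = \sum_(j < m) G j + (F i + F k).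
Proof.
move=> im km ik FG.
rewrite (bigD1 (Ordinal im)) //= (bigD1 (Ordinal km)) /=; last first.
  by rewrite -val_eqE /= eq_sym.
rewrite [in RHS](bigD1 (Ordinal im)) //= [in RHS](bigD1 (Ordinal km)) /=; last first.
  by rewrite -val_eqE /= eq_sym.
rewrite (eq_bigr (fun j : 'I_m => G j)); last first.
  by move=> j /andP[ji jk]; apply: FG.
by lia.
Qed.

Lemma sum_change1 m (F G : nat -> nat) i : i < m ->
  (forall j, j != i -> F j = G j) ->
  \sum_(j < m) F j + G i = \sum_(j < m) G j + F i.
Proof.
move=> im FG.
rewrite (bigD1 (Ordinal im)) //= [in RHS](bigD1 (Ordinal im)) //=.
rewrite (eq_bigr (fun j : 'I_m => G j)); last by move=> j ji; apply: FG.
by lia.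
Qed.

Section Transfer.

Variables (P m : nat) (x : nat -> nat -> nat) (i k d t : nat).
Hypotheses (im : i < m) (km : k < m) (ik : i != k) (dP : d <= P) (tx : t <= x i d).

Let x' := transfer x i k d t.

Lemma transfer_i : x' i d = x i d - t.
Proof. by rewrite /x' /transfer !eqxx. Qed.

Lemma transfer_k : x' k d = x k d + t.
Proof. by rewrite /x' /transfer !eqxx eq_sym (negbTE ik). Qed.

Lemma transfer_col e : \sum_(j < m) x' j e = \sum_(j < m) x j e.
Proof.
clear dP P.
have [->|ed] := eqVneq e d; last first.
  by apply: eq_bigr => j _; rewrite /x' /transfer (negbTE ed).
have := @sum_change2 m (x'^~ d) (x^~ d) i k im km ik.
rewrite transfer_i transfer_k => h.
have : \sum_(j < m) x' j d + (x i d + x k d) =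
       \sum_(j < m) x j d + (x i d - t + (x k d + t)).
  by apply: h => j ji jk; rewrite /x' /transfer eqxx (negbTE ji) (negbTE jk).
lia.
Qed.

Lemma transfer_load_i : row_load P x' i + d * t = row_load P x i.
Proof.
clear im km ik m.
have := @sum_change1 P.+1 (fun e => e * x' i e) (fun e => e * x i e) d dP.
rewrite transfer_i => h.
have : row_load P x' i + d * x i d = row_load P x i + d * (x i d - t).
  by apply: h => e ed; rewrite /x' /transfer (negbTE ed).
have : d * (x i d - t) + d * t = d * x i d by rewrite -mulnDr subnK.
lia.
Qed.

Lemma transfer_load_k : row_load P x' k = row_load P x k + d * t.
Proof.
clear im km m tx.
have := @sum_change1 P.+1 (fun e => e * x' k e) (fun e => e * x k e) d dP.
rewrite transfer_k => h.
have : row_load P x' k + d * x k d = row_load P x k + d * (x k d + t).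
  by apply: h => e ed; rewrite /x' /transfer (negbTE ed).
lia.
Qed.

Lemma transfer_load j : j != i -> j != k -> row_load P x' j = row_load P x j.
Proof.
move=> ji jk; apply: eq_bigr => e _.
by rewrite /x' /transfer (negbTE ji) (negbTE jk); case: eqP => // ->.
Qed.

Lemma transfer_load_le M : row_load P x k + d * t <= M ->
  (forall j, j < m -> row_load P x j <= M) -> forall j, j < m -> row_load P x' j <= M.
Proof.
clear km.
move=> hk hM j jm; have [->|ji] := eqVneq j i.
  by have := hM i im; have := transfer_load_i; lia.
have [->|jk] := eqVneq j k; first by rewrite transfer_load_k.
by rewrite transfer_load //; apply: hM.
Qed.

Definition sum_sq (y : nat -> nat -> nat) : nat :=
  \sum_(j < m) \sum_(e < P.+1) y j e ^ 2.

(** Moving [t] from [a] to [b] changes [a ^ 2 + b ^ 2] by [- 2 * t * (a - b - t)]. The same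
    computation gives [transfer_load_sq]. *)
Lemma transfer_sq : x k d + t < x i d -> 0 < t -> sum_sq x' < sum_sq x.
Proof.
clear tx.
move=> ht t0.
pose F (y : nat -> nat -> nat) (j : nat) := \sum_(e < P.+1) y j e ^ 2 : nat.
have hik : sum_sq x' + (F x i + F x k) = sum_sq x + (F x' i + F x' k).
  apply: (@sum_change2 m (F x') (F x)) => // j ji jk.
  apply: eq_bigr => e _; rewrite /x' /transfer (negbTE ji) (negbTE jk).
  by case: eqP => // ->.
have hi : F x' i + x i d ^ 2 = F x i + x' i d ^ 2.
  apply: (@sum_change1 P.+1 (fun e => x' i e ^ 2) (fun e => x i e ^ 2)) => // e ed.
  by rewrite /x' /transfer (negbTE ed).
have hk : F x' k + x k d ^ 2 = F x k + x' k d ^ 2.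
  apply: (@sum_change1 P.+1 (fun e => x' k e ^ 2) (fun e => x k e ^ 2)) => // e ed.
  by rewrite /x' /transfer (negbTE ed).
move: hi hk; rewrite transfer_i transfer_k.
have [u Eu] : exists u, x i d = x k d + t + u by exists (x i d - (x k d + t)); lia.
have -> : x i d - t = x k d + u by lia.
rewrite Eu => hi hk; have u0 : 0 < u by lia.
move: (sum_sq x') (sum_sq x) (F x i) (F x k) (F x' i) (F x' k) (x k d) hik hi hk.
move=> a b c e f g y h1 h2 h3; nia.
Qed.

Lemma transfer_load_sq : row_load P x k + d * t < row_load P x i -> 0 < d * t ->
  \sum_(j < m) row_load P x' j ^ 2 < \sum_(j < m) row_load P x j ^ 2.
Proof.
move=> ht t0.
have h : \sum_(j < m) row_load P x' j ^ 2 + (row_load P x i ^ 2 + row_load P x k ^ 2) =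
    \sum_(j < m) row_load P x j ^ 2 + (row_load P x' i ^ 2 + row_load P x' k ^ 2).
  apply: (@sum_change2 m (fun j => row_load P x' j ^ 2) (fun j => row_load P x j ^ 2)) => //.
  by move=> j ji jk; rewrite transfer_load.
move: h; rewrite transfer_load_k -transfer_load_i.
have := transfer_load_i; move: (\sum_(_ < _) _) (\sum_(_ < _) _) ht t0.
move: (row_load P x i) (row_load P x k) (row_load P x' i) (d * t) => A B C D E F; nia.
Qed.

End Transfer.

(* Either a job moves from a machine to one that is more than [P] less loaded,
   which decreases the sum of the squared loads, or [e] jobs of size [d] are
   exchanged against [d] jobs of size [e], which keeps all loads and decreases
   the sum of the squared multiplicities. *)
Theorem balanced_distribution P m (x : nat -> nat -> nat) : exists y : nat -> nat -> nat,
  [/\ forall d, \sum_(j < m) y j d = \sum_(j < m) x j d,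
      forall M, (forall j, j < m -> row_load P x j <= M) ->
                forall j, j < m -> row_load P y j <= M
    & forall i k d, i < m -> k < m -> 0 < d <= P -> y i d <= y k d + (P * P + P)].
Proof.
pose Phi y := \sum_(j < m) row_load P y j ^ 2 : nat.
(* Lexicographic descent on the pair of [Phi] and [sum_sq], written as two nested inductions on
   upper bounds. *)
move: {2}(Phi x).+1 (ltnSn (Phi x)) => A; elim: A x => // A IHA x.
move: {2}(sum_sq P m x).+1 (ltnSn (sum_sq P m x)) => B; elim: B x => // B IHB x hB hA.
have step (x' : nat -> nat -> nat) : (forall d, \sum_(j < m) x' j d = \sum_(j < m) x j d) ->
    (forall M, (forall j, j < m -> row_load P x j <= M) ->
               forall j, j < m -> row_load P x' j <= M) ->
    (Phi x' < Phi x \/ Phi x' = Phi x /\ sum_sq P m x' < sum_sq P m x) ->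
    exists y : nat -> nat -> nat, [/\ forall d, \sum_(j < m) y j d = \sum_(j < m) x j d,
      forall M, (forall j, j < m -> row_load P x j <= M) ->
                forall j, j < m -> row_load P y j <= M
    & forall i k d, i < m -> k < m -> 0 < d <= P -> y i d <= y k d + (P * P + P)].
  move=> hc hl hd.
  have [y [y1 y2 y3]] : exists y : nat -> nat -> nat, [/\ forall d, \sum_(j < m) y j d = \sum_(j < m) x' j d,
      forall M, (forall j, j < m -> row_load P x' j <= M) ->
                forall j, j < m -> row_load P y j <= M
    & forall i k d, i < m -> k < m -> 0 < d <= P -> y i d <= y k d + (P * P + P)].
    case: hd => [hd|[e hd]]; first by apply: IHA; lia.
    by apply: IHB; lia.
  exists y; split=> //; first by move=> d; rewrite y1 hc.
  by move=> M hM; apply: y2; apply: hl.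
case: (boolP [exists i : 'I_m, exists k : 'I_m, row_load P x k + P < row_load P x i]).
  case/existsP=> i /existsP[k lik].
  have ik : (i : nat) != k by apply/eqP => e; move: lik; rewrite e; lia.
  have [d [dP d0 xd]] : exists d, [/\ d <= P, 0 < d & 0 < x i d].
    case: (boolP [exists d : 'I_P.+1, (0 < d) && (0 < x i d)]).
      by case/existsP=> d /andP[d0 xd]; exists d; rewrite -ltnS ltn_ord.
    rewrite negb_exists => /forallP h.
    suff: row_load P x i = 0 by move: lik; lia.
    rewrite /row_load big1 // => d _; have := h d.
    by case: (nat_of_ord d) => [|d'] //=; rewrite -eqn0Ngt => /eqP ->; rewrite muln0.
  apply: (step (transfer x i k d 1)).
  - by move=> e; apply: transfer_col.
  - move=> M hM; apply: transfer_load_le => //.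
    by have := hM i (ltn_ord i); lia.
  - by left; apply: transfer_load_sq => //; lia.
rewrite negb_exists => /forallP hP.
have near i k : i < m -> k < m -> row_load P x i <= row_load P x k + P.
  move=> im km; have := hP (Ordinal im).
  by rewrite negb_exists => /forallP /(_ (Ordinal km)); rewrite -leqNgt.
case: (boolP [exists i : 'I_m, exists k : 'I_m, exists d : 'I_P.+1,
               (0 < d) && (x k d + (P * P + P) < x i d)]); last first.
  rewrite negb_exists => /forallP hx.
  exists x; split=> // i k d im km /andP[d0 dP].
  have := hx (Ordinal im); rewrite negb_exists => /forallP /(_ (Ordinal km)).
  rewrite negb_exists => /forallP /(_ (Ordinal (dP : d < P.+1))) /=.
  by rewrite d0 /= -leqNgt.
case/existsP=> -[i im] /existsP[[k km] /existsP[[d dP1] /andP[/= d0 hd]]].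
have ik : i != k by apply/eqP => e; move: hd; rewrite e; lia.
have dP : d <= P by rewrite -ltnS.
(* Otherwise machine [k] has at most [d] more jobs than [i] of every other size, which is at most
   [d * P ^ 2] of load. The surplus of [i] in size [d] exceeds [d * (P ^ 2 + P)], so the loads would
   differ by more than [d * P], against [near]. *)
have [e [e0 eP ed he]] : exists e, [/\ 0 < e, e <= P, e != d & x i e + d < x k e].
  case: (boolP [exists e : 'I_P.+1, [&& 0 < e, (e : nat) != d & x i e + d < x k e]]).
    by case/existsP=> e /and3P[e0 ed he]; exists e; split=> //; rewrite -ltnS.
  rewrite negb_exists => /forallP h; exfalso.
  have h1 : row_load P x k + d * (P * P + P) < row_load P x i + d * (P * P).
    rewrite /row_load (bigD1 (Ordinal dP1)) //= [in X in _ < X](bigD1 (Ordinal dP1)) //=.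
    have : \sum_(e < P.+1 | e != Ordinal dP1) e * x k e <=
           \sum_(e < P.+1 | e != Ordinal dP1) (e * x i e + d * e).
      apply: leq_sum => e; rewrite -val_eqE /= => ed; have := h e; rewrite ed /=.
      case: (posnP e) => [->|e0] /=; first by rewrite !mul0n.
      rewrite -leqNgt => hx.
      by rewrite [d * e]mulnC -mulnDr leq_mul2l hx orbT.
    rewrite big_split /= -big_distrr /=.
    have : \sum_(e < P.+1 | e != Ordinal dP1) e <= P * P.
      rewrite big_mkcond big_ord_recl /=.
      have -> : (if ord0 != Ordinal dP1 then 0 else 0) = 0 by case: ifP.
      rewrite add0n; apply: leq_trans (_ : \sum_(e < P) P <= _).
        by apply: leq_sum => e _; case: ifP => // _; rewrite /bump /= add1n ltn_ord.
      by rewrite sum_nat_const card_ord.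
    move: (\sum_(_ < _ | _) _) (\sum_(_ < _ | _) _) (\sum_(_ < _ | _) _) => a b c.
    nia.
  have := near i k im km; nia.
(* Half of the exchange; [x2] below returns [d] jobs of size [e]. Both halves move the load
   [d * e]. *)
pose x1 := transfer x i k d e.
have exd : e <= x i d by lia.
have x1i (e' : nat) : e' != d -> forall j, x1 j e' = x j e'.
  by move=> h j; rewrite /x1 /transfer (negbTE h).
have [x1ie x1ke] : x1 i e = x i e /\ x1 k e = x k e by rewrite !x1i.
have dxe : d <= x1 k e by lia.
have ki : k != i by rewrite eq_sym.
have L1 : row_load P x1 i + d * e = row_load P x i by apply: transfer_load_i.
have L2 : row_load P x1 k = row_load P x k + d * e by apply: transfer_load_k.
pose x2 := transfer x1 k i e d.
have L3 : row_load P x2 k + e * d = row_load P x1 k by apply: transfer_load_i.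
have L4 : row_load P x2 i = row_load P x1 i + e * d by apply: transfer_load_k.
have L j : row_load P x2 j = row_load P x j.
  have [->|ji] := eqVneq j i; first by rewrite L4; lia.
  have [->|jk] := eqVneq j k; first by lia.
  by rewrite (transfer_load P x1) // (transfer_load P x).
apply: (step x2).
- by move=> f; rewrite transfer_col // transfer_col.
- by move=> M hM j jm; rewrite L; apply: hM.
- right; split; first by apply: eq_bigr => j _; rewrite L.
  apply: (@ltn_trans (sum_sq P m x1)); apply: transfer_sq => //; lia.
Qed.

Lemma balanced_near_average m (c : nat -> nat) B : 0 < m ->
  (forall i k, i < m -> k < m -> c i <= c k + B) ->
  forall i, i < m -> (\sum_(j < m) c j) %/ m <= c i + B /\
                     c i <= (\sum_(j < m) c j) %/ m + B.
Proof.
move=> m0 h i im; set S := \sum_(j < m) c j; split.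
  have : S <= m * (c i + B).
    rewrite -{1}(card_ord m) -sum_nat_const; apply: leq_sum => j _; exact: h.
  by move=> hS; rewrite -(leq_pmul2r m0) [_ * m in X in _ <= X]mulnC (leq_trans (leq_trunc_div _ _)).
have : m * (c i - B) <= S.
  rewrite -{1}(card_ord m) -sum_nat_const; apply: leq_sum => j _.
  by have := h i j im (ltn_ord j); lia.
by rewrite mulnC -leq_divRL // addnC -leq_subLR.
Qed.

(** * Rounding a multiset of configurations to an almost straight path *)

(** The point after [i] full rounds and the first [k] configurations of the next round: these are
    already rounded with [i + 1] in place of [i]. *)
Definition path_vector (m K : nat) (N : nat -> nat) (v : nat -> nat -> nat)
  (i k d : nat) : nat := \sum_(l < K) (i + (l < k)) * N l %/ m * v l d.

Section Path.

Variables (m K H : nat) (N : nat -> nat) (v : nat -> nat -> nat).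
Hypotheses (m0 : 0 < m) (Nm : forall k, N k <= m).

Let path := path_vector m K N v.
Let total d := \sum_(l < K) N l * v l d.

Lemma path0 d : path 0 0 d = 0.
Proof. by apply: big1 => l _; rewrite ltn0 mul0n div0n mul0n. Qed.

Lemma path_last i d : path i K d = path i.+1 0 d.
Proof. by apply: eq_bigr => l _; rewrite ltn_ord addn1 addn0. Qed.

Lemma path_end d : path m 0 d = total d.
Proof. by apply: eq_bigr => l _; rewrite addn0 mulKn. Qed.

(** As [N k <= m], the quotient [i * N k %/ m] grows by at most 1 when [i] does, so a configuration
    is used at most once per round. *)
Lemma path_step i k : k < K -> (forall d, path i k.+1 d = path i k d) \/
  0 < N k /\ forall d, path i k.+1 d = path i k d + v k d.
Proof.
move=> kK.
have E d : path i k.+1 d + i * N k %/ m * v k d =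
           path i k d + i.+1 * N k %/ m * v k d.
  have := @sum_change1 K (fun l => (i + (l < k.+1)) * N l %/ m * v l d)
     (fun l => (i + (l < k)) * N l %/ m * v l d) k kK.
  rewrite ltnSn ltnn addn0 addn1; apply=> l lk.
  by rewrite ltnS [l < k]ltn_neqAle lk.
have [e|ne] := eqVneq (i * N k %/ m) (i.+1 * N k %/ m).
  by left=> d; have := E d; rewrite e; lia.
have D : i.+1 * N k %/ m = (i * N k %/ m).+1.
  have h1 : i * N k %/ m <= i.+1 * N k %/ m by apply: leq_div2r; rewrite leq_mul2r leqnSn orbT.
  have h2 : i.+1 * N k %/ m <= (i * N k + m) %/ m.
    by apply: leq_div2r; rewrite mulSn addnC leq_add2l.
  by move: h2; rewrite divnDr // divnn m0; lia.
right; split; first by case: (N k) ne => //; rewrite !muln0 eqxx.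
by move=> d; have := E d; rewrite D mulSn; lia.
Qed.

(** Below, each of the [K] quotients loses less than one configuration with entry at most [H].
    Above, at most [i + 1] rounds have contributed, and one more round is worth
    [total d / m <= H]. *)
Lemma path_window i k d : i < m -> (forall l, v l d <= H) -> total d <= m * H ->
  i * total d %/ m <= path i k d + K * H /\ path i k d <= i * total d %/ m + H.
Proof.
move=> im vH tH; split.
  have h : i * total d <= m * (path i k d + K * H).
    rewrite /total /path /path_vector big_distrr mulnDr big_distrr /= -[K in m * (K * _)]card_ord.
    rewrite -sum_nat_const big_distrr -big_split /=; apply: leq_sum => l _.
    set X := (i + (l < k)) * N l; set q := X %/ m.
    have hX : i * N l <= X by rewrite leq_mul2r leq_addr orbT.
    have : i * N l <= m * q + m.
      have := divn_eq X m; have := ltn_pmod X m0; rewrite -/q [q * m]mulnC; lia.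
    have := vH l; move: (v l d) q (N l) => a b c h1 h2.
    by rewrite mulnA; nia.
  by rewrite -(leq_pmul2r m0); apply: leq_trans (leq_trunc_div _ _) _; rewrite [X in _ <= X]mulnC.
have h : m * path i k d <= i.+1 * total d.
  rewrite /total /path /path_vector !big_distrr /=; apply: leq_sum => l _.
  rewrite !mulnA leq_mul2r; apply/orP; right.
  apply: leq_trans (_ : (i + (l < k)) * N l <= _); first by rewrite mulnC leq_trunc_div.
  by rewrite leq_mul2r; case: (l < k); rewrite ?addn1 ?addn0 ?leqnn ?leqnSn orbT.
have : path i k d <= (i * total d + m * H) %/ m.
  by rewrite leq_divRL // mulnC; apply: leq_trans h _; rewrite mulSn addnC leq_add2l.
by rewrite divnDr ?dvdn_mulr // mulKn.
Qed.

End Path.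

(** * The scheduling program *)

Declare Scope cmd_scope.
Notation "c1 ;; c2" := (Then c1 c2) (at level 60, right associativity) : cmd_scope.
Notation "x <-- e" := (Put x (Num 0) e) (at level 55) : cmd_scope.
Notation "e1 +' e2" := (Add e1 e2) (at level 50, left associativity) : cmd_scope.
Notation "e1 -' e2" := (Sub e1 e2) (at level 50, left associativity) : cmd_scope.
Notation V x := (Cell x (Num 0)) (only parsing).
Notation Eqb e1 e2 := (Sub (Num 1) (Add (Sub e1 e2) (Sub e2 e1))) (only parsing).
Local Open Scope cmd_scope.

(* Variables [v_], loop counters [i_] and temporaries are cell 0 of their array. *)
Notation a_jobs := 0 (only parsing).
Notation v_m := 1 (only parsing).
Notation v_n := 2 (only parsing).
Notation v_P := 3 (only parsing).
Notation v_E := 4 (only parsing).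
Notation v_L := 5 (only parsing).
Notation a_count := 6 (only parsing).
Notation v_B := 7 (only parsing).
Notation v_H1 := 8 (only parsing).
Notation v_K1 := 9 (only parsing).
Notation v_W := 10 (only parsing).
Notation v_H2 := 11 (only parsing).
Notation v_K2 := 12 (only parsing).
Notation v_E1 := 13 (only parsing).
Notation v_E2 := 14 (only parsing).
Notation a_quota := 15 (only parsing).
Notation a_rest := 16 (only parsing).
Notation v_start := 17 (only parsing).
Notation v_target := 18 (only parsing).
Notation a_base := 19 (only parsing).
Notation a_quot := 20 (only parsing).
Notation a_rem := 21 (only parsing).
Notation a_code := 22 (only parsing).
Notation a_tail := 23 (only parsing).
Notation a_head := 24 (only parsing).
Notation a_sum := 25 (only parsing).
Notation a_load := 26 (only parsing).
Notation a_offset := 27 (only parsing).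
Notation a_mark := 32 (only parsing).
Notation a_out := 33 (only parsing).
Notation i_T := 40 (only parsing).
Notation i_i := 41 (only parsing).
Notation i_k := 42 (only parsing).
Notation i_o := 43 (only parsing).
Notation i_d := 44 (only parsing).
Notation i_j := 45 (only parsing).
Notation i_x := 46 (only parsing).
Notation t1 := 47 (only parsing).
Notation t2 := 48 (only parsing).
Notation t3 := 49 (only parsing).

(** Components 0 to [P], where component 0 counts machines instead of jobs. *)
Definition types : expr := V v_P +' Num 1.

Definition double (x : nat) : cmd := x <-- V x +' V x.

(** With truncated subtraction, [x + (y - x)] is a maximum and [m - (m - n)] a minimum. *)
Definition phase_max : cmd :=
  Loop i_j v_n (v_P <-- V v_P +' (Cell a_jobs (V i_j) -' V v_P)) ;;
  v_m <-- V v_m -' (V v_m -' V v_n).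

Definition phase_exponent : cmd :=
  v_E <-- Num 16 ;; Loop i_j v_P (double v_E ;; double v_E ;; double v_E).

Definition phase_limit : cmd :=
  v_L <-- V v_n ;; Loop i_j v_E (double v_L).

Definition phase_count : cmd :=
  For i_j v_L (V v_n)
    (Put a_count (Cell a_jobs (V i_j)) (Cell a_count (Cell a_jobs (V i_j)) +' Num 1)).

Definition power (x : nat) (k e : expr) : cmd :=
  x <-- Num 1 ;; For i_d v_L k (For i_j v_L e (double x)).

Definition phase_sizes : cmd :=
  power v_B (V v_P) (Num 2) ;;
  v_E1 <-- V v_P +' V v_P +' Num 2 ;;
  power v_H1 (Num 1) (V v_E1) ;;
  power v_K1 types (V v_E1) ;;
  power v_W (types +' Num 1) (V v_E1) ;;
  v_E2 <-- Num 1 ;;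
  For i_j v_L (types +' Num 1) (v_E2 <-- V v_E2 +' V v_E1) ;;
  power v_H2 (Num 1) (V v_E2) ;;
  power v_K2 types (V v_E2).

(** The quotient by [m] is found by counting multiples of [m]. The quota stays [B] below it, so that
    a balanced schedule gives every machine at least the quota. The last [Put] turns component 0
    into the machine counter. *)
Definition phase_quota : cmd :=
  For i_d v_L types (
    t1 <-- Num 0 ;; t2 <-- V v_m ;;
    Loop i_x v_L (When (Cell a_count (V i_d) +' Num 1 -' V t2)
                    (t2 <-- V t2 +' V v_m ;; t1 <-- V t1 +' Num 1)) ;;
    Put a_quota (V i_d) (V t1 -' V v_B) ;;
    t2 <-- Cell a_count (V i_d) ;;
    For i_x v_L (Cell a_quota (V i_d)) (t2 <-- V t2 -' V v_m) ;;
    Put a_rest (V i_d) (V t2)) ;;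
  Put a_rest (Num 0) (V v_m).

Definition shift (x : nat) : cmd := Loop i_x v_L (double x).

Definition horner (x : nat) (e : expr) : cmd :=
  x <-- Num 0 ;; For i_d v_L types (shift x ;; x <-- V x +' e).

Definition phase_ends : cmd :=
  horner v_start (V v_W) ;;
  horner v_target (V v_W +' Cell a_rest (V v_P -' V i_d)).

(** Quotient and remainder of [i * rest d] by [m] are carried along from [i] to [i + 1], which
    avoids multiplication. *)
Definition phase_base : cmd :=
  For i_i v_L (V v_m) (
    horner t1 (Cell a_quot (V v_P -' V i_d)) ;;
    Put a_base (V i_i) (V t1) ;;
    For i_d v_L types (
      Put a_rem (V i_d) (Cell a_rem (V i_d) +' Cell a_rest (V i_d)) ;;
      Loop i_x v_L (When (Cell a_rem (V i_d) +' Num 1 -' V v_m) (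
        Put a_rem (V i_d) (Cell a_rem (V i_d) -' V v_m) ;;
        Put a_quot (V i_d) (Cell a_quot (V i_d) +' Num 1))))).

(* Row [x] describes the vector of the base-[H] digits of [x], which is the
   vector of row [x %/ H] shifted by one place and extended by [x %% H]. *)
Definition table (H N : nat) : cmd :=
  t1 <-- Num 0 ;; t2 <-- Num 0 ;;
  For i_k v_L (V N) (
    t3 <-- Cell a_code (V t1) ;; shift t3 ;;
    Put a_tail (V i_k) (V t1) ;;
    Put a_head (V i_k) (V t2) ;;
    Put a_load (V i_k) (Cell a_load (V t1) +' Cell a_sum (V t1)) ;;
    Put a_sum (V i_k) (Cell a_sum (V t1) +' V t2) ;;
    Put a_code (V i_k) (V t3 +' V t2) ;;
    t2 <-- V t2 +' Num 1 ;;
    When (V t2 +' Num 1 -' V H) (t2 <-- Num 0 ;; t1 <-- V t1 +' Num 1)).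

(** Both tables use the same arrays, so the codes of the offsets are saved before the table of
    configurations overwrites them. *)
Definition phase_copy : cmd :=
  For i_k v_L (V v_K2) (Put a_offset (V i_k) (Cell a_code (V i_k))).

(** A mark is 1 plus the index of the configuration that led to the vector, and 0 means unreached;
    at the start the 1 is just a flag. The innermost test freezes all marks once the target is
    reached, so larger limits [T] cannot spoil its chain. *)
Definition phase_search : cmd :=
  Put a_mark (V v_start) (Num 1) ;;
  Loop i_T v_L (For i_i v_L (V v_m) (For i_k v_L (V v_K1) (
    When (Eqb (Cell a_head (V i_k)) (Num 1)) (
    When (V i_T +' Num 1 -' Cell a_load (V i_k)) (
      For i_o v_L (V v_K2) (
        t1 <-- Cell a_base (V i_i) +' Cell a_offset (V i_o) ;;
        When (Cell a_mark (V t1)) (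
        When (Num 1 -' Cell a_mark (V v_target))
          (Put a_mark (V t1 +' Cell a_code (V i_k)) (V i_k +' Num 1))))))))).

(** Walks from the target back to the start. Meanwhile [a_out] holds the machine plus 1, with 0 for
    unassigned jobs; the last loop removes the shift. For size 0 the scan finds no job, because
    processing times are positive. *)
Definition phase_output : cmd :=
  t1 <-- V v_target ;;
  For i_i v_L (V v_m) (
    t2 <-- Cell a_mark (V t1) -' Num 1 ;;
    t1 <-- V t1 -' Cell a_code (V t2) ;;
    For i_d v_L types (
      t3 <-- Cell a_quota (V i_d) +' Cell a_head (V t2) ;;
      t2 <-- Cell a_tail (V t2) ;;
      For i_j v_L (V v_n) (
        When (Eqb (Cell a_jobs (V i_j)) (V i_d)) (
        When (Num 1 -' Cell a_out (V i_j)) (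
        When (V t3) (
          Put a_out (V i_j) (V i_i +' Num 1) ;; t3 <-- V t3 -' Num 1)))))) ;;
  For i_j v_L (V v_n) (Put a_out (V i_j) (Cell a_out (V i_j) -' Num 1)).

Definition phases : seq cmd :=
  [:: phase_max; phase_exponent; phase_limit; phase_count; phase_sizes; phase_quota;
      phase_ends; phase_base; table v_H2 v_K2; phase_copy; table v_H1 v_K1;
      phase_search; phase_output].

(** [B] dominates [P ^ 2 + P]. With the quota removed, entries are at most [2 * B], hence digits in
    radix [H1 = 4 * B], and [K1] is the number of digit vectors. [W = K1 * H1] is the rounding error
    in [path_window]; offsets stay below [H2 = 2 * W], so there are [K2] of them. [E] is chosen so
    that [L] is at least [n + 4 * K2]. Radices and table sizes are powers of 2, to be computed by
    doubling. *)
Definition size_B P := 4 ^ P.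
Definition size_E1 P := P + P + 2.
Definition size_H1 P := 2 ^ size_E1 P.
Definition size_K1 P := size_H1 P ^ P.+1.
Definition size_W P := size_H1 P ^ P.+2.
Definition size_E2 P := 1 + P.+2 * size_E1 P.
Definition size_H2 P := 2 ^ size_E2 P.
Definition size_K2 P := size_H2 P ^ P.+1.
Definition size_E P := 16 * 8 ^ P.
Definition size_L n P := n * 2 ^ size_E P.


(** * Correctness of the phases that prepare the search *)

Arguments exec : simpl never.

Lemma exec_put a e1 e2 s :
  exec (Put a e1 e2) s = set_cell s a (eval s e1) (eval s e2).
Proof. by []. Qed.

Lemma exec_then c1 c2 s : exec (c1 ;; c2) s = exec c2 (exec c1 s).
Proof. by []. Qed.

Lemma exec_when e c s : exec (When e c) s = if eval s e == 0 then s else exec c s.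
Proof. by []. Qed.

Lemma set_cellE s a i v a' i' :
  set_cell s a i v a' i' = if (a' == a) && (i' == i) then v else s a' i'.
Proof. by []. Qed.

Arguments set_cell : simpl never.

Lemma phase_maxP s n : s v_n 0 = n -> s v_P 0 = 0 ->
  exec phase_max s v_P 0 = \max_(j < n) s a_jobs j /\
  exec phase_max s v_m 0 = minn (s v_m 0) n.
Proof.
move=> sn sP; rewrite /phase_max exec_then exec_put !set_cellE /=.
split; last by rewrite !exec_frame // sn; lia.
rewrite -sn.
apply: (@loop_rule (fun k s' => s' v_P 0 = \max_(j < k) s a_jobs j)) => //.
  by rewrite big_ord0.
move=> k s' hk sk fr E; rewrite exec_put !set_cellE /= sk E (fr a_jobs isT) big_ord_recr /=.
by rewrite maxnE.
Qed.

Lemma phase_exponentP s : exec phase_exponent s v_E 0 = size_E (s v_P 0).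
Proof.
rewrite /phase_exponent exec_then; set s1 := exec _ s.
have -> : s v_P 0 = s1 v_P 0 by [].
apply: (@loop_rule (fun k s' => s' v_E 0 = size_E k)) => // k s' _ _ _ E.
rewrite /size_E expnS /double !exec_then !exec_put !set_cellE /= !set_cellE /= E.
by rewrite /size_E; lia.
Qed.

Lemma phase_limitP s : exec phase_limit s v_L 0 = s v_n 0 * 2 ^ s v_E 0.
Proof.
rewrite /phase_limit exec_then; set s1 := exec _ s.
have -> : s v_E 0 = s1 v_E 0 by [].
apply: (@loop_rule (fun k s' => s' v_L 0 = s v_n 0 * 2 ^ k)) => //.
  by rewrite set_cellE /= muln1.
move=> k s' _ _ _ E; rewrite /double exec_put !set_cellE /= E expnS; lia.
Qed.

Lemma shiftP s x : x != v_L -> x != i_x ->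
  exec (shift x) s x 0 = s x 0 * 2 ^ s v_L 0.
Proof.
move=> xL xi.
apply: (@loop_rule (fun k s' => s' x 0 = s x 0 * 2 ^ k)).
- by rewrite /= !inE !negb_or /= eq_sym xL.
- by rewrite /= inE eq_sym.
- by rewrite muln1 set_cellE (negbTE xi).
- move=> k s' hk sk _ E.
  by rewrite /double exec_put !set_cellE (negbTE xi) !eqxx /= E expnS; lia.
Qed.

Lemma phase_countP s n : s v_n 0 = n -> n <= s v_L 0 -> (forall d, s a_count d = 0) ->
  forall d, exec phase_count s a_count d = \sum_(j < n) (s a_jobs j == d).
Proof.
move=> sn nL s0 d.
apply: (@for_rule (fun k s' => s' a_count d = \sum_(j < k) (s a_jobs j == d))) => //.
- by rewrite s0 big_ord0.
- move=> k s' hk sk fr E; rewrite big_ord_recr /= -E exec_put set_cellE /= sk (fr a_jobs isT).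
  by rewrite eq_sym; case: eqP => [->|_]; rewrite ?addn1 ?addn0.
Qed.

Lemma powerP s x k e K E : x \notin [:: v_L; i_d; i_j] ->
  all (fun a => a \notin [:: x; i_d; i_j]) (reads k ++ reads e) ->
  eval s k = K -> eval s e = E -> K <= s v_L 0 -> E <= s v_L 0 ->
  exec (power x k e) s x 0 = (2 ^ E) ^ K.
Proof.
rewrite !inE !negb_or all_cat => /and3P[xL xd xj] /andP[rk re] ek ee KL EL.
have sub (X : seq nat) r : {subset X <= [:: x; i_d; i_j]} ->
    all (fun a => a \notin [:: x; i_d; i_j]) r -> all (fun a => a \notin X) r.
  by move=> XY; apply: sub_all => a; apply: contra; apply: XY.
rewrite /power exec_then; set s1 := exec _ s.
have fr1 : agree [:: x; i_d; i_j] s s1 by apply: agree_set; rewrite inE eqxx.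
have L1 : s1 v_L 0 = s v_L 0 by rewrite fr1 // !inE /= ?orbF eq_sym.
apply: (@for_rule (fun t s' => s' x 0 = (2 ^ E) ^ t)).
- by rewrite /= !inE /= ?orbF eq_sym.
- by rewrite /= !inE /= eq_sym.
- by apply: sub rk => a; rewrite /= !inE; case: (a == x); case: (a == 44); case: (a == 45).
- by rewrite (eval_agree fr1 rk).
- by rewrite L1.
- by move=> t s' v; rewrite set_cellE (negbTE xd).
- by rewrite /s1 exec_put set_cellE !eqxx.
- move=> t s' tK st fr It; rewrite expnS mulnC -It.
  have fr2 : agree [:: x; i_d; i_j] s s'.
    apply: agree_trans fr1 _; apply: agree_sub fr => a.
    by rewrite /= !inE; case: (a == x); case: (a == 44); case: (a == 45).
  apply: (@for_rule (fun u s2 => s2 x 0 = s' x 0 * 2 ^ u)).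
  + by rewrite /= !inE /= eq_sym.
  + by rewrite /= !inE eq_sym.
  + by apply: sub re => a; rewrite /= !inE; case: (a == x); case: (a == 44); case: (a == 45).
  + by rewrite (eval_agree fr2 re).
  + by rewrite fr2 // !inE /= ?orbF eq_sym.
  + by move=> u s2 v; rewrite set_cellE (negbTE xj).
  + by rewrite muln1.
  + move=> u s2 _ _ _ E2; rewrite /double exec_put set_cellE !eqxx /= E2 expnS; lia.
Qed.

Lemma phase_sizesP s P : s v_P 0 = P -> P.+2 <= s v_L 0 -> size_E1 P <= s v_L 0 ->
  size_E2 P <= s v_L 0 ->
  let s' := exec phase_sizes s in
  [/\ s' v_B 0 = size_B P, s' v_H1 0 = size_H1 P, s' v_K1 0 = size_K1 P
    & [/\ s' v_W 0 = size_W P, s' v_H2 0 = size_H2 P & s' v_K2 0 = size_K2 P]].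
Proof.
move=> sP PL E1L E2L; rewrite /phase_sizes /=.
rewrite exec_then; set s1 := exec (power v_B _ _) s.
rewrite exec_then; set s2 := exec _ s1.
rewrite exec_then; set s3 := exec _ s2.
rewrite exec_then; set s4 := exec _ s3.
rewrite exec_then; set s5 := exec _ s4.
rewrite exec_then; set s6 := exec _ s5.
rewrite exec_then; set s7 := exec _ s6.
rewrite exec_then; set s8 := exec _ s7.
have P1 : s1 v_P 0 = P by rewrite /s1 exec_frame.
have L1 : s1 v_L 0 = s v_L 0 by rewrite /s1 exec_frame.
have e2 : s2 v_E1 0 = size_E1 P by rewrite /s2 exec_put set_cellE /= P1.
have P2 : s2 v_P 0 = P by rewrite /s2 exec_frame.
have L2 : s2 v_L 0 = s v_L 0 by rewrite /s2 exec_frame.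
have P3 : s3 v_P 0 = P by rewrite /s3 exec_frame.
have L3 : s3 v_L 0 = s v_L 0 by rewrite /s3 exec_frame.
have e3 : s3 v_E1 0 = size_E1 P by rewrite /s3 exec_frame.
have P4 : s4 v_P 0 = P by rewrite /s4 exec_frame.
have L4 : s4 v_L 0 = s v_L 0 by rewrite /s4 exec_frame.
have e4 : s4 v_E1 0 = size_E1 P by rewrite /s4 exec_frame.
have P5 : s5 v_P 0 = P by rewrite /s5 exec_frame.
have L5 : s5 v_L 0 = s v_L 0 by rewrite /s5 exec_frame.
have e5 : s5 v_E1 0 = size_E1 P by rewrite /s5 exec_frame.
have P6 : s6 v_P 0 = P by rewrite /s6 exec_frame.
have L6 : s6 v_L 0 = s v_L 0 by rewrite /s6 exec_frame.
have e6 : s6 v_E1 0 = size_E1 P by rewrite /s6 exec_frame.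
have P7 : s7 v_P 0 = P by rewrite /s7 exec_frame.
have L7 : s7 v_L 0 = s v_L 0 by rewrite /s7 exec_frame.
have e7 : s7 v_E2 0 = size_E2 P.
  rewrite /s7 /size_E2.
  apply: (@for_rule (fun k s' => s' v_E2 0 = 1 + k * size_E1 P)) => //.
  - by rewrite /= P6 !addn1.
  - by rewrite L6.
  - move=> k s' _ _ fr E; rewrite exec_put set_cellE /= E (fr v_E1 isT) e6; lia.
have P8 : s8 v_P 0 = P by rewrite /s8 exec_frame.
have L8 : s8 v_L 0 = s v_L 0 by rewrite /s8 exec_frame.
have e8 : s8 v_E2 0 = size_E2 P by rewrite /s8 exec_frame.
have hB : s1 v_B 0 = size_B P.
  by rewrite /s1 (@powerP _ _ _ _ P 2) //=; lia.
have hH1 : s3 v_H1 0 = size_H1 P.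
  by rewrite /s3 (@powerP _ _ _ _ 1 (size_E1 P)) ?expn1 //= ?L2 //; lia.
have hK1 : s4 v_K1 0 = size_K1 P.
  by rewrite /s4 (@powerP _ _ _ _ P.+1 (size_E1 P)) //= ?L3 ?P3 ?addn1 //; lia.
have hW : s5 v_W 0 = size_W P.
  by rewrite /s5 (@powerP _ _ _ _ P.+2 (size_E1 P)) //= ?L4 ?P4 ?addn1.
have hH2 : s8 v_H2 0 = size_H2 P.
  by rewrite /s8 (@powerP _ _ _ _ 1 (size_E2 P)) ?expn1 //= ?L7 //; lia.
have hK2 : exec (power v_K2 types (V v_E2)) s8 v_K2 0 = size_K2 P.
  by rewrite (@powerP _ _ _ _ P.+1 (size_E2 P)) //= ?L8 ?P8 ?addn1 //; lia.
split; [| | |split] => //.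
- by rewrite /s8 /s7 /s6 /s5 /s4 /s3 /s2 !exec_frame.
- by rewrite /s8 /s7 /s6 /s5 /s4 !exec_frame.
- by rewrite /s8 /s7 /s6 /s5 !exec_frame.
- by rewrite /s8 /s7 /s6 !exec_frame.
- by rewrite exec_frame.
Qed.

Lemma phase_quotaP s m P B cnt : s v_m 0 = m -> 0 < m -> s v_P 0 = P ->
  P < s v_L 0 -> s v_B 0 = B -> (forall d, s a_count d = cnt d) ->
  (forall d, cnt d <= s v_L 0) ->
  let s' := exec phase_quota s in
  [/\ forall d, d <= P -> s' a_quota d = cnt d %/ m - B,
      forall d, 0 < d <= P -> s' a_rest d = cnt d - m * (cnt d %/ m - B)
    & s' a_rest 0 = m].
Proof.
move=> sm m0 sP PL sB scnt cL; rewrite /phase_quota /= exec_then exec_put.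
set s1 := exec _ s.
have m1 : s1 v_m 0 = m by rewrite /s1 exec_frame.
suff h : forall d, d < P.+1 -> s1 a_quota d = cnt d %/ m - B /\
                               s1 a_rest d = cnt d - m * (cnt d %/ m - B).
  split=> [d dP|d /andP[d0 dP]|]; rewrite set_cellE /=.
  - by have [] := h d dP.
  - by rewrite (gtn_eqF d0); have [] := h d dP.
  - by rewrite m1.
rewrite /s1.
apply: (@for_rule (fun k s' => forall d, d < k -> s' a_quota d = cnt d %/ m - B /\
                               s' a_rest d = cnt d - m * (cnt d %/ m - B))) => //.
- by rewrite /= sP addn1.
move=> k s2 kP sk fr IH.
rewrite exec_then; set s3 := exec _ s2.
rewrite exec_then; set s4 := exec _ s3.
rewrite exec_then; set s5 := exec _ s4.
rewrite exec_then; set s6 := exec _ s5.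
rewrite exec_then; set s7 := exec _ s6.
rewrite exec_then; set s8 := exec _ s7.
have c4 : s4 a_count k = cnt k by rewrite /s4 /s3 !exec_frame // (fr a_count isT).
have k4 : s4 i_d 0 = k by rewrite /s4 /s3 !exec_frame.
have m4 : s4 v_m 0 = m by rewrite /s4 /s3 !exec_frame // (fr v_m isT).
have L4 : s4 v_L 0 = s v_L 0 by rewrite /s4 /s3 !exec_frame // (fr v_L isT).
have [q5 _] : s5 t1 0 = minn (s4 v_L 0) (cnt k %/ m) /\
              s5 t2 0 = m * (minn (s4 v_L 0) (cnt k %/ m)).+1.
  (* [t2] is the next multiple of [m] to compare with the count; both variables stop changing once
     [t1] is the quotient. *)
  apply: (@loop_rule (fun t s' => s' t1 0 = minn t (cnt k %/ m) /\
                                  s' t2 0 = m * (minn t (cnt k %/ m)).+1)) => //.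
    rewrite min0n muln1 !set_cellE /= /s4 exec_put !set_cellE /= /s3 exec_put.
    by rewrite !set_cellE /= (fr v_m isT).
  move=> t s' tL st fr' [Q1 Q2]; rewrite exec_when /=.
  rewrite (fr' i_d isT) k4 (fr' a_count isT) c4 Q2 !set_cellE /=.
  have : (cnt k + 1 - m * (minn t (cnt k %/ m)).+1 == 0) = (cnt k %/ m <= t).
    rewrite subn_eq0 addn1 ltnNge [m * _]mulnC -leq_divRL //; lia.
  move=> ->; case: leqP => ht.
    by rewrite Q1 Q2; have -> : minn t.+1 (cnt k %/ m) = minn t (cnt k %/ m) by lia.
  rewrite exec_then !exec_put !set_cellE /= !set_cellE /= Q1 Q2 (fr' v_m isT) m4.
  have -> : minn t.+1 (cnt k %/ m) = (minn t (cnt k %/ m)).+1 by lia.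
  by rewrite addn1 addnC -mulnS.
have {}q5 : s5 t1 0 = cnt k %/ m.
  rewrite q5 L4; apply/minn_idPr; apply: leq_trans (leq_div _ _) (cL k).
have B5 : s5 v_B 0 = B by rewrite /s5 /s4 /s3 !exec_frame // (fr v_B isT).
have k5 : s5 i_d 0 = k by rewrite /s5 exec_frame.
have k6 : s6 i_d 0 = k by rewrite /s6 exec_frame.
have q6 : s6 a_quota k = cnt k %/ m - B.
  by rewrite /s6 exec_put set_cellE /= k5 eqxx q5 B5.
have q6' d : d != k -> s6 a_quota d = s2 a_quota d.
  move=> dk; rewrite /s6 exec_put set_cellE /= k5 (negbTE dk).
  by rewrite /s5 /s4 /s3 !exec_frame.
have c6 : s6 a_count k = cnt k by rewrite /s6 /s5 !exec_frame.
have k7 : s7 i_d 0 = k by rewrite /s7 exec_frame.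
have q7 d : s7 a_quota d = s6 a_quota d by rewrite /s7 exec_frame.
have t7 : s7 t2 0 = cnt k by rewrite /s7 exec_put set_cellE /= k6.
have m7 : s7 v_m 0 = m by rewrite /s7 /s6 /s5 !exec_frame.
have t8 : s8 t2 0 = cnt k - m * (cnt k %/ m - B).
  rewrite /s8.
  apply: (@for_rule (fun t s' => s' t2 0 = cnt k - m * t)) => //.
  - by rewrite /= k7 q7 q6.
  - rewrite /s7 /s6 /s5 !exec_frame // L4.
    by apply: leq_trans (leq_subr _ _) _; apply: leq_trans (leq_div _ _) (cL k).
  - by rewrite muln0 subn0.
  - move=> t s' _ _ fr' E; rewrite exec_put set_cellE /= E (fr' v_m isT) m7; lia.
have q8 d : s8 a_quota d = s6 a_quota d by rewrite /s8 exec_frame.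
have k8 : s8 i_d 0 = k by rewrite /s8 exec_frame.
move=> d; rewrite ltnS leq_eqVlt exec_put !set_cellE /= k8 q8 t8.
case: (eqVneq d k) => [->|dk] /=; first by rewrite q6.
move=> dk'; rewrite q6' //.
have -> : s8 a_rest d = s2 a_rest d by rewrite /s8 /s7 /s6 /s5 /s4 /s3 !exec_frame.
exact: IH.
Qed.

Lemma hornerP s x e P v : x \notin [:: v_L; v_P; i_d; i_x] ->
  s v_P 0 = P -> P < s v_L 0 ->
  (forall k s', k <= P -> s' i_d 0 = k -> agree [:: x; i_d; i_x] s s' ->
     eval s' e = v (P - k)) ->
  exec (horner x e) s x 0 = encode (2 ^ s v_L 0) P.+1 v.
Proof.
rewrite !inE !negb_or => /and4P[xL xP xd xx] sP PL he.
rewrite /horner exec_then; set s1 := exec _ s.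
have fr1 : agree [:: x; i_d; i_x] s s1 by apply: agree_set; rewrite inE eqxx.
have P1 : s1 v_P 0 = P by rewrite fr1 // !inE /= eq_sym negb_or xP.
have L1 : s1 v_L 0 = s v_L 0 by rewrite fr1 // !inE /= eq_sym negb_or xL.
set Q := 2 ^ _.
have -> : encode Q P.+1 v = encode Q P.+1 (fun j => v (P.+1 - P.+1 + j)).
  by apply: eq_encode => d _; rewrite subnn.
(* After [k] turns the accumulator encodes the top [k] components, moved down to position 0. *)
apply: (@for_rule (fun k s' => s' x 0 = encode Q k (fun j => v (P.+1 - k + j)))).
- by rewrite /= !inE /= !(eq_sym _ x) !negb_or xL.
- by rewrite /= !inE /= !(eq_sym _ x) !negb_or xd.
- by rewrite /= !inE /= !(eq_sym _ x) !negb_or xP.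
- by rewrite /= P1 addn1.
- by rewrite L1.
- by move=> k s' w; rewrite set_cellE (negbTE xd).
- by rewrite /s1 exec_put set_cellE !eqxx /encode big_ord0.
- move=> k s' kP sk fr Ik.
  have sub a : a \in [:: i_d, i_x, x & [:: x]] -> a \in [:: x; i_d; i_x].
    by rewrite !inE; case: (a == x); case: (a == 44); case: (a == 46).
  have fr2 : agree [:: x; i_d; i_x] s s'.
    apply: agree_trans fr1 _; apply: agree_sub fr => a /= h; apply: sub.
    by move: h; rewrite !inE; case: (a == x); case: (a == 44); case: (a == 46).
  rewrite exec_then; set s2 := exec _ s'.
  have fr3 : agree [:: x; i_d; i_x] s s2.
    apply: agree_trans fr2 _; apply: agree_sub (@exec_agree (shift x) s') => a.
    by rewrite /= !inE; case: (a == x); case: (a == 44); case: (a == 46).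
  have d2 : s2 i_d 0 = k by rewrite /s2 exec_frame //= !inE /= eq_sym ?negb_or xd.
  rewrite exec_put set_cellE !eqxx /= (he k) // /s2 shiftP // Ik.
  have -> : s' v_L 0 = s v_L 0 by rewrite fr2 // !inE /= eq_sym negb_or xL.
  rewrite -/Q encodeS addn0 addnC subSS mulnC; congr (_ + _ * _).
  by apply: eq_encode => d _; congr v; lia.
Qed.

Lemma phase_endsP s P W rest : s v_P 0 = P -> P < s v_L 0 -> s v_W 0 = W ->
  (forall d, d <= P -> s a_rest d = rest d) ->
  let s' := exec phase_ends s in let Q := 2 ^ s v_L 0 in
  s' v_start 0 = encode Q P.+1 (fun=> W) /\
  s' v_target 0 = encode Q P.+1 (fun d => W + rest d).
Proof.
move=> sP PL sW sr; rewrite /phase_ends /= exec_then; set s1 := exec _ s.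
have P1 : s1 v_P 0 = P by rewrite /s1 exec_frame.
have L1 : s1 v_L 0 = s v_L 0 by rewrite /s1 exec_frame.
have W1 : s1 v_W 0 = W by rewrite /s1 exec_frame.
split.
  rewrite exec_frame // /s1; apply: hornerP => // k s' _ _ fr.
  by rewrite /= (fr v_W isT).
rewrite -L1; apply: hornerP; rewrite ?L1 // => k s' kP sk fr.
rewrite /= (fr v_W isT) W1 (fr v_P isT) P1 sk (fr a_rest isT) /s1 exec_frame //.
by rewrite sr // leq_subr.
Qed.

Lemma phase_baseP s m P rest : s v_m 0 = m -> 0 < m -> m <= s v_L 0 -> s v_P 0 = P ->
  P < s v_L 0 -> (forall d, d <= P -> s a_rest d = rest d) ->
  (forall d, d <= P -> m + rest d <= s v_L 0) ->
  (forall d, s a_quot d = 0) -> (forall d, s a_rem d = 0) ->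
  forall i, i < m -> exec phase_base s a_base i =
                     encode (2 ^ s v_L 0) P.+1 (fun d => i * rest d %/ m).
Proof.
move=> sm m0 mL sP PL sr rL sq0 sr0.
pose Q := 2 ^ s v_L 0; rewrite -/Q.
pose I k (s' : store) := [/\ forall d, d <= P -> s' a_quot d = k * rest d %/ m,
    forall d, d <= P -> s' a_rem d = k * rest d %% m
  & forall i, i < k -> s' a_base i = encode Q P.+1 (fun d => i * rest d %/ m)].
suff : I m (exec phase_base s) by case.
apply: for_rule => //.
  by split=> // d dP; rewrite mul0n ?div0n ?mod0n.
move=> k s1 km sk fr [Iq Ir Ib].
rewrite exec_then; set s2 := exec _ s1.
rewrite exec_then; set s3 := exec _ s2.
have P1 : s1 v_P 0 = P by rewrite (fr v_P isT).
have L1 : s1 v_L 0 = s v_L 0 by rewrite (fr v_L isT).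
have h2 : s2 t1 0 = encode Q P.+1 (fun d => k * rest d %/ m).
  rewrite /s2 /Q -L1; apply: hornerP; rewrite ?L1 // => j s' jP sj fr'.
  by rewrite /= (fr' v_P isT) P1 sj (fr' a_quot isT) Iq // leq_subr.
have i2 : s2 i_i 0 = k by rewrite /s2 exec_frame.
have b3 i : i < k.+1 -> s3 a_base i = encode Q P.+1 (fun d => i * rest d %/ m).
  rewrite ltnS leq_eqVlt /s3 exec_put set_cellE /= i2.
  case: eqP => [->|_] /= ik; first by rewrite h2.
  by rewrite /s2 exec_frame // Ib.
have q3 d : d <= P -> s3 a_quot d = k * rest d %/ m.
  by move=> dP; rewrite /s3 /s2 !exec_frame // Iq.
have r3 d : d <= P -> s3 a_rem d = k * rest d %% m.
  by move=> dP; rewrite /s3 /s2 !exec_frame // Ir.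
have P3 : s3 v_P 0 = P by rewrite /s3 /s2 !exec_frame.
have L3 : s3 v_L 0 = s v_L 0 by rewrite /s3 /s2 !exec_frame.
have m3 : s3 v_m 0 = m by rewrite /s3 /s2 !exec_frame // (fr v_m isT).
have e3 d : d <= P -> s3 a_rest d = rest d.
  by move=> dP; rewrite /s3 /s2 !exec_frame // (fr a_rest isT) sr.
suff h : forall d, d < P.+1 -> exec (For i_d v_L types (
      Put a_rem (V i_d) (Cell a_rem (V i_d) +' Cell a_rest (V i_d)) ;;
      Loop i_x v_L (When (Cell a_rem (V i_d) +' Num 1 -' V v_m) (
        Put a_rem (V i_d) (Cell a_rem (V i_d) -' V v_m) ;;
        Put a_quot (V i_d) (Cell a_quot (V i_d) +' Num 1))))) s3 a_quot d
      = k.+1 * rest d %/ m /\ exec (For i_d v_L types (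
      Put a_rem (V i_d) (Cell a_rem (V i_d) +' Cell a_rest (V i_d)) ;;
      Loop i_x v_L (When (Cell a_rem (V i_d) +' Num 1 -' V v_m) (
        Put a_rem (V i_d) (Cell a_rem (V i_d) -' V v_m) ;;
        Put a_quot (V i_d) (Cell a_quot (V i_d) +' Num 1))))) s3 a_rem d
      = k.+1 * rest d %% m.
  split=> [d dP|d dP|i ik]; [by have [] := h d dP|by have [] := h d dP|].
  by rewrite exec_frame // b3.
move=> d dP.
(* For the fixed component [d], the flag [d < t] tells whether the loop has already updated it. *)
pose q' j := if j then k.+1 * rest d %/ m else k * rest d %/ m.
pose r' j := if j then k.+1 * rest d %% m else k * rest d %% m.
have -> : k.+1 * rest d %/ m = q' (d < P.+1) by rewrite dP.
have -> : k.+1 * rest d %% m = r' (d < P.+1) by rewrite dP.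
apply: (@for_rule (fun t s' => s' a_quot d = q' (d < t) /\ s' a_rem d = r' (d < t))) => //.
- by rewrite /= P3 addn1.
- by rewrite L3.
- by rewrite ltn0 /= q3 // r3.
move=> t s4 tP st fr4 [E1 E2].
rewrite exec_then exec_put; set s5 := set_cell _ _ _ _.
have t5 : s5 i_d 0 = t by [].
have m5 : s5 v_m 0 = m by rewrite /s5 set_cellE /= (fr4 v_m isT).
have L5 : s5 v_L 0 = s v_L 0 by rewrite /s5 set_cellE /= (fr4 v_L isT).
have [dt|dt] := eqVneq d t; last first.
  have -> : (d < t.+1) = (d < t) by rewrite ltnS leq_eqVlt (negbTE dt).
  apply: (@loop_rule (fun _ s' => s' a_quot d = q' (d < t) /\ s' a_rem d = r' (d < t))) => //.
    by rewrite !set_cellE /= /s5 !set_cellE /= st (negbTE dt).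
  move=> u s' _ _ fr' [F1 F2]; rewrite !set_cellE /= exec_when; case: eqP => // _.
  rewrite exec_then !exec_put !set_cellE /= !set_cellE /=.
  by rewrite (fr' i_d isT) t5 (negbTE dt).
rewrite -dt ltnn in E1 E2; rewrite -dt in st t5 *; rewrite ltnSn /=.
pose r0 := k * rest d %% m + rest d.
have r5 : s5 a_rem d = r0.
  by rewrite /s5 set_cellE /= st eqxx E2 (fr4 a_rest isT) e3.
have q5 : s5 a_quot d = k * rest d %/ m by rewrite /s5 set_cellE /=.
have [F1 F2] : exec (Loop i_x v_L (When (Cell a_rem (V i_d) +' Num 1 -' V v_m) (
        Put a_rem (V i_d) (Cell a_rem (V i_d) -' V v_m) ;;
        Put a_quot (V i_d) (Cell a_quot (V i_d) +' Num 1)))) s5 a_quot d =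
        k * rest d %/ m + minn (s5 v_L 0) (r0 %/ m) /\
   exec (Loop i_x v_L (When (Cell a_rem (V i_d) +' Num 1 -' V v_m) (
        Put a_rem (V i_d) (Cell a_rem (V i_d) -' V v_m) ;;
        Put a_quot (V i_d) (Cell a_quot (V i_d) +' Num 1)))) s5 a_rem d =
        r0 - m * minn (s5 v_L 0) (r0 %/ m).
  apply: (@loop_rule (fun u s' => s' a_quot d = k * rest d %/ m + minn u (r0 %/ m) /\
                        s' a_rem d = r0 - m * minn u (r0 %/ m))) => //.
    by rewrite !set_cellE /= min0n addn0 muln0 subn0.
  move=> u s' uL su fr' [F1 F2]; rewrite !set_cellE /= exec_when /=.
  rewrite (fr' i_d isT) t5 F2 (fr' v_m isT) m5.
  have hm : m * (r0 %/ m) <= r0 by rewrite mulnC leq_trunc_div.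
  case: (leqP (r0 %/ m) u) => hu.
    have -> : minn u.+1 (r0 %/ m) = r0 %/ m by lia.
    have hu' : minn u (r0 %/ m) = r0 %/ m by lia.
    rewrite hu' in F1 F2 *.
    have := divn_eq r0 m; have := ltn_pmod r0 m0; rewrite mulnC => g1 g2.
    have -> : r0 - m * (r0 %/ m) + 1 - m = 0 by lia.
    by [].
  have -> : minn u.+1 (r0 %/ m) = u.+1 by lia.
  have hu' : minn u (r0 %/ m) = u by lia.
  rewrite hu' in F1 F2 *.
  have g1 : m * u.+1 <= r0 by apply: leq_trans hm; rewrite leq_mul2l hu orbT.
  rewrite mulnS in g1 *.
  case: eqP => g2; first by exfalso; lia.
  rewrite exec_then !exec_put !set_cellE /= !set_cellE /=.
  by rewrite (fr' i_d isT) t5 eqxx F1 F2 (fr' v_m isT) m5; split; lia.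
rewrite F1 F2.
(* [L] turns complete the division, since [r0 < m + rest d <= L]. *)
have -> : minn (s5 v_L 0) (r0 %/ m) = r0 %/ m.
  rewrite L5; apply/minn_idPr; apply: leq_trans (leq_div _ _) _; rewrite /r0.
  by have := rL d dP; have := ltn_pmod (k * rest d) m0; lia.
have E : k.+1 * rest d = k * rest d %/ m * m + r0.
  by rewrite mulSn {1}(divn_eq (k * rest d) m) /r0; lia.
rewrite /q' /r' E divnMDl // modnMDl; split=> //.
by rewrite {1}(divn_eq r0 m) mulnC addKn.
Qed.

Definition is_table (s : store) (Q H D : nat) : Prop := forall x, x < H ^ D ->
  [/\ s a_code x = encode Q D (digit H x), s a_tail x = x %/ H, s a_head x = x %% H,
      s a_load x = \sum_(d < D) digit H x d * d
    & s a_sum x = \sum_(d < D) digit H x d * 1].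

(** Row 0 is its own tail and is computed from its previous contents, hence the three conditions on
    zeros. The bounds 20 keep the two parameters apart from everything that [table] writes. *)
Lemma tableP vH vN s H D : vH < 20 -> vN < 20 ->
  1 < H -> 0 < D -> s vH 0 = H -> s vN 0 = H ^ D -> H ^ D <= s v_L 0 ->
  s a_code 0 = 0 -> s a_sum 0 = 0 -> s a_load 0 = 0 ->
  is_table (exec (table vH vN) s) (2 ^ s v_L 0) H D.
Proof.
move=> vH20 vN20 H1 D0 sH sN NL z1 z2 z3; set Q := 2 ^ s v_L 0.
have H0 : 0 < H by lia.
pose I k (s' : store) := [/\ s' t1 0 = k %/ H, s' t2 0 = k %% H,
  forall x, x < k -> [/\ s' a_code x = encode Q D (digit H x),
      s' a_tail x = x %/ H, s' a_head x = x %% H,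
      s' a_load x = \sum_(d < D) digit H x d * d
    & s' a_sum x = \sum_(d < D) digit H x d * 1]
  & k = 0 -> [/\ s' a_code 0 = 0, s' a_sum 0 = 0 & s' a_load 0 = 0]].
suff : I (H ^ D) (exec (table vH vN) s) by case.
rewrite /table exec_then; set s1 := exec _ s.
rewrite exec_then; set s2 := exec _ s1.
have low a j : a < 40 -> s2 a j = s a j.
  by move=> ha; rewrite /s2 /s1 !exec_frame //= inE; apply/eqP; lia.
have notin a X : a < 20 -> all (fun y => 20 <= y) X -> a \notin X.
  by move=> a20 /allP hX; apply/negP => /hX; rewrite leqNgt a20.
apply: for_rule => //.
- by rewrite /= andbT notin.
- by rewrite /= low // (leq_trans vN20).
- by split; rewrite ?div0n ?mod0n // => _; rewrite !low.
move=> k s3 kD sk fr [J1 J2 J3 J4].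
have L3 : s3 v_L 0 = s v_L 0 by rewrite (fr v_L isT) low.
have H3 : s3 vH 0 = H by rewrite fr ?notin // low // (leq_trans vH20).
(* Moving all digits up one place multiplies the code by [Q] and adds the digit sum to the load;
   this is why the digit sum is tabulated. *)
have [b1 b2 b3] : [/\ s3 a_code (k %/ H) * Q + k %% H = encode Q D (digit H k),
    s3 a_load (k %/ H) + s3 a_sum (k %/ H) = \sum_(d < D) digit H k d * d
  & s3 a_sum (k %/ H) + k %% H = \sum_(d < D) digit H k d * 1].
  rewrite /encode (sum_digits_rec (fun d => Q ^ d) H0 kD D0).
  rewrite (sum_digits_rec (fun d => d) H0 kD D0) (sum_digits_rec (fun=> 1) H0 kD D0).
  rewrite expn0 !muln1 muln0 add0n.
  have [k0|k0] := posnP k.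
    have [E1 E2 E3] := J4 k0; rewrite k0 div0n mod0n E1 E2 E3.
    have Z w : \sum_(d < D) digit H 0 d * w d = 0.
      by apply: big1 => d _; rewrite /digit div0n mod0n.
    by rewrite (Z (fun d => Q ^ d.+1)) (Z S) (Z (fun=> 1)).
  have kH : k %/ H < k by apply: ltn_Pdiv.
  have [-> _ _ -> ->] := J3 _ kH; split; last by rewrite addnC.
    rewrite /encode big_distrl /= addnC; congr (_ + _).
    by apply: eq_bigr => d _; rewrite expnS mulnA mulnAC -mulnA mulnC; lia.
  by rewrite -big_split /=; apply: eq_bigr => d _; rewrite -mulnDr addn1.
rewrite exec_then; set s4 := exec _ s3.
rewrite exec_then; set s5 := exec _ s4.
have e5 : s5 t3 0 = s3 a_code (k %/ H) * Q.
  by rewrite /s5 shiftP // /s4 exec_put !set_cellE /= J1 L3.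
have fr5 a j : a != t3 -> a != i_x -> s5 a j = s3 a j.
  move=> h1 h2; rewrite /s5 /s4 !exec_frame //= !inE (negbTE h1) //.
  by rewrite (negbTE h2).
move: e5 fr5; move: s5 => s5 e5 fr5 {s4}.
have [k5 q5 r5] : [/\ s5 i_k 0 = k, s5 t1 0 = k %/ H & s5 t2 0 = k %% H].
  by rewrite !fr5.
rewrite exec_then exec_put /= k5 q5; set s6 := set_cell _ _ _ _.
have [k6 q6 r6] : [/\ s6 i_k 0 = k, s6 t1 0 = k %/ H & s6 t2 0 = k %% H] by [].
rewrite exec_then exec_put /= k6 r6; set s7 := set_cell _ _ _ _.
have [k7 q7 r7] : [/\ s7 i_k 0 = k, s7 t1 0 = k %/ H & s7 t2 0 = k %% H] by [].
rewrite exec_then exec_put /= k7 q7; set s8 := set_cell _ _ _ _.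
have [k8 q8 r8] : [/\ s8 i_k 0 = k, s8 t1 0 = k %/ H & s8 t2 0 = k %% H] by [].
rewrite exec_then exec_put /= k8 q8 r8; set s9 := set_cell _ _ _ _.
have [k9 q9 r9] : [/\ s9 i_k 0 = k, s9 t1 0 = k %/ H & s9 t2 0 = k %% H] by [].
rewrite exec_then exec_put /= k9 r9; set s10 := set_cell _ _ _ _.
have rows : forall x, x < k.+1 -> [/\ s10 a_code x = encode Q D (digit H x),
      s10 a_tail x = x %/ H, s10 a_head x = x %% H,
      s10 a_load x = \sum_(d < D) digit H x d * d
    & s10 a_sum x = \sum_(d < D) digit H x d * 1].
  move=> x; rewrite /s10 /s9 /s8 /s7 /s6 !set_cellE /= ?set_cellE /= e5 !fr5 //.
  rewrite ltnS leq_eqVlt; case: eqP => [->|_] /=; last exact: J3.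
  by rewrite b1 b2 b3.
have [q10 r10] : s10 t1 0 = k %/ H /\ s10 t2 0 = k %% H by [].
have H10 : s10 vH 0 = H.
  have F c : 20 <= c -> (vH == c) = false by move=> ?; apply/negbTE/eqP; lia.
  by rewrite /s10 /s9 /s8 /s7 /s6 !set_cellE !F //= fr5 ?H3 ?F.
rewrite exec_then exec_put /= r10; set s11 := set_cell _ _ _ _.
have H11 : s11 vH 0 = H by rewrite /s11 set_cellE; case: eqP => [e|_] //; lia.
rewrite exec_when /= H11 exec_then !exec_put /=.
have [q11 r11] : s11 t1 0 = k %/ H /\ s11 t2 0 = k %% H + 1 by [].
rewrite r11 [set_cell _ _ _ _ t1 0]set_cellE /= q11.
have kH := ltn_pmod k H0.
have D1 : k.+1 %/ H = k %/ H + (k %% H).+1 %/ H.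
  by rewrite {1}(divn_eq k H) -addnS divnMDl.
have M1 : k.+1 %% H = (k %% H).+1 %% H.
  by rewrite {1}(divn_eq k H) -addnS modnMDl.
case: eqP => h; split=> //; rewrite ?D1 ?M1 ?set_cellE /= ?set_cellE /= ?q11 ?r11 /=.
- by rewrite [_.+1 %/ _]divn_small ?addn0 //; lia.
- by rewrite [_.+1 %% _]modn_small ?addn1 //; lia.
- have -> : (k %% H).+1 = H by lia.
  by rewrite divnn H0.
- have -> : (k %% H).+1 = H by lia.
  by rewrite modnn.
Qed.

Lemma phase_copyP s K : s v_K2 0 = K -> K <= s v_L 0 ->
  forall x, x < K -> exec phase_copy s a_offset x = s a_code x.
Proof.
move=> sK KL.
apply: (@for_rule (fun k s' => forall x, x < k -> s' a_offset x = s a_code x)) => //.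
move=> k s' _ sk fr IH x; rewrite ltnS leq_eqVlt exec_put set_cellE /= sk.
by case: eqP => [->|_] /= h; [rewrite (fr a_code isT)|apply: IH].
Qed.

(** * Correctness of the search *)

Section Search.

Variables (m P L Q H1 K1 W H2 K2 : nat) (rest : nat -> nat).
(** [W_ge] and [H2_gt] place the offsets [path + W - base] in the range from 0 to [H2 - 1]; [Q_ge]
    rules out carries when a base point, an offset and a configuration are added. *)
Hypotheses (m0 : 0 < m) (mL : m <= L) (K1L : K1 <= L) (K2L : K2 <= L).
Hypotheses (K1E : K1 = H1 ^ P.+1) (K2E : K2 = H2 ^ P.+1).
Hypotheses (H1_gt0 : 0 < H1) (W_ge : K1 * H1 <= W) (H2_gt : W + H1 < H2).
Hypothesis Q_ge : forall d, d <= P -> rest d + H2 + H1 <= Q.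

Definition code_of k := encode Q P.+1 (digit H1 k).
Definition load_of k := \sum_(d < P.+1) digit H1 k d * d.
Definition offset_of o := encode Q P.+1 (digit H2 o).
Definition base_of i := encode Q P.+1 (fun d => i * rest d %/ m).
Definition start_of := encode Q P.+1 (fun=> W).
Definition target_of := encode Q P.+1 (fun d => W + rest d).

Definition config (T k : nat) : Prop := [/\ k < K1, k %% H1 = 1 & load_of k <= T].

Definition search_ready (s : store) : Prop :=
  [/\ [/\ s v_m 0 = m, s v_L 0 = L, s v_K1 0 = K1 & s v_K2 0 = K2],
      s v_start 0 = start_of, s v_target 0 = target_of,
      forall i, i < m -> s a_base i = base_of i
    & (forall o, o < K2 -> s a_offset o = offset_of o) /\
      (forall k, k < K1 -> [/\ s a_code k = code_of k, s a_head k = k %% H1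
                             & s a_load k = load_of k])].

Lemma search_ready_agree X s s' : agree X s s' ->
  all (fun a => a \notin X)
      [:: v_m; v_L; v_K1; v_K2; v_start; v_target; a_base; a_offset; a_code; a_head; a_load] ->
  search_ready s -> search_ready s'.
Proof.
move=> fr /allP hX [[h1 h2 h3 h4] h5 h6 h7 [h8 h9]].
have F a i : a \in [:: v_m; v_L; v_K1; v_K2; v_start; v_target; a_base; a_offset; a_code;
    a_head; a_load] -> s' a i = s a i by move=> /hX aX; rewrite fr.
split; first by rewrite !F.
- by rewrite F.
- by rewrite F.
- by move=> i im; rewrite F // h7.
- by split=> [o oK|k kK]; rewrite ?F //; [apply: h8|apply: h9].
Qed.

(* Every marked code other than the start carries the index of a configuration
   leading to it from another marked code; the digits of the latter are small
   enough to exclude a carry. *)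
Definition linked (T : nat) (M : nat -> nat) : Prop := forall v, 0 < M v ->
  v = start_of \/ exists k y, [/\ M v = k.+1, config T k,
    v = encode Q P.+1 y + code_of k, 0 < M (encode Q P.+1 y)
  & forall d, d <= P -> y d + H1 <= Q].

Lemma eq_linked T M M' : M =1 M' -> linked T M -> linked T M'.
Proof.
move=> E h v; rewrite -E => /h[->|[k [y [h1 h2 h3 h4 h5]]]]; first by left.
by right; exists k, y; rewrite -!E.
Qed.

(** A mark may be overwritten, but it never returns to 0, so the predecessors used by older links
    stay marked. *)
Lemma linked_mark T M k y : linked T M -> config T k -> 0 < M (encode Q P.+1 y) ->
  (forall d, d <= P -> y d + H1 <= Q) ->
  linked T (fun v => if v == encode Q P.+1 y + code_of k then k.+1 else M v).
Proof.
move=> lM ck My yQ v.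
have pos u : 0 < M u -> 0 < (if u == encode Q P.+1 y + code_of k then k.+1 else M u).
  by case: ifP.
case: eqP => [->|_] h; last first.
  have [->|[k' [y' [h1 h2 h3 h4 h5]]]] := lM v h; first by left.
  by right; exists k', y'; split=> //; apply: pos.
by right; exists k, y; split=> //; apply: pos.
Qed.

(** Without carries, the equation between codes in [linked] is an equation between vectors. *)
Lemma marked_chain T M x : linked T M -> 0 < M (encode Q P.+1 x) ->
  (forall d, d <= P -> x d < Q) ->
  (forall d, d <= P -> x d = W) \/
  exists k y, [/\ M (encode Q P.+1 x) = k.+1, config T k, 0 < M (encode Q P.+1 y),
    forall d, d <= P -> y d < Q & forall d, d <= P -> x d = y d + digit H1 k d].
Proof.
have WQ d : d <= P -> W < Q by move=> dP; have := Q_ge dP; lia.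
move=> lM Mx xQ; case: (lM _ Mx) => [e|[k [y [h1 h2 h3 h4 h5]]]].
  by left; apply: encode_inj e => //; exact: WQ.
right; exists k, y; split=> //.
  by move=> d dP; have := h5 d dP; lia.
apply: (@encode_inj Q P.+1) => //; last by rewrite h3 encodeD.
by move=> d dP; have := h5 d dP; have := digit_lt k d H1_gt0; lia.
Qed.

Definition search_step : cmd :=
  t1 <-- Cell a_base (V i_i) +' Cell a_offset (V i_o) ;;
  When (Cell a_mark (V t1)) (
  When (Num 1 -' Cell a_mark (V v_target))
    (Put a_mark (V t1 +' Cell a_code (V i_k)) (V i_k +' Num 1))).

Lemma search_stepP s i k o : search_ready s -> i < m -> k < K1 -> o < K2 ->
  s i_i 0 = i -> s i_k 0 = k -> s i_o 0 = o ->
  let v := base_of i + offset_of o in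
  exec search_step s a_mark =1 fun u =>
    if [&& 0 < s a_mark v, s a_mark target_of == 0 & u == v + code_of k]
    then k.+1 else s a_mark u.
Proof.
case=> [[h1 h2 h3 h4] h5 h6 h7 [h8 h9]] im kK oK si sk so v u.
have [hc _ _] := h9 k kK.
rewrite /search_step exec_then exec_put /= si so h7 // h8 // -/v.
rewrite exec_when /= !set_cellE /= exec_when /= !set_cellE /= h6.
case: (s a_mark v) => [|Mv] //=.
case: (s a_mark target_of) => [|Mt] //=.
rewrite exec_put /= !set_cellE /= sk hc addn1.
by [].
Qed.

(** Until the target is marked, the current limit [T] is at most [Ts], and afterwards nothing is
    written; so no link ever uses a configuration of load above [Ts]. *)
Definition good (Ts T : nat) (M : nat -> nat) : Prop :=
  linked Ts M /\ (T <= Ts \/ 0 < M target_of).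

Lemma search_loop_oP Ts T s i k : search_ready s -> i < m -> config T k ->
  s i_i 0 = i -> s i_k 0 = k -> good Ts T (s a_mark) ->
  let s' := exec (For i_o v_L (V v_K2) search_step) s in
  [/\ good Ts T (s' a_mark), forall v, 0 < s a_mark v -> 0 < s' a_mark v
    & forall o, o < K2 -> let v := base_of i + offset_of o in 0 < s a_mark v ->
        0 < s' a_mark target_of \/ 0 < s' a_mark (v + code_of k)].
Proof.
move=> rs im ck si sk gs /=; have [kK k1 kT] := ck.
pose I j (s' : store) := [/\ good Ts T (s' a_mark),
  forall v, 0 < s a_mark v -> 0 < s' a_mark v
  & forall o, o < j -> let v := base_of i + offset_of o in 0 < s a_mark v ->
        0 < s' a_mark target_of \/ 0 < s' a_mark (v + code_of k)].
have [[_ sL _ sK2] _ _ _ _] := rs.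
suff : I K2 (exec (For i_o v_L (V v_K2) search_step) s) by [].
apply: for_rule => //.
  by rewrite sL.
move=> o s1 oK so fr [[lM gT] mono fin].
have rs1 : search_ready s1 by apply: search_ready_agree fr _ rs.
have E := @search_stepP s1 i k o rs1 im kK oK.
rewrite (fr i_i isT) (fr i_k isT) si sk so in E.
have {}E := E erefl erefl erefl; set v := base_of i + offset_of o in E.
have mono1 u : 0 < s1 a_mark u -> 0 < exec search_step s1 a_mark u.
  by rewrite E; case: ifP.
split.
- split; last by case: gT => h; [left|right; apply: mono1].
  apply: (@eq_linked _ _ _ (fun u => esym (E u))).
  have [Mv|] := boolP (0 < s1 a_mark v) => /=; last by move=> _; apply: eq_linked lM.
  have [Mt|] := boolP (s1 a_mark target_of == 0) => /=; last by move=> _; apply: eq_linked lM.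
  (* Base point and offset exhibit [v] as the code of a vector with components below [rest d + H2],
     which leaves room for one more configuration. *)
  pose y d := i * rest d %/ m + digit H2 o d.
  have Ev : v = encode Q P.+1 y by rewrite /y encodeD.
  rewrite Ev; apply: linked_mark => //.
  + split=> //; apply: leq_trans kT _.
    by case: gT => //; rewrite (eqP Mt).
  + by rewrite -Ev.
  + move=> d dP; rewrite /y; have H2_gt0 : 0 < H2 by lia.
    have := digit_lt o d H2_gt0; have := Q_ge dP.
    have : i * rest d %/ m <= rest d.
      by rewrite -{2}(mulKn (rest d) m0) leq_div2r // leq_mul2r (ltnW im) orbT.
    by move: (_ %/ m) (digit _ _ _) => a b; lia.
- by move=> u /mono /mono1.
- move=> o'; rewrite ltnS leq_eqVlt => /orP[/eqP ->|o'o] v' Mv'; last first.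
    by case: (fin o' o'o Mv') => h; [left|right]; apply: mono1.
  have Mv1 := mono _ Mv'.
  have [Mt|Mt] := posnP (s1 a_mark target_of); last by left; apply: mono1.
  by right; rewrite E Mv1 Mt !eqxx.
Qed.

Definition search_config : cmd :=
  When (Eqb (Cell a_head (V i_k)) (Num 1)) (
  When (V i_T +' Num 1 -' Cell a_load (V i_k)) (For i_o v_L (V v_K2) search_step)).

Lemma search_configP Ts T s i k : search_ready s -> i < m -> k < K1 ->
  s i_T 0 = T -> s i_i 0 = i -> s i_k 0 = k -> good Ts T (s a_mark) ->
  let s' := exec search_config s in
  [/\ good Ts T (s' a_mark), forall v, 0 < s a_mark v -> 0 < s' a_mark v
    & config T k -> forall o, o < K2 -> let v := base_of i + offset_of o in
        0 < s a_mark v -> 0 < s' a_mark target_of \/ 0 < s' a_mark (v + code_of k)].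
Proof.
move=> rs im kK sT si sk gs; have [_ _ _ _ [_ /(_ k kK)[_ hh hl]]] := rs.
rewrite /= /search_config exec_when /= sk hh.
case: (k %% H1 =P 1) => k1; last first.
  case: eqP => h; last by exfalso; lia.
  by split=> // -[_ /k1].
rewrite k1 /= exec_when /= sT sk hl.
case: eqP => h; first by split=> // -[_ _]; lia.
have ck : config T k by split=> //; lia.
have [a b c] := search_loop_oP rs im ck si sk gs.
by split.
Qed.

(** * Completeness: the search follows the rounded path of a given solution *)

Section Complete.

Variables (Ts : nat) (sol : nat -> nat).
Hypothesis sol_config : forall i, i < m -> config Ts (sol i).
Hypothesis sol_rest : forall d, d <= P -> \sum_(i < m) digit H1 (sol i) d = rest d.

Let N k := \sum_(i < m) (sol i == k).
Let path := path_vector m K1 N (digit H1).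

Lemma N_le k : N k <= m.
Proof.
rewrite /N -[X in _ <= X]card_ord -sum1_card; apply: leq_sum => i _; exact: leq_b1.
Qed.

Lemma N_config k : 0 < N k -> config Ts k.
Proof.
move=> h; have [i /eqP <-] : exists i : 'I_m, sol i == k.
  apply/existsP; apply: contraTT h; rewrite negb_exists => /forallP h.
  by rewrite /N big1 // => i _; rewrite (negbTE (h i)).
exact: sol_config.
Qed.

Lemma sol_total d : d <= P -> \sum_(l < K1) N l * digit H1 l d = rest d.
Proof.
move=> dP; rewrite -sol_rest // /N.
under eq_bigr => l _ do rewrite big_distrl /=.
rewrite exchange_big /=; apply: eq_bigr => i _.
have [iK _ _] := sol_config (ltn_ord i).
rewrite (bigD1 (Ordinal iK)) //= eqxx mul1n big1 ?addn0 // => l.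
by rewrite -val_eqE /= eq_sym => /negbTE ->.
Qed.

Definition waypoint i k := encode Q P.+1 (fun d => path i k d + W).

(** By [path_window] the path is at most [K1 * H1 <= W] below the base point and at most [H1] above
    it, so after the shift by [W] the difference is a natural number below [H2]. *)
Lemma waypoint_offset i k : i < m ->
  exists2 o, o < K2 & waypoint i k = base_of i + offset_of o.
Proof.
move=> im; pose x d := path i k d + W - i * rest d %/ m.
have H d : d <= P -> i * rest d %/ m <= path i k d + W /\ x d < H2.
  move=> dP.
  have vH l : digit H1 l d <= H1 by apply/ltnW/digit_lt.
  have tH : \sum_(l < K1) N l * digit H1 l d <= m * H1.
    rewrite sol_total // -sol_rest // -[m in m * _]card_ord -sum_nat_const.
    by apply: leq_sum => j _; apply: vH.
  have := path_window m0 k im vH tH; rewrite sol_total // -/path => -[a b].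
  by rewrite /x; move: W_ge H2_gt a b; move: (_ %/ m) (path i k d) (K1 * H1) => A B C; lia.
exists (encode H2 P.+1 x); first by rewrite K2E; apply: encode_lt => d /H[].
rewrite /waypoint /base_of /offset_of -encodeD; apply: eq_encode => d dP.
rewrite digit_encode //; last by move=> e /H[].
by have [] := H d dP; rewrite /x; move: (_ %/ m) => A; lia.
Qed.

Lemma waypoint0 : waypoint 0 0 = start_of.
Proof. by apply: eq_encode => d _; rewrite /path path0. Qed.

Lemma waypoint_end : waypoint m 0 = target_of.
Proof.
apply: eq_encode => d dP; rewrite /path path_end // sol_total // addnC //.
Qed.

Lemma waypoint_last i : waypoint i K1 = waypoint i.+1 0.
Proof. by apply: eq_encode => d _; rewrite /path path_last. Qed.

Lemma waypoint_step i k : k < K1 -> waypoint i k.+1 = waypoint i k \/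
  config Ts k /\ waypoint i k.+1 = waypoint i k + code_of k.
Proof.
move=> kK; case: (path_step (digit H1) m0 N_le i kK) => [h|[Nk h]].
  by left; apply: eq_encode => d _; rewrite /path h.
right; split; first exact: N_config.
rewrite /waypoint /code_of -encodeD; apply: eq_encode => d _.
by rewrite /path h addnAC.
Qed.

(** The path uses each configuration at most once per round, in the order in which the loop offers
    them; hence one pass carries the mark from [waypoint i 0] to [waypoint i.+1 0]. *)
Lemma search_loop_kP T s i : search_ready s -> i < m -> s i_T 0 = T -> s i_i 0 = i ->
  good Ts T (s a_mark) ->
  let s' := exec (For i_k v_L (V v_K1) search_config) s in
  [/\ good Ts T (s' a_mark), forall v, 0 < s a_mark v -> 0 < s' a_mark v
    & T = Ts -> 0 < s a_mark target_of \/ 0 < s a_mark (waypoint i 0) ->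
      0 < s' a_mark target_of \/ 0 < s' a_mark (waypoint i.+1 0)].
Proof.
move=> rs im sT si gs /=.
pose I j (s' : store) := [/\ good Ts T (s' a_mark),
  forall v, 0 < s a_mark v -> 0 < s' a_mark v
  & T = Ts -> 0 < s a_mark target_of \/ 0 < s a_mark (waypoint i 0) ->
      0 < s' a_mark target_of \/ 0 < s' a_mark (waypoint i j)].
have [[_ sL sK1 _] _ _ _ _] := rs.
suff : I K1 (exec (For i_k v_L (V v_K1) search_config) s).
  by rewrite /I waypoint_last.
apply: for_rule => //.
  by rewrite sL.
move=> k s1 kK sk fr [g1 mono fin].
have rs1 : search_ready s1 by apply: search_ready_agree fr _ rs.
have [||a b c] := @search_configP Ts T s1 i k rs1 im kK _ _ sk g1.
- by rewrite (fr i_T isT).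
- by rewrite (fr i_i isT).
split=> //; first by move=> v /mono /b.
move=> TT h; case: (fin TT h) => h1; first by left; apply: b.
case: (waypoint_step i kK) => [->|[ck ->]]; first by right; apply: b.
rewrite -TT in ck; have [o oK E] := waypoint_offset k im.
by rewrite E in h1 *; apply: c.
Qed.

Lemma search_loop_iP T s : search_ready s -> s i_T 0 = T -> good Ts T (s a_mark) ->
  0 < s a_mark start_of ->
  let s' := exec (For i_i v_L (V v_m) (For i_k v_L (V v_K1) search_config)) s in
  [/\ good Ts T (s' a_mark), forall v, 0 < s a_mark v -> 0 < s' a_mark v
    & T = Ts -> 0 < s' a_mark target_of].
Proof.
move=> rs sT gs Ms /=.
pose I j (s' : store) := [/\ good Ts T (s' a_mark),
  forall v, 0 < s a_mark v -> 0 < s' a_mark v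
  & T = Ts -> 0 < s' a_mark target_of \/ 0 < s' a_mark (waypoint j 0)].
have [[sm sL _ _] _ _ _ _] := rs.
suff : I m (exec (For i_i v_L (V v_m) (For i_k v_L (V v_K1) search_config)) s).
  by case=> a b c; split=> // TT; case: (c TT); rewrite ?waypoint_end.
apply: for_rule => //.
- by rewrite sL.
- by split=> // _; right; rewrite waypoint0.
move=> i s1 im si fr [g1 mono fin].
have rs1 : search_ready s1 by apply: search_ready_agree fr _ rs.
have [|a b c] := @search_loop_kP T s1 i rs1 im _ si g1.
- by rewrite (fr i_T isT).
split=> //; first by move=> v /mono /b.
by move=> TT; apply: c => //; apply: fin.
Qed.

(** Turns with [T < Ts] only have to keep the links valid. The turn [T = Ts] follows the path from
    the start, unless the target is already marked, and later turns find everything frozen. *)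
Theorem phase_searchP s : search_ready s -> Ts < L -> (forall v, s a_mark v = 0) ->
  let s' := exec phase_search s in
  linked Ts (s' a_mark) /\ 0 < s' a_mark target_of.
Proof.
move=> rs TL s0; rewrite /phase_search /= exec_then exec_put.
have [[sm sL _ _] st _ _ _] := rs; rewrite /= st; set s1 := set_cell _ _ _ _.
have rs1 : search_ready s1.
  by apply: (@search_ready_agree [:: a_mark] s) => //; apply: agree_set.
pose I j (s' : store) := [/\ linked Ts (s' a_mark), 0 < s' a_mark start_of
  & Ts < j -> 0 < s' a_mark target_of].
set body := For i_i _ _ _.
suff : I L (exec (Loop i_T v_L body) s1) by case=> a _ c; split=> //; apply: c.
have <- : s1 v_L 0 = L by [].
apply: loop_rule => //.
  split=> //; last by rewrite set_cellE /= /s1 set_cellE /= eqxx.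
  move=> v; rewrite set_cellE /= /s1 set_cellE /= s0.
  by case: eqP => // -> _; left.
move=> T s2 TL2 sT fr [lM Ms fin].
have rs2 : search_ready s2 by apply: search_ready_agree fr _ rs1.
have gs : good Ts T (s2 a_mark).
  by split=> //; case: (leqP T Ts) => h; [left|right; apply: fin].
have [a b c] := search_loop_iP rs2 sT gs Ms.
rewrite -/search_step -/search_config -/body in a b c.
split.
- by apply: eq_linked (proj1 a) => v; rewrite set_cellE.
- by rewrite set_cellE /=; apply: b.
- rewrite set_cellE /= ltnS leq_eqVlt => /orP[/eqP TT|h]; first exact: c.
  by apply: b; apply: fin.
Qed.

End Complete.

(** * Reading a schedule off the marks *)

Section Output.

Variables (n Ts : nat) (p quota M : nat -> nat).
Hypotheses (nL : n <= L) (PL : P < L).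
Hypotheses (linkedM : linked Ts M) (targetM : 0 < M target_of).
Hypotheses (rest0 : rest 0 = m) (p_range : forall j, j < n -> 0 < p j <= P).
Hypothesis countE : forall d, 0 < d <= P ->
  \sum_(j < n) (p j == d) = m * quota d + rest d.

Definition output_ready (s : store) : Prop :=
  [/\ [/\ s v_m 0 = m, s v_n 0 = n, s v_P 0 = P & s v_L 0 = L],
      forall j, s a_jobs j = p j,
      forall d, d <= P -> s a_quota d = quota d
    & (forall v, s a_mark v = M v) /\
      (forall k, k < K1 -> [/\ s a_code k = code_of k, s a_head k = k %% H1
                             & s a_tail k = k %/ H1])].

Lemma output_ready_agree X s s' : agree X s s' ->
  all (fun a => a \notin X)
      [:: v_m; v_n; v_P; v_L; a_jobs; a_quota; a_mark; a_code; a_head; a_tail] ->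
  output_ready s -> output_ready s'.
Proof.
move=> fr /allP hX [[h1 h2 h3 h4] h5 h6 [h7 h8]].
have F a i : a \in [:: v_m; v_n; v_P; v_L; a_jobs; a_quota; a_mark; a_code; a_head; a_tail]
    -> s' a i = s a i by move=> /hX aX; rewrite fr.
split; first by rewrite !F.
- by move=> j; rewrite F.
- by move=> d dP; rewrite F // h6.
- by split=> [v|k kK]; rewrite ?F //; apply: h8.
Qed.

(** Induction on component 0, which is smaller by one at the predecessor; the chain can only end at
    the start vector, whose components are all [W]. *)
Lemma marked_ge x d : 0 < M (encode Q P.+1 x) -> (forall d, d <= P -> x d < Q) ->
  d <= P -> W <= x d.
Proof.
move: {2}(x 0).+1 (ltnSn (x 0)) => b; elim: b x => // b IH x xb Mx xQ dP.
case: (marked_chain linkedM Mx xQ) => [->|[k [y [h1 [_ k1 _] h3 h4 h5]]]] //.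
rewrite h5 //; apply: leq_trans (leq_addr _ _); apply: IH => //.
by have := h5 0 isT; rewrite /digit expn0 divn1 k1; lia.
Qed.

Lemma marked_next x : 0 < M (encode Q P.+1 x) -> (forall d, d <= P -> x d < Q) ->
  W < x 0 -> exists k y, [/\ M (encode Q P.+1 x) = k.+1, config Ts k,
    0 < M (encode Q P.+1 y), forall d, d <= P -> y d < Q
  & forall d, d <= P -> x d = y d + digit H1 k d].
Proof.
move=> Mx xQ x0; case: (marked_chain linkedM Mx xQ) => // h.
by move: x0; rewrite h // ltnn.
Qed.

(** A predecessor would have [W - 1] in component 0, which [marked_ge] excludes. *)
Lemma marked_start x : 0 < M (encode Q P.+1 x) -> (forall d, d <= P -> x d < Q) ->
  x 0 = W -> forall d, d <= P -> x d = W.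
Proof.
move=> Mx xQ x0; case: (marked_chain linkedM Mx xQ) => // -[k [y [_ [_ k1 _] h3 h4 h5]]].
have := marked_ge h3 h4 (leq0n P); have := h5 0 isT.
by rewrite /digit expn0 divn1 k1; lia.
Qed.

Definition assigned (o : nat -> nat) (i d : nat) : nat :=
  \sum_(j < n) (p j == d) && (o j == i.+1).

Definition unassigned (o : nat -> nat) (d : nat) : nat :=
  \sum_(j < n) (p j == d) && (o j == 0).

Lemma assigned_total o i d : (forall j, j < n -> p j = d -> o j <= i) ->
  \sum_(j < n) (p j == d) = unassigned o d + \sum_(i' < i) assigned o i' d.
Proof.
move=> ho; rewrite /unassigned /assigned exchange_big -big_split /=.
apply: eq_bigr => j _; case: eqP => [pj|_] /=; last by rewrite big1.
have {}ho := ho j (ltn_ord j) pj.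
case: (o j) ho => [|v] vi /=; first by rewrite big1.
rewrite (bigD1 (Ordinal vi)) //= eqxx big1 // => l; rewrite -val_eqE /= => lv.
by rewrite eqSS eq_sym (negbTE lv).
Qed.

Definition output_scan : cmd :=
  For i_j v_L (V v_n) (
    When (Eqb (Cell a_jobs (V i_j)) (V i_d)) (
    When (Num 1 -' Cell a_out (V i_j)) (
    When (V t3) (
      Put a_out (V i_j) (V i_i +' Num 1) ;; t3 <-- V t3 -' Num 1)))).

(** While the demand [t3] is positive, no eligible job has been passed over. Demand left at the end
    would thus mean that all eligible jobs were taken, so a demand not above their number is met
    exactly. *)
Lemma output_scanP s i d : output_ready s -> s i_i 0 = i -> s i_d 0 = d ->
  let s' := exec output_scan s in
  [/\ forall j, s' a_out j = s a_out j \/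
                [/\ s a_out j = 0, p j = d & s' a_out j = i.+1]
    & s t3 0 <= unassigned (s a_out) d ->
      \sum_(j < n) [&& p j == d, s a_out j == 0 & s' a_out j == i.+1] = s t3 0].
Proof.
move=> rs si sd /=; have [[_ sn _ sL] sp _ _] := rs.
pose new (s' : store) j := [&& p j == d, s a_out j == 0 & s' a_out j == i.+1].
pose I t (s' : store) := [/\ forall j, t <= j -> s' a_out j = s a_out j,
   forall j, s' a_out j = s a_out j \/ [/\ s a_out j = 0, p j = d & s' a_out j = i.+1],
   \sum_(j < t) new s' j + s' t3 0 = s t3 0
 & 0 < s' t3 0 -> \sum_(j < t) new s' j =
                   \sum_(j < t) ((p j == d) && (s a_out j == 0))].
have: I n (exec output_scan s).
  apply: for_rule => //.
  - by rewrite sL.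
  - by split=> //; rewrite ?big_ord0 //; left.
  move=> t s1 tn st fr [A B C D].
  have rs1 : output_ready s1 by apply: output_ready_agree fr _ rs.
  have [[_ _ _ _] sp1 _ _] := rs1.
  have [si1 sd1] : s1 i_i 0 = i /\ s1 i_d 0 = d by rewrite (fr i_i isT) (fr i_d isT).
  have At := A t (leqnn _).
  have noop : ~~ [&& p t == d, s a_out t == 0 & 0 < s1 t3 0] -> I t.+1 s1.
    move=> h; have nt : new s1 t = false.
      apply/negP => /and3P[/eqP e1 /eqP e2 /eqP e3].
      by move: e3; rewrite At e2.
    split=> //; first by move=> j /ltnW; apply: A.
      by rewrite big_ord_recr /= nt addn0.
    move=> t30; rewrite !big_ord_recr /= nt D //; congr (_ + _).
    by move: h; rewrite t30 andbT => /negbTE ->.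
  rewrite exec_when /= st sp1 sd1.
  case: (p t =P d) => [pd|pd] in noop *; last first.
    by case: eqP => [_|e]; [apply: noop|exfalso; lia].
  have -> : (1 - (p t - d + (d - p t)) == 0) = false by rewrite pd; apply/eqP; lia.
  rewrite exec_when /= st At.
  case: (s a_out t =P 0) => [o0|o0] in noop *; last first.
    by case: eqP => [_|e]; [apply: noop|exfalso; lia].
  have -> : (1 - s a_out t == 0) = false by rewrite o0.
  rewrite exec_when /=.
  case: (posnP (s1 t3 0)) => [t30|t30] in noop *; first by apply: noop.
  rewrite exec_then !exec_put /= st si1; set s2 := set_cell s1 _ _ _.
  have o2 j : j != t -> s2 a_out j = s1 a_out j.
    by move=> jt; rewrite /s2 set_cellE /= (negbTE jt).
  have o2t : s2 a_out t = i.+1 by rewrite /s2 set_cellE /= eqxx addn1.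
  have t2 : s2 t3 0 = s1 t3 0 by rewrite /s2 set_cellE.
  have n2 : \sum_(j < t) new s2 j = \sum_(j < t) new s1 j.
    by apply: eq_bigr => j _; rewrite /new o2 // neq_ltn ltn_ord.
  have nt : new s2 t by rewrite /new pd o0 o2t !eqxx.
  set s3 := set_cell s2 _ _ _.
  have o3 j : s3 a_out j = s2 a_out j by rewrite /s3 set_cellE.
  have t3E : s3 t3 0 = s1 t3 0 - 1 by rewrite /s3 set_cellE /= t2.
  have n3 j : new s3 j = new s2 j by rewrite /new o3.
  split.
  - by move=> j tj; rewrite o3 o2 ?A // ?neq_ltn ?tj ?orbT // ltnW.
  - move=> j; rewrite o3; have [->|jt] := eqVneq j t; last by rewrite o2.
    by right; rewrite o2t.
  - rewrite big_ord_recr /= n3 nt t3E (eq_bigr (fun j : 'I_t => new s2 j : nat)) //.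
    by rewrite n2; lia.
  - move=> _; rewrite !big_ord_recr /= n3 nt (eq_bigr (fun j : 'I_t => new s2 j : nat)) //.
    by rewrite n2 D // pd o0 !eqxx.
case=> _ B C D; split=> // le_need.
have [t30|t30] := posnP (exec output_scan s t3 0); first by rewrite -C t30 addn0.
move: C le_need; rewrite (D t30) /unassigned => <-; lia.
Qed.

Definition output_machine : cmd :=
  For i_d v_L types (
    t3 <-- Cell a_quota (V i_d) +' Cell a_head (V t2) ;;
    t2 <-- Cell a_tail (V t2) ;; output_scan).

Lemma output_machineP s i k : output_ready s -> s i_i 0 = i -> s t2 0 = k -> k < K1 ->
  (forall j, j < n -> s a_out j <= i) ->
  (forall d, 0 < d <= P -> quota d + digit H1 k d <= unassigned (s a_out) d) ->
  let s' := exec output_machine s in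
  [/\ forall j, j < n -> s' a_out j <= i.+1,
      forall i' d, i' < i -> assigned (s' a_out) i' d = assigned (s a_out) i' d
    & forall d, 0 < d <= P -> assigned (s' a_out) i d = quota d + digit H1 k d].
Proof.
move=> rs si sk kK o_le need_le /=; have [[_ sn sP sL] _ _ _] := rs.
(* The digits of [k] are consumed from the lowest one; before turn [t] only jobs of size below [t]
   have been touched, so all unassigned jobs of size [t] are still available. *)
pose I t (s' : store) := [/\ s' t2 0 = k %/ H1 ^ t,
  forall j, s' a_out j = s a_out j \/ [/\ s a_out j = 0, p j < t & s' a_out j = i.+1]
  & forall d, 0 < d < t -> assigned (s' a_out) i d = quota d + digit H1 k d].
have: I P.+1 (exec output_machine s).
  apply: for_rule => //.
  - by rewrite /= sP addn1.
  - by rewrite sL.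
  - by split; rewrite ?expn0 ?divn1 //; [left|case].
  move=> d s1 dP sd fr [T2 A B].
  have rs1 : output_ready s1 by apply: output_ready_agree fr _ rs.
  have [_ _ q1 [_ tab]] := rs1.
  have kd : k %/ H1 ^ d < K1 by apply: leq_ltn_trans (leq_div _ _) kK.
  have [_ hh ht] := tab _ kd.
  rewrite exec_then exec_put /= sd T2 hh q1 //; set s2 := set_cell s1 _ _ _.
  have s2t : s2 t2 0 = k %/ H1 ^ d by [].
  rewrite exec_then exec_put /= s2t; set s3 := set_cell s2 _ _ _.
  have o3 j : s3 a_out j = s1 a_out j by [].
  have e3 : s3 t3 0 = quota d + digit H1 k d by [].
  have t3' : s3 t2 0 = k %/ H1 ^ d.+1.
    by rewrite /s3 set_cellE /= /s2 set_cellE /= ht expnSr divnMA.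
  have rs3 : output_ready s3.
    apply: (@output_ready_agree [:: t2; t3] s1) => // a ha j.
    rewrite /s3 /s2 !set_cellE; move: ha; rewrite !inE negb_or => /andP[/negbTE -> /negbTE ->].
    by [].
  have i3 : s3 i_i 0 = i by rewrite /s3 /s2 !set_cellE /= (fr i_i isT).
  have d3 : s3 i_d 0 = d by [].
  have same d' j : d <= d' -> (p j == d') && (s1 a_out j == 0) =
                             (p j == d') && (s a_out j == 0).
    move=> dd; case: eqP => //= pj; case: (A j) => [->|[_ h _]] //; lia.
  have not_new j : p j = d -> j < n -> (s1 a_out j == i.+1) = false.
    move=> pj jn; case: (A j) => [->|[_ h _]]; last by lia.
    by apply/negbTE/eqP; have := o_le j jn; lia.
  (* Component 0 is the machine counter; its demand is not to be met by jobs. *)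
  have need : 0 < d -> s3 t3 0 <= unassigned (s3 a_out) d.
    move=> d0; rewrite e3; apply: leq_trans (need_le d _) _; first by rewrite d0.
    rewrite /unassigned; apply: eq_leq; apply: eq_bigr => j _.
    by rewrite -(same d).
  have [scan1 scan2] := output_scanP rs3 i3 d3.
  split.
  - by rewrite exec_frame.
  - move=> j; case: (scan1 j) => [->|[h1 h2 h3]].
      rewrite o3; case: (A j) => [->|[a b c]]; first by left.
      by right; split=> //; lia.
    case: (A j) => [e|[a b c]]; last by rewrite o3 c in h1.
    by right; split; [rewrite -e -o3|lia|].
  - move=> e /andP[e0]; rewrite ltnS leq_eqVlt => /orP[/eqP ed|ed].
      rewrite ed in e0 *; rewrite -e3 -(scan2 (need e0)); apply: eq_bigr => j _.
      case: (p j =P d) => //= pj.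
      case: (scan1 j) => [->|[h1 h2 ->]]; last by rewrite eqxx h1.
      by rewrite o3 not_new // andbF.
    rewrite -B ?e0 //; apply: eq_bigr => j _.
    case: (p j =P e) => //= pj; congr (nat_of_bool (_ == _)).
    by case: (scan1 j) => [->|[_ h _]] //; lia.
case=> _ A B; split.
- move=> j jn; have := o_le j jn.
  by case: (A j) => [->|[_ _ ->]] //; lia.
- move=> i' d ii'; apply: eq_bigr => j _; congr (nat_of_bool (_ && _)).
  case: (A j) => [->|[-> _ ->]] //; rewrite eqSS eq_sym.
  by apply/negbTE/eqP; lia.
- by move=> d dP; apply: B; rewrite ltnS.
Qed.

Theorem phase_outputP s : output_ready s -> s v_target 0 = target_of ->
  (forall j, s a_out j = 0) ->
  let o := exec phase_output s a_out in
  exists c, [/\ forall i, i < m -> config Ts (c i), forall j, j < n -> o j < m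
    & forall i d, i < m -> 0 < d <= P ->
        \sum_(j < n) (p j == d) && (o j == i) = quota d + digit H1 (c i) d].
Proof.
move=> rs stg so0; rewrite /phase_output /= exec_then exec_put /= stg.
set s1 := set_cell s _ _ _.
have rs1 : output_ready s1.
  by apply: (@output_ready_agree [:: t1] s) => //; apply: agree_set.
rewrite exec_then; set s2 := exec _ s1; set last := For i_j _ _ _.
(* [x] is the marked vector reached after [i] backward links and [c] lists the configurations
   removed so far; together they make up the target. *)
pose I i (s' : store) := exists (x c : nat -> nat),
  [/\ [/\ s' t1 0 = encode Q P.+1 x, 0 < M (encode Q P.+1 x)
        & forall d, d <= P -> x d < Q],
      forall d, d <= P -> x d + \sum_(i' < i) digit H1 (c i') d = W + rest d,
      forall i', i' < i -> config Ts (c i'),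
      forall j, j < n -> s' a_out j <= i
    & forall i' d, i' < i -> 0 < d <= P ->
        assigned (s' a_out) i' d = quota d + digit H1 (c i') d].
have dig0 T k : config T k -> digit H1 k 0 = 1.
  by case=> _ k1 _; rewrite /digit expn0 divn1.
have h2 : I m s2.
  have [[sm sn sP sL] _ _ _] := rs1.
  apply: for_rule => //.
  - by rewrite sL.
  - exists (fun d => W + rest d), id; split=> //.
    + by split=> // d dP; have := Q_ge dP; lia.
    + by move=> d dP; rewrite big_ord0 addn0.
    + by move=> j _; rewrite /s1 set_cellE /= so0.
  move=> i s3 im si fr [x [c [[T1 Mx xQ] xE cC oI aE]]].
  have rs3 : output_ready s3 by apply: output_ready_agree fr _ rs1.
  have [_ _ _ [mk tab]] := rs3.
  (* After [i < m] links component 0 is [W + m - i], so the start has not been reached and another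
     link exists. *)
  have x0 : W < x 0.
    have := xE 0 isT; rewrite rest0.
    have -> : \sum_(i' < i) digit H1 (c i') 0 = i.
      rewrite (eq_bigr (fun=> 1)) ?sum_nat_const ?card_ord ?muln1 // => i' _.
      exact: dig0 (cC _ (ltn_ord i')).
    lia.
  have [k [y [Mk ck My yQ xy]]] := marked_next Mx xQ x0.
  have [kK _ _] := ck.
  rewrite exec_then exec_put /= T1 mk Mk subn1 /=; set s4 := set_cell s3 _ _ _.
  have [s4a s4b] : s4 t1 0 = encode Q P.+1 x /\ s4 t2 0 = k by [].
  have [hc _ _] := tab k kK.
  rewrite exec_then exec_put /= s4a s4b.
  have -> : s4 a_code k = code_of k by [].
  have Exy : encode Q P.+1 x - code_of k = encode Q P.+1 y.
    by rewrite (@eq_encode Q P.+1 x (fun d => y d + digit H1 k d)) // encodeD addnK.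
  rewrite Exy; set s5 := set_cell s4 _ _ _.
  have rs5 : output_ready s5.
    apply: (@output_ready_agree [:: t1; t2] s3) => // a ha j.
    rewrite /s5 /s4 !set_cellE; move: ha; rewrite !inE negb_or => /andP[/negbTE -> /negbTE ->].
    by [].
  have [i5 k5] : s5 i_i 0 = i /\ s5 t2 0 = k by [].
  have o5 : s5 a_out = s3 a_out by [].
  have [||a1 a2 a3] := @output_machineP s5 i k rs5 i5 k5 kK.
  - by rewrite o5.
  (* Enough jobs are left: of size [d] there remain [(m - i) * quota d + (x d - W)], and
     [x d = y d + digit H1 k d] with [W <= y d]. *)
  - move=> d /andP[d0 dP].
    have dPP : 0 < d <= P by rewrite d0.
    have E1 : \sum_(j < n) (p j == d) = unassigned (s5 a_out) d +
               \sum_(i' < i) assigned (s5 a_out) i' d.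
      by apply: assigned_total => j jn _; rewrite o5; apply: oI.
    move: E1; rewrite countE //.
    rewrite (eq_bigr (fun i' : 'I_i => quota d + digit H1 (c i') d)); last first.
      by move=> i' _; rewrite o5 aE.
    rewrite big_split /= sum_nat_const card_ord.
    have := xE d dP; rewrite (xy d dP); have := marked_ge My yQ dP.
    have : i.+1 * quota d <= m * quota d by rewrite leq_mul2r im orbT.
    rewrite mulSn; move: (i * _) (m * _) (\sum_(_ < _) _) (unassigned _ _) => A B C D.
    lia.
  exists y, (fun i' => if i' == i then k else c i'); split=> //.
  - by split=> //; rewrite exec_frame.
  - move=> d dP; rewrite big_ord_recr /= eqxx -(xE d dP) (xy d dP).
    rewrite (eq_bigr (fun i' : 'I_i => digit H1 (c i') d)).
      by rewrite -[RHS]addnA [_ + \sum_(_ < _) _ in RHS]addnC.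
    by move=> i' _; rewrite (ltn_eqF (ltn_ord i')).
  - by move=> i'; rewrite ltnS leq_eqVlt; case: eqP => //= _; apply: cC.
  - move=> i' d; rewrite ltnS leq_eqVlt; case: eqP => [->|_] /= ii dP; first exact: a3.
    by rewrite a2 // o5 aE.
have [x [c [[_ Mx xQ] xE cC oI aE]]] := h2.
(* After [m] links component 0 has come down to [W], which happens only at the start vector. *)
have xW : forall d, d <= P -> x d = W.
  apply: marked_start => //; have := xE 0 isT; rewrite rest0.
  have -> : \sum_(i' < m) digit H1 (c i') 0 = m.
    rewrite (eq_bigr (fun=> 1)) ?sum_nat_const ?card_ord ?muln1 // => i' _.
    exact: dig0 (cC _ (ltn_ord i')).
  lia.
(* All of [rest d] has been consumed, so the machines account for every job of each size. *)
have full j : j < n -> 0 < s2 a_out j.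
  move=> jn; have pj := p_range jn; pose d := p j; have [d0 dP] := andP pj.
  have := assigned_total (fun j jn (_ : p j = d) => oI j jn).
  rewrite countE // (eq_bigr (fun i' : 'I_m => quota d + digit H1 (c i') d)); last first.
    by move=> i' _; rewrite aE.
  rewrite big_split /= sum_nat_const card_ord; have := xE d dP; rewrite (xW d dP) => h.
  have : unassigned (s2 a_out) d = 0 -> 0 < s2 a_out j.
    move/eqP; rewrite /unassigned sum_nat_eq0 => /forallP/(_ (Ordinal jn)) /=.
    by rewrite eqxx /= eqb0 lt0n.
  move=> hu hE; apply: hu; move: h hE.
  move: (m * _) (\sum_(_ < _) _) (unassigned _ _) => A B C; lia.
have hl : forall j, exec last s2 a_out j = if j < n then s2 a_out j - 1 else s2 a_out j.
  have [[_ sn _ sL] _ _ _] : output_ready s2.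
    by apply: output_ready_agree (@exec_agree _ s1) _ rs1.
  move=> j.
  apply: (@for_rule (fun t s' => s' a_out j = if j < t then s2 a_out j - 1 else s2 a_out j)) => //.
  - by rewrite sL.
  - move=> t s' tn st fr E; rewrite exec_put set_cellE /= st ltnS.
    by case: (ltngtP j t) E => //= -> ->.
exists c; split=> //.
- by move=> j jn; rewrite hl jn; have := full j jn; have := oI j jn; lia.
- move=> i d im dP; rewrite -aE //; apply: eq_bigr => j _.
  rewrite hl ltn_ord; congr (nat_of_bool (_ && _)).
  by have := full j (ltn_ord j); case: (s2 a_out j) => // v _; rewrite subn1.
Qed.

End Output.

End Search.

(** * Sizes *)

(** The exponent of [size_K2] is cubic in [P], and [P < 2 ^ P] bounds it by a multiple of
    [(2 ^ P) ^ 3 = 8 ^ P], the form chosen for [size_E] because doublings compute it. *)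
Lemma size_K2_small P : 8 * size_K2 P <= 2 ^ size_E P.
Proof.
rewrite /size_K2 /size_H2 -expnM -[8]/(2 ^ 3) -expnD leq_exp2l //.
have -> : size_E P = 16 * (2 ^ P) ^ 3 by rewrite /size_E -expnM [P * 3]mulnC expnM.
rewrite /size_E2 /size_E1; have := ltn_expl P (isT : 1 < 2); move: (2 ^ P) => y hy.
have h1 : (1 + P.+2 * (P + P + 2)) * P.+1 <= (1 + y.+1 * (y + y)) * y.
  by apply: leq_mul => //; rewrite leq_add2l; apply: leq_mul; lia.
have h2 : (1 + y.+1 * (y + y)) * y + 3 <= 16 * y ^ 3 by rewrite !expnS expn0; nia.
lia.
Qed.

Lemma size_H1_gt1 P : 1 < size_H1 P.
Proof. by rewrite /size_H1 -{1}(expn0 2) ltn_exp2l // /size_E1; lia. Qed.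

Lemma size_WE P : size_K1 P * size_H1 P = size_W P.
Proof. by rewrite /size_K1 /size_W [RHS]expnSr. Qed.

Lemma size_H2E P : size_H2 P = 2 * size_W P.
Proof. by rewrite /size_H2 /size_W /size_H1 -expnM /size_E2 expnD expn1 mulnC [P.+2 * _]mulnC mulnC. Qed.

Lemma size_sq P : P.+1 * P.+1 <= size_B P.
Proof.
have -> : size_B P = (2 ^ P) ^ 2 by rewrite /size_B -expnM [P * 2]mulnC expnM.
by have := ltn_expl P (isT : 1 < 2); move: (2 ^ P) => y hy; rewrite !expnS expn0; nia.
Qed.

Lemma size_H1E P : size_H1 P = 4 * size_B P.
Proof.
rewrite /size_H1 /size_B /size_E1 -[4]/(2 ^ 2) -expnM -expnD; congr (2 ^ _); lia.
Qed.

Lemma size_H1_W P : size_H1 P * size_H1 P <= size_W P.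
Proof.
rewrite /size_W -[X in X <= _]/(size_H1 P ^ 2) leq_pexp2l //.
exact: ltnW (size_H1_gt1 P).
Qed.

Lemma sizes_le P :
  [/\ size_H1 P < size_W P, size_K1 P <= size_W P, size_W P < size_H2 P,
      size_H2 P <= size_K2 P & size_E2 P < size_H2 P].
Proof.
have h1 := size_H1_gt1 P; have hW := size_H1_W P.
have W0 : size_H1 P < size_W P by apply: leq_trans hW; rewrite -{1}[size_H1 P]muln1 ltn_pmul2l; lia.
split=> //.
- by rewrite -size_WE leq_pmulr //; lia.
- by rewrite size_H2E; lia.
- by rewrite /size_K2 -{1}[size_H2 P]expn1 leq_pexp2l // size_H2E; lia.
- by rewrite /size_H2 ltn_expl.
Qed.

Lemma size_L_ge n P a : 0 < n -> a <= 4 * size_K2 P -> n + a <= size_L n P.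
Proof.
move=> n0 ha; rewrite /size_L.
have := size_K2_small P; have : 0 < size_K2 P.
  by rewrite /size_K2 expn_gt0 /size_H2 expn_gt0.
move: (2 ^ _) => G; nia.
Qed.

(** * Loads and configurations *)

Lemma load_of_small P k : load_of P (size_H1 P) k <= size_W P.
Proof.
rewrite /load_of; apply: leq_trans (size_H1_W P).
apply: leq_trans (_ : \sum_(d < P.+1) size_H1 P * P.+1 <= _).
  apply: leq_sum => d _; apply: leq_mul; last exact: ltnW (ltn_ord d).
  by apply/ltnW/digit_lt/ltnW/size_H1_gt1.
rewrite sum_nat_const card_ord mulnCA leq_mul2l; apply/orP; right.
by have := size_sq P; rewrite size_H1E; lia.
Qed.

Section Instance.

Variables (m : nat) (p : seq nat).
Hypotheses (m0 : 0 < m) (p0 : all (fun x => 0 < x) p).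

Let n := size p.
Let P := pmax p.
Let pj j := nth 0 p j.
Let cnt d := \sum_(j < n) (pj j == d).
Let quota d := cnt d %/ m - size_B P.
Let rest d := if d == 0 then m else cnt d - m * quota d.

Lemma job_range j : j < n -> 0 < pj j <= P.
Proof.
move=> jn; rewrite (all_nthP 0 p0) //=.
by rewrite /P /pmax (big_nth 0) big_mkord; apply: (@leq_bigmax _ (fun i : 'I_n => nth 0 p i) (Ordinal jn)).
Qed.

Lemma cnt_le d : cnt d <= n.
Proof.
rewrite /cnt -[X in _ <= X]card_ord -sum1_card; apply: leq_sum => j _; exact: leq_b1.
Qed.

Lemma cntE d : 0 < d -> cnt d = m * quota d + rest d.
Proof.
move=> d0; rewrite /rest (gtn_eqF d0) subnKC // /quota.
apply: leq_trans (leq_trunc_div (cnt d) m); rewrite mulnC leq_mul2r.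
by rewrite leq_subr orbT.
Qed.

Lemma loadE a i : load p a i = \sum_(d < P.+1) d * \sum_(j < n) (pj j == d) && (a j == i).
Proof.
rewrite /load.
rewrite [RHS](eq_bigr (fun d : 'I_P.+1 => \sum_(j < n) d * ((pj j == d) && (a j == i))));
  last by move=> d _; rewrite big_distrr.
rewrite exchange_big big_mkcond /=; apply: eq_bigr => j _.
have := job_range (ltn_ord j); rewrite /pj => /andP[_ jP].
rewrite (bigD1 (Ordinal (jP : nth 0 p j < P.+1))) //= eqxx /=.
rewrite big1 ?addn0; last first.
  by move=> d; rewrite -val_eqE /= eq_sym => /negbTE ->; rewrite muln0.
by case: (a j == i); rewrite ?muln1 ?muln0.
Qed.

Definition quota_load := \sum_(d < P.+1) d * quota d.

(** Balance the multiplicities of [b], subtract the quota from every machine, and encode what is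
    left together with a 1 in component 0. Balancing never raises the makespan. *)
Lemma schedule_configs b : valid_assignment m n b -> exists sol : nat -> nat,
  [/\ forall i, sol i < size_K1 P /\ sol i %% size_H1 P = 1,
      forall d, d <= P -> \sum_(i < m) digit (size_H1 P) (sol i) d = rest d
    & forall i, i < m -> quota_load + load_of P (size_H1 P) (sol i) <= makespan m p b].
Proof.
move=> vb; set H1 := size_H1 P.
pose x i d := \sum_(j < n) (pj j == d) && (b j == i) : nat.
have [y [ycol yload ybal]] := balanced_distribution P m x.
have colE d : \sum_(i < m) x i d = cnt d.
  rewrite /x exchange_big; apply: eq_bigr => j _ /=.
  have bj : b j < m by apply: (forallP vb).
  rewrite (bigD1 (Ordinal bj)) //= eqxx andbT big1 ?addn0 // => i.
  by rewrite -val_eqE /= eq_sym => /negbTE ->; rewrite andbF.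
have H1E := size_H1E P; have Bsq := size_sq P.
(* A balanced entry is within [P ^ 2 + P <= B] of the average, and the quota is [B] below the
   average or 0; so the difference is at most [2 * B]. *)
have near i d : i < m -> 0 < d <= P -> quota d <= y i d /\ y i d - quota d < H1.
  move=> im dP.
  have := balanced_near_average m0 (fun i k im km => ybal i k d im km dP) im.
  rewrite ycol colE /quota /H1 H1E; move: Bsq; move: (cnt d %/ m) (size_B P) (y i d).
  move=> A B C; nia.
(* Beyond the machines a dummy configuration keeps [sol i] valid for every [i]. *)
pose v i d := if d == 0 then 1 else if i < m then y i d - quota d else 0.
have vH i d : d < P.+1 -> v i d < H1.
  rewrite /v => dP; case: eqP => [_|/eqP d0]; first exact: size_H1_gt1.
  case: ifP => im; last by apply: ltnW; apply: size_H1_gt1.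
  by have [] := @near i d im; rewrite // lt0n d0.
exists (fun i => encode H1 P.+1 (v i)); split.
- move=> i; split; first by rewrite /size_K1; apply: encode_lt => d; apply: vH.
  have := digit_encode (vH i) (isT : 0 < P.+1).
  by rewrite /digit expn0 divn1.
- move=> d dP.
  under eq_bigr => i _ do rewrite (digit_encode (vH i)) //.
  rewrite /v /rest; case: eqP => [_|/eqP d0].
    by rewrite sum_nat_const card_ord muln1.
  have dPP : 0 < d <= P by rewrite lt0n d0.
  have : \sum_(i < m) y i d = m * quota d + \sum_(i < m) (y i d - quota d).
    rewrite -[m in m * _]card_ord -sum_nat_const -big_split /=; apply: eq_bigr => i _.
    by have [h _] := near i d (ltn_ord i) dPP; rewrite subnKC.
  rewrite ycol colE => ->; rewrite addKn; apply: eq_bigr => i _.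
  by rewrite ltn_ord.
- move=> i im.
  have -> : quota_load + load_of P H1 (encode H1 P.+1 (v i)) = row_load P y i.
    rewrite /quota_load /load_of /row_load -big_split /=; apply: eq_bigr => d _.
    rewrite (digit_encode (vH i)) // /v.
    have [->|d0] := eqVneq (d : nat) 0; first by rewrite !mul0n muln0.
    rewrite im [_ * d]mulnC -mulnDr subnKC //.
    by have [] := near i d im; rewrite // lt0n d0 -ltnS ltn_ord.
  apply: (yload _ _ i im) => k km.
  have -> : row_load P x k = load p b k by rewrite loadE.
  exact: (@leq_bigmax _ (fun i : 'I_m => load p b i) (Ordinal km)).
Qed.

Lemma config_schedule (a c : nat -> nat) Ts :
  (forall i, i < m -> load_of P (size_H1 P) (c i) <= Ts) ->
  (forall i d, i < m -> 0 < d <= P ->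
     \sum_(j < n) (pj j == d) && (a j == i) = quota d + digit (size_H1 P) (c i) d) ->
  makespan m p a <= quota_load + Ts.
Proof.
move=> cT ac; apply/bigmax_leqP => i _; rewrite loadE.
apply: leq_trans (_ : quota_load + load_of P (size_H1 P) (c i) <= _); last first.
  by rewrite leq_add2l; apply: cT.
rewrite /quota_load /load_of -big_split /=; apply: leq_sum => d _.
have [->|d0] := eqVneq (d : nat) 0; first by rewrite !mul0n.
by rewrite ac // ?lt0n ?d0 ?leq_ord // mulnDr [d * digit _ _ _]mulnC.
Qed.

End Instance.

(** * Correctness of the whole sequence of phases *)

Lemma bounds_by v L c s : all (pred1 v) (bounds c) -> s v 0 <= L ->
  forall x, x \in bounds c -> s x 0 <= L.
Proof. by move=> /allP h sL x /h /eqP ->. Qed.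

Lemma optimal_exists m p : 0 < m -> exists2 b, valid_assignment m (size p) b &
  forall b', valid_assignment m (size p) b' -> makespan m p b <= makespan m p b'.
Proof.
move=> m0; set n := size p.
pose g (f : {ffun 'I_n -> 'I_m}) (j : nat) : nat :=
  if insub j is Some j' then f j' else 0.
pose f0 : {ffun 'I_n -> 'I_m} := [ffun=> Ordinal m0].
have gv f : valid_assignment m n (g f).
  by apply/forallP => j; rewrite /g valK.
case: (@arg_minnP _ f0 predT (fun f => makespan m p (g f)) isT) => f _ fmin.
exists (g f) => // b vb.
pose fb : {ffun 'I_n -> 'I_m} := [ffun j : 'I_n => Ordinal (forallP vb j)].
have := fmin fb isT; suff -> : makespan m p (g fb) = makespan m p b by [].
apply: eq_bigr => i _; apply: eq_bigl => j.
by rewrite /g valK ffunE.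
Qed.

(** With at least as many machines as jobs, one job per machine is optimal, because each single job
    is a lower bound for every schedule; this already fits on [size p] machines. *)
Lemma makespan_min m p a : 0 < m -> optimal_schedule (minn m (size p)) p a ->
  optimal_schedule m p a.
Proof.
move=> m0 [va oa]; have [mn|nm] := leqP m (size p).
  by move: va oa; rewrite (minn_idPl mn).
move: va oa; rewrite (minn_idPr (ltnW nm)); set n := size p => va oa.
have an (j : 'I_n) : a j < n by apply: (forallP va).
split; first by apply/forallP => j; apply: ltn_trans (an j) nm.
move=> b vb.
have pb : makespan n p id <= makespan m p b.
  apply/bigmax_leqP => i _.
  have bi : b i < m by apply: (forallP vb).
  apply: leq_trans (@leq_bigmax _ (fun i : 'I_m => load p b i) (Ordinal bi)).
  rewrite /load [X in X <= _](big_pred1 i) => [|j]; last by rewrite /= -val_eqE.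
  by rewrite /= [X in _ <= X](bigD1 i) //= leq_addr.
apply: leq_trans pb; apply: leq_trans (oa id _); last by apply/forallP.
apply/bigmax_leqP => i _; have [ilt|ige] := ltnP i n.
  exact: (@leq_bigmax _ (fun i : 'I_n => load p a i) (Ordinal ilt)).
rewrite /load big_pred0 // => j; apply/negbTE/eqP => e.
by have := an j; rewrite e ltnNge ige.
Qed.

Theorem phases_correct m p : 0 < m -> all (fun x => 0 < x) p -> 0 < size p ->
  phases_ok (size_L (size p) (pmax p)) (input_store m p) phases /\
  optimal_schedule m p (exec_phases (input_store m p) phases a_out).
Proof.
move=> m0 p0 n0; set n := size p; set P := pmax p; set L := size_L n P.
set m' := minn m n; have m'0 : 0 < m' by rewrite /m'; lia.
have m'n : m' <= n by apply: geq_minr.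
have [h1 h2 h3 h4 h5] := sizes_le P; have H1gt := size_H1_gt1 P.
have Lge a : a <= 4 * size_K2 P -> n + a <= L by apply: size_L_ge.
set s0 := input_store m p.
rewrite /phases /exec_phases [foldl _ _ _]/=.
set s1 := exec phase_max s0; set s2 := exec phase_exponent s1.
set s3 := exec phase_limit s2; set s4 := exec phase_count s3.
set s5 := exec phase_sizes s4; set s6 := exec phase_quota s5.
set s7 := exec phase_ends s6; set s8 := exec phase_base s7.
set s9 := exec (table v_H2 v_K2) s8; set s10 := exec phase_copy s9.
set s11 := exec (table v_H1 v_K1) s10; set s12 := exec phase_search s11.
set s13 := exec phase_output s12.
have [P1 m1] := @phase_maxP s0 n erefl erefl.
have {}P1 : s1 v_P 0 = P by rewrite /s1 P1 /P /pmax (big_nth 0) big_mkord.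
have {}m1 : s1 v_m 0 = m' by rewrite /s1 m1.
have n1 : s1 v_n 0 = n by rewrite /s1 exec_frame.
have E2 : s2 v_E 0 = size_E P by rewrite /s2 phase_exponentP P1.
have P2 : s2 v_P 0 = P by rewrite /s2 exec_frame.
have n2 : s2 v_n 0 = n by rewrite /s2 exec_frame.
have L3 : s3 v_L 0 = L by rewrite /s3 phase_limitP n2 E2.
have L4 : s4 v_L 0 = L by rewrite /s4 exec_frame.
have L5 : s5 v_L 0 = L by rewrite /s5 exec_frame.
have L6 : s6 v_L 0 = L by rewrite /s6 exec_frame.
have L7 : s7 v_L 0 = L by rewrite /s7 exec_frame.
have L8 : s8 v_L 0 = L by rewrite /s8 exec_frame.
have L9 : s9 v_L 0 = L by rewrite /s9 exec_frame.
have L10 : s10 v_L 0 = L by rewrite /s10 exec_frame.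
have L11 : s11 v_L 0 = L by rewrite /s11 exec_frame.
have L12 : s12 v_L 0 = L by rewrite /s12 exec_frame.
have nL : n <= L by have := Lge 0 isT; lia.
have E2L : size_E2 P <= L by have := Lge (size_E2 P); lia.
have PE1 : P.+2 <= size_E1 P /\ size_E1 P <= size_E2 P by rewrite /size_E2 /size_E1; nia.
have EL : size_E P <= L.
  by rewrite /L /size_L; have := ltn_expl (size_E P) (isT : 1 < 2); move: (2 ^ _) => G; nia.
split.
  do !split=> //; [apply: (@bounds_by v_n)|apply: (@bounds_by v_P)|apply: (@bounds_by v_E)
    |apply: (@bounds_by v_L)..] => //.
  - by rewrite -[X in X <= _]/(s1 v_P 0) P1; lia.
  - by rewrite -[X in X <= _]/(s2 v_E 0) E2.
  - exact: eq_leq L3.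
  - exact: eq_leq L4.
  - exact: eq_leq L5.
  - exact: eq_leq L6.
  - exact: eq_leq L7.
  - exact: eq_leq L8.
  - exact: eq_leq L9.
  - exact: eq_leq L10.
  - exact: eq_leq L11.
  - exact: eq_leq L12.
pose pj j := nth 0 p j.
pose cnt d := \sum_(j < n) (pj j == d).
pose quota d := cnt d %/ m' - size_B P.
pose rest d := if d == 0 then m' else cnt d - m' * quota d.
have n3 : s3 v_n 0 = n by rewrite /s3 exec_frame.
have j3 j : s3 a_jobs j = pj j by rewrite /s3 /s2 /s1 !exec_frame.
have c3 d : s3 a_count d = 0 by rewrite /s3 /s2 /s1 !exec_frame.
have c4 d : s4 a_count d = cnt d.
  rewrite /s4 (phase_countP n3) ?L3 //; apply: eq_bigr => j _; by rewrite j3.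
have P4 : s4 v_P 0 = P by rewrite /s4 /s3 !exec_frame.
have PE : [/\ P.+2 <= s4 v_L 0, size_E1 P <= s4 v_L 0 & size_E2 P <= s4 v_L 0].
  by rewrite L4; split; lia.
have [PL4 E1L4 E2L4] := PE.
have [B5 Ha5 Ka5 [W5 Hb5 Kb5]] := phase_sizesP P4 PL4 E1L4 E2L4.
rewrite -/s5 in B5 Ha5 Ka5 W5 Hb5 Kb5.
have PL : P < L by lia.
have cntn d : cnt d <= n by apply: cnt_le.
have m5 : s5 v_m 0 = m' by rewrite /s5 /s4 /s3 /s2 !exec_frame.
have P5 : s5 v_P 0 = P by rewrite /s5 exec_frame.
have c5 d : s5 a_count d = cnt d by rewrite /s5 exec_frame.
have [||q6 r6 r60] := phase_quotaP m5 m'0 P5 _ B5 c5.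
- by rewrite L5.
- by move=> d; rewrite L5; apply: leq_trans (cntn d) nL.
rewrite -/s6 in q6 r6 r60.
have r6' d : d <= P -> s6 a_rest d = rest d.
  rewrite /rest => dP; case: eqP => [->|/eqP d0] //.
  by rewrite r6 // lt0n d0.
have P6 : s6 v_P 0 = P by rewrite /s6 exec_frame.
have W6 : s6 v_W 0 = size_W P by rewrite /s6 exec_frame.
have PL6 : P < s6 v_L 0 by rewrite L6.
have [st7 tg7] := phase_endsP P6 PL6 W6 r6'.
rewrite -/s7 L6 in st7 tg7.
have restn d : rest d <= n by rewrite /rest; case: eqP => _ //; apply: leq_trans (leq_subr _ _) _.
have m7 : s7 v_m 0 = m' by rewrite /s7 /s6 !exec_frame.
have P7 : s7 v_P 0 = P by rewrite /s7 exec_frame.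
have b8 : forall i, i < m' -> s8 a_base i = encode (2 ^ L) P.+1 (fun d => i * rest d %/ m').
  rewrite -L7; apply: phase_baseP => //; rewrite ?L7 //.
  - by apply: leq_trans nL.
  - by move=> d dP; rewrite /s7 exec_frame // r6'.
  - move=> d _; have := restn d; have := Lge n; have := Lge (size_W P).
    by rewrite /L /size_L; have := size_K2_small P; move: (2 ^ _) => G; nia.
  - by move=> d; rewrite /s7 /s6 /s5 /s4 /s3 /s2 /s1 !exec_frame.
  - by move=> d; rewrite /s7 /s6 /s5 /s4 /s3 /s2 /s1 !exec_frame.
have Hb8 : s8 v_H2 0 = size_H2 P by rewrite /s8 /s7 /s6 !exec_frame.
have Kb8 : s8 v_K2 0 = size_K2 P by rewrite /s8 /s7 /s6 !exec_frame.
have z8 a : a \in [:: a_code; a_sum; a_load] -> s8 a 0 = 0.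
  rewrite !inE => /or3P[] /eqP ->;
  by rewrite /s8 /s7 /s6 /s5 /s4 /s3 /s2 /s1 !exec_frame.
have K2L : size_K2 P <= L by have := Lge (size_K2 P); lia.
have H2gt : 1 < size_H2 P by lia.
have t9 : is_table s9 (2 ^ L) (size_H2 P) P.+1.
  have := @tableP v_H2 v_K2 s8 _ P.+1 isT isT H2gt isT Hb8 Kb8.
  by rewrite L8; apply=> //; apply: z8.
have Kb9 : s9 v_K2 0 = size_K2 P by rewrite /s9 exec_frame.
have o10 o : o < size_K2 P -> s10 a_offset o = encode (2 ^ L) P.+1 (digit (size_H2 P) o).
  move=> oK; rewrite /s10 (phase_copyP Kb9) ?L9 //.
  by have [-> _ _ _ _] := t9 o oK.
have z10 : [/\ s10 a_code 0 = 0, s10 a_sum 0 = 0 & s10 a_load 0 = 0].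
  rewrite /s10 !exec_frame //.
  have K0 : 0 < size_H2 P ^ P.+1 by rewrite expn_gt0; lia.
  have [-> _ _ -> ->] := t9 0 K0.
  by split; apply: big1 => d _; rewrite /digit div0n mod0n.
have [z10a z10b z10c] := z10.
have Ha10 : s10 v_H1 0 = size_H1 P by rewrite /s10 /s9 /s8 /s7 /s6 !exec_frame.
have Ka10 : s10 v_K1 0 = size_K1 P by rewrite /s10 /s9 /s8 /s7 /s6 !exec_frame.
have K1L : size_K1 P <= L by lia.
have t11 : is_table s11 (2 ^ L) (size_H1 P) P.+1.
  have := @tableP v_H1 v_K1 s10 _ P.+1 isT isT H1gt isT Ha10 Ka10.
  by rewrite L10; apply.
have tg11 : s11 v_target 0 = target_of P (2 ^ L) (size_W P) rest.
  by rewrite /s11 /s10 /s9 /s8 !exec_frame.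
have ready11 : search_ready m' P L (2 ^ L) (size_H1 P) (size_K1 P) (size_W P)
                 (size_H2 P) (size_K2 P) rest s11.
  split=> //.
  - split=> //; first by rewrite /s11 /s10 /s9 /s8 !exec_frame.
      by rewrite /s11 exec_frame.
    by rewrite /s11 /s10 !exec_frame.
  - by rewrite /s11 /s10 /s9 /s8 !exec_frame.
  - by move=> i im; rewrite /s11 /s10 /s9 !exec_frame // b8.
  - split=> [o oK|k kK]; first by rewrite /s11 exec_frame // o10.
    by have [-> _ -> -> _] := t11 k kK.
have [b vb bmin] := optimal_exists p m'0.
have [sol [solK solr soll]] := schedule_configs m'0 p0 vb.
(* The limit at which the search is certain to succeed, taken from an optimal schedule [b]. *)
pose Ts := \max_(i < m') load_of P (size_H1 P) (sol i).
have TsW : Ts <= size_W P.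
  by apply/bigmax_leqP => i _; apply: load_of_small.
have Qge d : d <= P -> rest d + size_H2 P + size_H1 P <= 2 ^ L.
  move=> _; have := ltn_expl L (isT : 1 < 2); have := restn d.
  by have := Lge (size_H2 P + size_H1 P); lia.
have H1_gt0 : 0 < size_H1 P by lia.
have Wge : size_K1 P * size_H1 P <= size_W P by rewrite size_WE.
have H2ge : size_W P + size_H1 P < size_H2 P by rewrite size_H2E; lia.
have m'L : m' <= L by apply: leq_trans nL.
have solc i : i < m' -> config P (size_H1 P) (size_K1 P) Ts (sol i).
  move=> im; have [kK k1] := solK i; split=> //.
  exact: (@leq_bigmax _ (fun i : 'I_m' => load_of P (size_H1 P) (sol i)) (Ordinal im)).
have TsL : Ts < L by have := Lge (size_W P); lia.
have mk11 v : s11 a_mark v = 0.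
  by rewrite /s11 /s10 /s9 /s8 /s7 /s6 /s5 /s4 /s3 /s2 /s1 !exec_frame.
have [lk mk] := @phase_searchP m' P L (2 ^ L) (size_H1 P) (size_K1 P) (size_W P)
   (size_H2 P) (size_K2 P) rest m'0 m'L K1L K2L erefl erefl H1_gt0 Wge H2ge Qge Ts sol solc solr
   s11 ready11 TsL mk11.
rewrite -/s12 in lk mk.
have ready12 : output_ready m' P L (2 ^ L) (size_H1 P) (size_K1 P) n pj quota
                 (s12 a_mark) s12.
  split=> //.
  - split=> //; first by rewrite /s12 /s11 /s10 /s9 /s8 !exec_frame.
      by rewrite /s12 /s11 /s10 /s9 /s8 /s7 /s6 /s5 /s4 !exec_frame.
    by rewrite /s12 /s11 /s10 /s9 /s8 !exec_frame.
  - by move=> j; rewrite /s12 /s11 /s10 /s9 /s8 /s7 /s6 /s5 /s4 !exec_frame // j3.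
  - by move=> d dP; rewrite /s12 /s11 /s10 /s9 /s8 /s7 !exec_frame // q6.
  - split=> // k kK; rewrite /s12 !exec_frame //.
    by have [-> -> -> _ _] := t11 k kK.
have tg12 : s12 v_target 0 = target_of P (2 ^ L) (size_W P) rest.
  by rewrite /s12 exec_frame.
have out12 j : s12 a_out j = 0.
  by rewrite /s12 /s11 /s10 /s9 /s8 /s7 /s6 /s5 /s4 /s3 /s2 /s1 !exec_frame.
have [c [cC om oc]] := @phase_outputP m' P L (2 ^ L) (size_H1 P) (size_K1 P) (size_W P)
   (size_H2 P) (size_K2 P) rest m'0 m'L K1L K2L erefl erefl H1_gt0 Wge H2ge Qge
   n Ts pj quota _ nL PL lk mk erefl (job_range p0)
   (fun d dP => cntE m' p (proj1 (andP dP))) s12 ready12 tg12 out12.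
rewrite -/s13 in om oc.
apply: makespan_min => //; split.
  by apply/forallP => j; apply: om.
move=> b' vb'; apply: leq_trans (bmin b' vb').
apply: leq_trans (_ : quota_load m' p + Ts <= _).
  apply: (config_schedule p0 (c := c)) => //.
  by move=> i im; have [] := cC i im.
(* [Ts] is attained on some machine, where [soll] compares it with the optimal makespan. *)
have [i ->] : exists i : 'I_m', Ts = load_of P (size_H1 P) (sol i).
  by have [|i hi] := @eq_bigmax _ (fun i : 'I_m' => load_of P (size_H1 P) (sol i));
    [rewrite card_ord|exists i].
exact: soll.
Qed.

(** * Running time *)

Definition schedule_program : program := build a_out phases.

Lemma schedule_program_consts : consts_below schedule_program 10.
Proof. by vm_compute. Qed.

Lemma eq_optimal m p a a' : (forall j, j < size p -> a j = a' j) ->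
  optimal_schedule m p a -> optimal_schedule m p a'.
Proof.
move=> E [va oa].
have Em : makespan m p a = makespan m p a'.
  by apply: eq_bigr => i _; apply: eq_bigl => j; rewrite E.
split; last by rewrite -Em.
by apply/forallP => j; rewrite -E //; apply: (forallP va).
Qed.

Definition phases_time : nat := \sum_(c <- phases) time 1 c + 400.

(** The exponent 4 is the nesting depth of [phase_search]: limit, round, configuration, offset. *)
Lemma phases_time_bound L : \sum_(c <- phases) time L c + (300 + 21 * L) <=
  phases_time * L.+1 ^ 4.
Proof.
rewrite /phases_time mulnDl; apply: leq_add.
  rewrite big_distrl /=.
  have : all (fun c => depth c <= 4) phases by [].
  elim: phases => [|c cs IH] /=; first by rewrite !big_nil.
  case/andP=> dc /IH {}IH; rewrite !big_cons; apply: leq_add IH.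
  by apply: leq_trans (time_bound L c) _; rewrite leq_mul2l leq_pexp2l ?orbT.
by rewrite !expnS expn0; nia.
Qed.

Lemma init_regs_lt m p e : m < 2 ^ e -> size p < 2 ^ e -> pmax p < 2 ^ e ->
  forall i, regs (init_state m p) i < 2 ^ e.
Proof.
move=> hm hn hp i /=; case: ifP => // _; case: ifP => // _.
have [lt|ge] := ltnP (i - 2) (size p); last by rewrite nth_default // expn_gt0.
apply: leq_ltn_trans hp; rewrite /pmax (big_nth 0) big_mkord.
exact: (@leq_bigmax _ (fun i : 'I_(size p) => nth 0 p i) (Ordinal lt)).
Qed.

Lemma program_steps m p : 0 < m -> all (fun x => 0 < x) p ->
  exists k s, [/\ reach schedule_program k (init_state m p) s, halted schedule_program s,
    optimal_schedule m p (output_assignment s)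
  & k <= phases_time * (size_L (size p) (pmax p)).+1 ^ 4].
Proof.
move=> m0 p0; have [n0|n0] := posnP (size p).
  have x0 : cexec (CIf 1 (CSeq boot (compile_phases a_out phases)))
              (regs (init_state m p)) (regs (init_state m p)) 1.
    by apply: ExecIf0; rewrite /= n0.
  have h := assemble_correct x0 (P := schedule_program) (pre := [::]) (post := [::]) (l := 0).
  rewrite cats0 in h; have {}h := h erefl erefl (jumps_ok_build a_out phases).
  eexists; eexists; split; first exact: h.
  - by rewrite /halted size_assemble.
  - have E a : makespan m p a = 0.
      by apply: big1 => i _; apply: big1 => -[j jn] _; exfalso; move: jn; rewrite n0.
    split; last by move=> b _; rewrite !E.
    by apply/forallP => -[j jn]; exfalso; move: jn; rewrite n0.
  - by rewrite /phases_time; have : 0 < (size_L (size p) (pmax p)).+1 ^ 4; [rewrite expn_gt0|nia].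
have [hok hopt] := phases_correct m0 p0 n0.
have [|k [s [h1 h2 h3 h4]]] := @build_correct m p (size_L (size p) (pmax p)) a_out phases n0 isT hok.
  by [].
exists k, s; split=> //.
  by apply: eq_optimal hopt => j jn; rewrite /output_assignment h3.
apply: leq_trans h4 _; apply: leq_trans (phases_time_bound _).
rewrite leq_add2l leq_add2l leq_mul2l /size_L leq_pmulr ?orbT // expn_gt0 //.
Qed.

Definition time_factor (P : nat) : nat :=
  (phases_time * 2 ^ (4 * (size_E P).+1)) ^ 2 * (3 * P + 50).

Theorem mainTheorem2 :
  exists (f : nat -> nat) (c : nat) (P : program),
    forall (m : nat) (p : seq nat),
      0 < m -> all (fun x => 0 < x) p ->
      solves_within P m p (f (pmax p) * (size p + trunc_log 2 m + 2) ^ c).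
Proof.
exists time_factor, 8, schedule_program => m p m0 p0.
have [k [s [h1 h2 h3 h4]]] := program_steps m0 p0.
exists k; set P := pmax p in h4 *; set n := size p in h4 *.
set X := n + trunc_log 2 m + 2.
(* Bit length of everything present initially: [m] through its logarithm in [X], [n] and the
   processing times crudely by [n < 2 ^ n] and [P < 2 ^ P], program constants by 10. *)
pose e := X + P + 10.
have e0 : 0 < e by rewrite /e addn_gt0 orbT.
have pow a : a <= e -> 2 ^ a <= 2 ^ e by move=> ae; rewrite leq_exp2l.
have cost := @run_cost schedule_program k (init_state m p) e e0.
have {}cost : (run schedule_program k (init_state m p)).2 <= k * (1 + 3 * (e + k)).
  apply: cost.
    apply: sub_all schedule_program_consts => -[] // _ c hc.
    by apply: leq_trans hc _; apply: pow; rewrite /e leq_addl.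
  apply: init_regs_lt.
  - apply: leq_trans (trunc_log_ltn m (isT : 1 < 2)) _; apply: pow; rewrite /e /X; lia.
  - by apply: leq_trans (ltn_expl n (isT : 1 < 2)) _; apply: pow; rewrite /e /X; lia.
  - by apply: leq_trans (ltn_expl P (isT : 1 < 2)) _; apply: pow; rewrite /e; lia.
have := reach_run h1; case: (run _ _ _) cost => s' t /= cost Es; rewrite Es; split=> //.
apply: leq_trans cost _.
(* Bounds the number of steps, by [L.+1 <= 2 ^ (size_E P).+1 * X]. *)
set Z := phases_time * 2 ^ (4 * (size_E P).+1) * X ^ 4.
have kZ : k <= Z.
  apply: leq_trans h4 _; rewrite /Z -mulnA leq_mul2l; apply/orP; right.
  rewrite [4 * _]mulnC expnM -expnMn leq_exp2r // /size_L expnS.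
  have : 0 < 2 ^ size_E P by rewrite expn_gt0.
  by rewrite /X; move: (2 ^ _) (trunc_log 2 m) => G l; nia.
have XZ : X <= Z.
  have : 0 < 2 ^ (4 * (size_E P).+1) by rewrite expn_gt0.
  have : 0 < phases_time by rewrite /phases_time addn_gt0 orbT.
  have : X <= X ^ 4 by rewrite !expnS expn0; rewrite /X; nia.
  rewrite /Z; move: phases_time (2 ^ _) (X ^ 4) => A B C hC hA hB.
  by apply: leq_trans hC _; rewrite leq_pmull // muln_gt0 hA.
have Z0 : 0 < Z by apply: leq_trans XZ; rewrite /X addn2.
(* Operands have at most [e + k] bits, where [e <= Z + P + 10] and [k <= Z], so the cost is
   quadratic in [Z]; hence the exponent 8 and the square in [time_factor]. *)
have -> : time_factor P * X ^ 8 = Z * Z * (3 * P + 50).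
  by rewrite /time_factor /Z (_ : 8 = 4 * 2) // expnM !mulnn !expnMn; lia.
apply: leq_trans (_ : Z * (1 + 3 * (e + Z)) <= _).
  by apply: leq_mul; lia.
rewrite -mulnA leq_mul2l; apply/orP; right; rewrite /e; move: {kZ} Z XZ Z0 => z XZ Z0; nia.
Qed.
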